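(* Let $F:\mathbb N\to\mathbb R_{\ge 1}$ be increasing with $\lim_{N\to\infty}F(N)=\infty$ and $F(N)\le N^{\eta}$ for all $N$, for some fixed $0<\eta<1/2$. Let $\alpha,\beta\in C^2_0(\mathbb T,\mathbb R)$, let $M=[F(N)]$ with $N\ge N_0$, where $N_0\in\mathbb Z_{\ge1}$ is chosen such that $\lambda^\pm_{2k+1}-\lambda^\pm_{2k}\ge 6$ for all $k\ge F([F(N_0)])$. Then, uniformly for $\lambda$ in the box $\Lambda^{-,M}$, $$\Delta_N\Big(-2+\frac1{4N^2}\lambda\Big)=(-1)^N\Delta_-(\lambda)+O\Big(\frac{F(M)^2}{M}\Big),$$ and, uniformly for $\lambda$ in the box $\Lambda^{+,M}$, $$\Delta_N\Big(2-\frac1{4N^2}\lambda\Big)=\Delta_+(\lambda)+O\Big(\frac{F(M)^2}{M}\Big).$$ These estimates hold uniformly on bounded subsets of functions $\alpha,\beta$ in $C^2_0(\mathbb T,\mathbb R)$.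
   Context: $\mathbb T=\mathbb R/\mathbb Z$; $C^2_0(\mathbb T,\mathbb R)$ is the space of real-valued 1-periodic $C^2$ functions with mean zero. $[x]$ is the integer part. For $N\ge3$, $n\in\mathbb Z$: $b^N_n=\frac1{4N^2}\beta(\frac nN)$, $a^N_n=1+\frac1{4N^2}\alpha(\frac nN)$ (positive for $N$ large). For $\mu\in\mathbb C$ let $y^N_1(k,\mu),y^N_2(k,\mu)$ be the solutions of the difference equation $a^N_{k-1}y(k-1)+b^N_ky(k)+a^N_ky(k+1)=\mu y(k)$, $k\in\mathbb Z$, with $y^N_1(0)=1,\ y^N_1(1)=0$ and $y^N_2(0)=0,\ y^N_2(1)=1$. The discriminant is $\Delta_N(\mu)=y^N_1(N,\mu)+y^N_2(N+1,\mu)$. Let $q_\pm(x)=-2\alpha(2x)\mp\beta(2x)$ and $H_\pm=-\partial_x^2+q_\pm$. Let $y_1^\pm,y_2^\pm$ be the solutions of $-y''+q_\pm y=\lambda y$ with $y_1^\pm(0)=1,(y_1^\pm)'(0)=0$, $y_2^\pm(0)=0,(y_2^\pm)'(0)=1$, and $\Delta_\pm(\lambda)=y_1^\pm(1/2,\lambda)+(y_2^\pm)'(1/2,\lambda)$. Let $\lambda^\pm_0<\lambda^\pm_1\le\lambda^\pm_2<\cdots$ be the periodic eigenvalues of $H_\pm$ on $[0,1]$, with multiplicities. $\Lambda^{\pm,M}=[\lambda^\pm_0-2,\ \lambda^\pm_{2[F(M)]}+2]+i[-2,2]\subset\mathbb C$. Convention: the $O$-estimates are asymptotic as $N\to\infty$,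 i.e. hold with a fixed constant for all sufficiently large $N$; both the constant and the threshold (and $N_0$) can be chosen uniformly on bounded sets of $(\alpha,\beta)$. *)

(* Defs.v *)
From Stdlib Require Import Reals Lra ZArith List.
From Coquelicot Require Import Coquelicot.
Local Open Scope R_scope.

(* Real-valued 1-periodic C^2 functions with mean zero.  Coquelicot's [Derive]
   is total, so differentiability of [f] and of [Derive f] are both required. *)
Definition C2_0 (f : R -> R) : Prop :=
  (forall x, f (x + 1) = f x) /\
  (forall x, ex_derive f x) /\
  (forall x, ex_derive (Derive f) x) /\
  (forall x, continuous (Derive (Derive f)) x) /\
  is_RInt f 0 1 0.

Definition C2_norm_le (B : R) (f : R -> R) : Prop :=
  forall x, Rabs (f x) <= B /\ Rabs (Derive f x) <= B /\
            Rabs (Derive (Derive f) x) <= B.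

(* Meaningful for x >= 0, where truncating to nat loses nothing. *)
Definition integer_part (x : R) : nat := Z.to_nat (Int_part x).

Definition toda_b (beta : R -> R) (N : nat) (n : Z) : R :=
  1 / (4 * INR N ^ 2) * beta (IZR n / INR N).

Definition toda_a (alpha : R -> R) (N : nat) (n : Z) : R :=
  1 + 1 / (4 * INR N ^ 2) * alpha (IZR n / INR N).

Definition difference_solution (alpha beta : R -> R) (N : nat) (mu : C)
    (y : Z -> C) : Prop :=
  forall k : Z,
    (RtoC (toda_a alpha N (k - 1)) * y (k - 1)%Z
     + RtoC (toda_b beta N k) * y k
     + RtoC (toda_a alpha N k) * y (k + 1)%Z = mu * y k)%C.

Definition is_Delta_N (alpha beta : R -> R) (N : nat) (mu D : C) : Prop :=
  exists y1 y2 : Z -> C,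
    difference_solution alpha beta N mu y1 /\
    difference_solution alpha beta N mu y2 /\
    y1 0%Z = RtoC 1 /\ y1 1%Z = RtoC 0 /\
    y2 0%Z = RtoC 0 /\ y2 1%Z = RtoC 1 /\
    D = (y1 (Z.of_nat N) + y2 (Z.of_nat N + 1)%Z)%C.

Definition q_plus (alpha beta : R -> R) (x : R) : R :=
  - 2 * alpha (2 * x) - beta (2 * x).

Definition q_minus (alpha beta : R -> R) (x : R) : R :=
  - 2 * alpha (2 * x) + beta (2 * x).

(* [y] solves -y'' + q y = lambda y on the real line, and [dy] is y'. *)
Definition schrodinger_solution (q : R -> R) (lambda : C) (y dy : R -> C) : Prop :=
  exists ddy : R -> C,
    (forall x, @is_derive R_AbsRing C_R_NormedModule y x (dy x)) /\
    (forall x, @is_derive R_AbsRing C_R_NormedModule dy x (ddy x)) /\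
    (forall x, (- ddy x + RtoC (q x) * y x = lambda * y x)%C).

(* The discriminant is taken over the half interval [0, 1/2], the period of
   [q_plus] and [q_minus]. *)
Definition is_Delta_H (q : R -> R) (lambda D : C) : Prop :=
  exists y1 dy1 y2 dy2 : R -> C,
    schrodinger_solution q lambda y1 dy1 /\
    schrodinger_solution q lambda y2 dy2 /\
    y1 0 = RtoC 1 /\ dy1 0 = RtoC 0 /\
    y2 0 = RtoC 0 /\ dy2 0 = RtoC 1 /\
    D = (y1 (1 / 2)%R + dy2 (1 / 2)%R)%C.

Definition periodic_eigenspace (q : R -> R) (mu : C) (y : R -> C) : Prop :=
  (exists dy : R -> C, schrodinger_solution q mu y dy) /\
  (forall x, y (x + 1) = y x).

Definition lin_comb (cs : list C) (fs : list (R -> C)) (x : R) : C :=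
  fold_right Cplus (RtoC 0)
    (map (fun p : C * (R -> C) => (fst p * snd p x)%C) (combine cs fs)).

Definition is_basis (E : (R -> C) -> Prop) (fs : list (R -> C)) : Prop :=
  List.Forall E fs /\
  (forall cs : list C, List.length cs = List.length fs ->
     (forall x, lin_comb cs fs x = RtoC 0) -> List.Forall (fun c => c = RtoC 0) cs) /\
  (forall f, E f ->
     exists cs : list C, List.length cs = List.length fs /\
       forall x, f x = lin_comb cs fs x).

Definition has_dim (E : (R -> C) -> Prop) (d : nat) : Prop :=
  exists fs : list (R -> C), List.length fs = d /\ is_basis E fs.

(* [lam] lists the eigenvalues of -d^2/dx^2 + q with 1-periodic boundary
   conditions in nondecreasing order, each complex number [mu] occurring as
   often as the complex dimension of its eigenspace.  These conditions
   determine [lam]. *)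
Definition periodic_eigenvalues (q : R -> R) (lam : nat -> R) : Prop :=
  (forall n, lam n <= lam (S n)) /\
  (forall mu : C, exists l : list nat,
     List.NoDup l /\ (forall n, List.In n l <-> RtoC (lam n) = mu) /\
     has_dim (periodic_eigenspace q mu) (List.length l)).

Definition gap_condition (F : nat -> R) (lam : nat -> R) (N0 : nat) : Prop :=
  forall k : nat, F (integer_part (F N0)) <= INR k ->
    lam (2 * k + 1)%nat - lam (2 * k)%nat >= 6.

Definition in_box (F : nat -> R) (lam : nat -> R) (M : nat) (z : C) : Prop :=
  lam 0%nat - 2 <= Re z <= lam (2 * integer_part (F M))%nat + 2 /\
  -2 <= Im z <= 2.

(* Main.v *)
Require Import Defs.
From Stdlib Require Import Reals Lra Lia ZArith List Classical ClassicalEpsilon.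
From Coquelicot Require Import Coquelicot.
Local Open Scope R_scope.

(** For real [lambda] let [M(lambda)] be the monodromy matrix of [y'' = (q - lambda) y]
    over [[0, 1]] and [f = tr M].  Variation of constants writes [f'] as the integral of
    a quadratic form in the fundamental solutions whose discriminant is [f^2 - 4]; hence
    [f' <> 0] wherever [|f| < 2], and also where [f = 2] unless [M] is the identity, in
    which case [det M = 1] forces a strict local maximum.  The eigenvalues are the zeros
    of [f - 2], double exactly when [M] is the identity, so [f - 2] has sign [(-1)^n] on
    the interval ending at [lambda_n].  Between [lambda_{2k}] and [lambda_{2k+1}] the
    function [f] therefore dips below 2, and being without critical value in [(-2, 2)] it
    reaches [-2]; since [|f'|] is [O(lambda^{-1/2})], the gap is at least of order
    [lambda_{2k}^{1/2}].  Comparison with [2 cos (sqrt lambda)] gives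
    [lambda_{2n} = O(n^2)], so on the boxes [|lambda| = O(F(M)^2)].

    With step [h = 1 / (2 N)] the difference equation becomes, for
    [p_k = a_k (z_{k+1} - z_k) / h], a symplectic Euler scheme for [-z'' + q z = lambda z].
    In the norm [w |z| + |p|], [w^2 ~ lambda], its local error is [O(h^2 w^2)] and its
    growth per step is [1 + O(h)], so the traces differ by
    [O(h w^2) = O(F(M)^2 / N)], and [M <= N]. *)

(** * Linear second order equations *)

(** The spectrum is given only as a list counted with multiplicity, so its bounds and gaps are read
    off from the discriminant, with constants depending on [B] alone. This is possible because every
    estimate is centred at [- w ^ 2], where [w ^ 2] differs from [lambda] by a bounded amount: the
    energy [|y'| ^ 2 + w ^ 2 |y| ^ 2] then grows at a rate independent of [lambda], while an
    unweighted Gronwall estimate would cost a factor exponential in [lambda], useless on growing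
    boxes. In the comparison [w ^ 2 = Re lambda + 3 B + 3]; as [lambda_0 >= - 3 B], this gives
    [w >= 1] on the whole box, down to [Re lambda = lambda_0 - 2].

    Two discriminants of the Schroedinger operator occur. The one over [[0, 1]], for real [lambda],
    governs the periodic spectrum; the one over [[0, 1/2]], for complex [lambda], is the limit of
    the [N] steps of the scheme. The gap bound yields the existence of [N0], and the bounds on
    [lambda_0] and [lambda_{2n}] control the boxes. On these [h w ^ 2] stays bounded because
    [F(M) ^ 2 <= M <= N], and this makes the growth over all [N] steps bounded. *)

Lemma is_derive_eq (f : R -> R) (x l l' : R) :
  is_derive f x l -> l = l' -> is_derive f x l'.
Proof. now intros H <-. Qed.

Lemma is_derive_continuous (f : R -> R) (x l : R) :
  is_derive f x l -> continuous f x.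
Proof. intros H. apply (ex_derive_continuous (V := R_NormedModule)). now exists l. Qed.

Lemma is_derive_continuity_pt (f : R -> R) (x l : R) :
  is_derive f x l -> continuity_pt f x.
Proof. intros H. apply continuity_pt_filterlim. now apply is_derive_continuous with l. Qed.

Lemma mean_value (f df : R -> R) (a b : R) :
  a <= b -> (forall x, a <= x <= b -> is_derive f x (df x)) ->
  exists c, a <= c <= b /\ f b - f a = df c * (b - a).
Proof.
intros Hab Hd.
destruct (MVT_gen f a b df) as [c [Hc E]].
- intros x. rewrite Rmin_left, Rmax_right by lra. intros Hx. apply Hd. lra.
- intros x. rewrite Rmin_left, Rmax_right by lra. intros Hx.
  now apply is_derive_continuity_pt with (df x), Hd.
- rewrite Rmin_left, Rmax_right in Hc by lra. now exists c.
Qed.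

Lemma derive_nonneg_le (f df : R -> R) (a b : R) :
  a <= b -> (forall x, a <= x <= b -> is_derive f x (df x)) ->
  (forall x, a <= x <= b -> 0 <= df x) -> f a <= f b.
Proof.
intros Hab Hd H0. destruct (mean_value f df a b Hab Hd) as [c [Hc E]].
specialize (H0 c Hc). nra.
Qed.

Lemma derive_pos_lt (f df : R -> R) (a b : R) :
  a < b -> (forall x, a <= x <= b -> is_derive f x (df x)) ->
  (forall x, a <= x <= b -> 0 < df x) -> f a < f b.
Proof.
intros Hab Hd H0. destruct (mean_value f df a b (Rlt_le _ _ Hab) Hd) as [c [Hc E]].
specialize (H0 c Hc). nra.
Qed.

Lemma derive_abs_le (f df : R -> R) (a b K : R) :
  a <= b -> (forall x, a <= x <= b -> is_derive f x (df x)) ->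
  (forall x, a <= x <= b -> Rabs (df x) <= K) -> Rabs (f b - f a) <= K * (b - a).
Proof.
intros Hab Hd HK. destruct (mean_value f df a b Hab Hd) as [c [Hc E]].
rewrite E, Rabs_mult, (Rabs_right (b - a)) by lra.
apply Rmult_le_compat_r; [lra | now apply HK].
Qed.

Lemma derive_zero_const (f : R -> R) (a b : R) :
  (forall x, is_derive f x 0) -> f a = f b.
Proof.
assert (H : forall f a b, (forall x, is_derive f x 0) -> a <= b -> f a = f b).
{ intros g u v Hg Huv. destruct (mean_value g (fun _ => 0) u v Huv) as [c [_ E]].
  - intros; apply Hg.
  - lra. }
intros Hf. destruct (Rle_lt_dec a b).
- now apply H.
- symmetry. apply H; auto. lra.
Qed.

Lemma gronwall (E dE : R -> R) (k b : R) :
  0 <= b -> (forall x, 0 <= x <= b -> is_derive E x (dE x)) ->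
  (forall x, 0 <= x <= b -> dE x <= k * E x) -> E b <= E 0 * exp (k * b).
Proof.
intros Hb Hd Hle.
assert (H : - (E 0 * exp (- k * 0)) <= - (E b * exp (- k * b))).
{ apply (derive_nonneg_le (fun x => - (E x * exp (- k * x)))
           (fun x => (k * E x - dE x) * exp (- k * x))); auto.
  - intros x Hx. specialize (Hd x Hx). auto_derive.
    + now exists (dE x).
    + replace (Derive (fun t : R => E t) x) with (dE x) by (symmetry; now apply is_derive_unique). ring.
  - intros x Hx. apply Rmult_le_pos.
    + specialize (Hle x Hx). lra.
    + left; apply exp_pos. }
replace (- k * 0) with 0 in H by ring. rewrite exp_0 in H.
replace (k * b) with (- (- k * b)) by ring. rewrite exp_Ropp.
assert (P := exp_pos (- k * b)).
apply Rmult_le_reg_r with (exp (- k * b)); [exact P|].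
rewrite Rmult_assoc, Rinv_l by lra. lra.
Qed.

Lemma derive_const (c x : R) : is_derive (fun _ => c) x 0.
Proof. apply (@is_derive_const R_AbsRing R_NormedModule). Qed.

Lemma derive_plus (f g : R -> R) (x df dg : R) :
  is_derive f x df -> is_derive g x dg -> is_derive (fun t => f t + g t) x (df + dg).
Proof. apply (@is_derive_plus R_AbsRing R_NormedModule). Qed.

Lemma derive_minus (f g : R -> R) (x df dg : R) :
  is_derive f x df -> is_derive g x dg -> is_derive (fun t => f t - g t) x (df - dg).
Proof. apply (@is_derive_minus R_AbsRing R_NormedModule). Qed.

Lemma derive_mult (f g : R -> R) (x df dg : R) :
  is_derive f x df -> is_derive g x dg ->
  is_derive (fun t => f t * g t) x (df * g x + f x * dg).
Proof. intros Hf Hg. apply (is_derive_mult f g x df dg Hf Hg). exact Rmult_comm. Qed.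

Lemma derive_scal (c : R) (f : R -> R) (x df : R) :
  is_derive f x df -> is_derive (fun t => c * f t) x (c * df).
Proof. intros Hf. exact (is_derive_scal f x c df Hf). Qed.

Lemma derive_primitive (f : R -> R) (a x : R) :
  (forall y, continuous f y) -> is_derive (fun t => a + RInt f 0 t) x (f x).
Proof.
intros Hf. apply is_derive_eq with (plus 0 (f x)); [|apply Rplus_0_l].
apply (@is_derive_plus R_AbsRing R_NormedModule (fun _ => a)).
- apply derive_const.
- apply (is_derive_RInt f (fun t => RInt f 0 t) 0 x); auto.
  apply filter_forall. intros t. apply (@RInt_correct R_CompleteNormedModule).
  apply (@ex_RInt_continuous R_CompleteNormedModule). auto.
Qed.

Definition linear_solution (Q y dy : R -> R) : Prop :=
  (forall x, is_derive y x (dy x)) /\ (forall x, is_derive dy x (Q x * y x)).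

(** * Existence of solutions by Picard iteration *)

Section Picard.

Variables (Q : R -> R) (a b : R).

Fixpoint picard (n : nat) : (R -> R) * (R -> R) :=
  match n with
  | O => (fun _ => a, fun _ => b)
  | S m => (fun x => a + RInt (snd (picard m)) 0 x,
            fun x => b + RInt (fun t => Q t * fst (picard m) t) 0 x)
  end.

Hypothesis Q_cont : forall x, continuous Q x.

Lemma picard_cont n :
  (forall x, continuous (fst (picard n)) x) /\ (forall x, continuous (snd (picard n)) x).
Proof.
induction n as [|n [IH1 IH2]]; simpl.
- split; intros x; apply continuous_const.
- split; intros x.
  + apply is_derive_continuous with (snd (picard n) x). now apply derive_primitive.
  + apply is_derive_continuous with (Q x * fst (picard n) x).
    apply (derive_primitive (fun t => Q t * fst (picard n) t)).
    intros y. apply (continuous_mult (K := R_AbsRing) Q (fst (picard n)) y); auto.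
Qed.

Lemma picard_derive n x :
  is_derive (fst (picard (S n))) x (snd (picard n) x) /\
  is_derive (snd (picard (S n))) x (Q x * fst (picard n) x).
Proof.
destruct (picard_cont n) as [H1 H2]. split; simpl.
- now apply derive_primitive.
- apply (derive_primitive (fun t => Q t * fst (picard n) t)).
  intros y. apply (continuous_mult (K := R_AbsRing) Q (fst (picard n)) y); auto.
Qed.

Lemma picard_0 n : fst (picard n) 0 = a /\ snd (picard n) 0 = b.
Proof.
destruct n; simpl; auto. rewrite !RInt_point. unfold zero; simpl. split; ring.
Qed.

(** Both [K t^(n+1) / (n+1)! - f] and [K t^(n+1) / (n+1)! + f] are nondecreasing, which takes the
    place of integrating [df]. *)
Lemma power_bound_primitive_nonneg (f df : R -> R) (K : R) (n : nat) (x : R) :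
  0 <= x -> f 0 = 0 -> (forall t, 0 <= t -> is_derive f t (df t)) ->
  (forall t, 0 <= t -> Rabs (df t) <= K * (t ^ n / INR (fact n))) ->
  Rabs (f x) <= K * (x ^ S n / INR (fact (S n))).
Proof.
intros Hx H0 Hd HK.
assert (Hp : forall t, is_derive (fun t => K * (t ^ S n / INR (fact (S n)))) t
                         (K * (t ^ n / INR (fact n)))).
{ intros t. auto_derive; auto.
  change (fact n + n * fact n)%nat with (S n * fact n)%nat. rewrite mult_INR.
  change (match n with O => 1 | S _ => INR n + 1 end) with (INR (S n)).
  assert (INR (fact n) <> 0) by apply INR_fact_neq_0.
  assert (INR (S n) <> 0) by now apply not_0_INR.
  field. auto. }
assert (A : forall s, s = 1 \/ s = -1 -> s * f x <= K * (x ^ S n / INR (fact (S n)))).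
{ intros s Hs.
  assert (B : K * (0 ^ S n / INR (fact (S n))) - s * f 0 <=
              K * (x ^ S n / INR (fact (S n))) - s * f x).
  { apply (derive_nonneg_le (fun t => K * (t ^ S n / INR (fact (S n))) - s * f t)
             (fun t => K * (t ^ n / INR (fact n)) - s * df t)); auto.
    - intros t Ht. apply derive_minus.
      + apply Hp.
      + apply derive_scal. apply Hd. lra.
    - intros t Ht. specialize (HK t (proj1 Ht)). apply Rabs_le_between in HK.
      destruct Hs; subst s; lra. }
  rewrite H0, pow_i in B by lia. unfold Rdiv in B at 1. lra. }
assert (A1 := A 1 (or_introl eq_refl)). assert (A2 := A (-1) (or_intror eq_refl)).
apply Rabs_le. lra.
Qed.

Lemma power_bound_primitive (f df : R -> R) (K : R) (n : nat) (x : R) :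
  f 0 = 0 -> (forall t, is_derive f t (df t)) ->
  (forall t, Rabs (df t) <= K * (Rabs t ^ n / INR (fact n))) ->
  Rabs (f x) <= K * (Rabs x ^ S n / INR (fact (S n))).
Proof.
intros H0 Hd HK. destruct (Rle_lt_dec 0 x) as [Hx|Hx].
- rewrite (Rabs_right x) by lra.
  apply power_bound_primitive_nonneg with df; auto.
  intros t Ht. specialize (HK t). rewrite (Rabs_right t) in HK by lra. exact HK.
- rewrite (Rabs_left x) by lra.
  assert (A := power_bound_primitive_nonneg (fun t => f (- t)) (fun t => - df (- t)) K n (- x)).
  cbv beta in A. rewrite Ropp_involutive in A. apply A.
  + lra.
  + now rewrite Ropp_0.
  + intros t _. apply is_derive_eq with (scal (-1) (df (- t))).
    * apply (@is_derive_comp R_AbsRing R_NormedModule f (fun t => - t)); auto.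
      auto_derive; auto.
    * unfold scal; simpl; unfold mult; simpl; ring.
  + intros t Ht. rewrite Rabs_Ropp. specialize (HK (- t)).
    rewrite Rabs_Ropp, (Rabs_right t) in HK by lra. exact HK.
Qed.

Variable K : R.
Hypothesis K_ge1 : 1 <= K.
Hypothesis Q_le : forall x, Rabs (Q x) <= K.

(** Since [1 <= K], one bound serves both components: the first integrates the second with
    coefficient 1, the second integrates the first with coefficient [Q], and both coefficients are
    at most [K]. *)
Lemma picard_diff n x :
  Rabs (fst (picard (S n)) x - fst (picard n) x) <=
    (Rabs a + Rabs b) * K ^ S n * (Rabs x ^ S n / INR (fact (S n))) /\
  Rabs (snd (picard (S n)) x - snd (picard n) x) <=
    (Rabs a + Rabs b) * K ^ S n * (Rabs x ^ S n / INR (fact (S n))).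
Proof.
assert (Pa := Rabs_pos a). assert (Pb := Rabs_pos b).
revert x. induction n as [|n IH]; intros x.
- split.
  + apply (power_bound_primitive (fun x => fst (picard 1) x - a)
             (fun _ => b - 0)).
    * rewrite !(proj1 (picard_0 _)). ring.
    * intros t. apply derive_minus.
      -- apply (picard_derive 0).
      -- apply derive_const.
    * intros t. rewrite Rminus_0_r. simpl. unfold Rdiv. rewrite Rinv_1. nra.
  + apply (power_bound_primitive (fun x => snd (picard 1) x - b)
             (fun x => Q x * a - 0)).
    * rewrite !(proj2 (picard_0 _)). ring.
    * intros t. apply derive_minus.
      -- apply (picard_derive 0).
      -- apply derive_const.
    * intros t. rewrite Rminus_0_r, Rabs_mult. simpl. unfold Rdiv. rewrite Rinv_1.
      specialize (Q_le t). assert (0 <= Rabs (Q t)) by apply Rabs_pos. nra.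
- split.
  + apply (power_bound_primitive (fun x => fst (picard (S (S n))) x - fst (picard (S n)) x)
             (fun x => snd (picard (S n)) x - snd (picard n) x)).
    * rewrite !(proj1 (picard_0 _)). ring.
    * intros t. apply derive_minus; apply picard_derive.
    * intros t. eapply Rle_trans; [apply IH|].
      assert (0 <= Rabs t ^ S n / INR (fact (S n))).
      { apply Rmult_le_pos; [apply pow_le, Rabs_pos|].
        left; apply Rinv_0_lt_compat, INR_fact_lt_0. }
      apply Rmult_le_compat_r; auto.
      apply Rmult_le_compat_l; [lra|].
      rewrite <- (Rmult_1_l (K ^ S n)). change (K ^ S (S n)) with (K * K ^ S n).
      apply Rmult_le_compat_r; auto. apply pow_le; lra.
  + apply (power_bound_primitive (fun x => snd (picard (S (S n))) x - snd (picard (S n)) x)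
             (fun x => Q x * fst (picard (S n)) x - Q x * fst (picard n) x)).
    * rewrite !(proj2 (picard_0 _)). ring.
    * intros t. apply derive_minus; apply picard_derive.
    * intros t. rewrite <- Rmult_minus_distr_l, Rabs_mult.
      destruct (IH t) as [H _].
      apply Rle_trans with (K * ((Rabs a + Rabs b) * K ^ S n * (Rabs t ^ S n / INR (fact (S n))))).
      -- apply Rmult_le_compat; auto; apply Rabs_pos.
      -- right. simpl. ring.
Qed.

Lemma exp_series_cauchy (r eps : R) :
  0 < eps -> exists N, forall n p, (N <= n)%nat ->
    sum_f_R0 (fun k => r ^ k / INR (fact k)) (n + p) - sum_f_R0 (fun k => r ^ k / INR (fact k)) n < eps.
Proof.
intros He.
assert (C : Cauchy_crit (sum_f_R0 (fun k => r ^ k / INR (fact k)))).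
{ apply CV_Cauchy. exists (exp r). unfold exp. destruct (exist_exp r) as [l Hl]. simpl.
  unfold exp_in, infinite_sum in Hl. intros e Hep. destruct (Hl e Hep) as [N HN].
  exists N. intros n Hn. specialize (HN n Hn).
  rewrite (sum_eq (fun k => r ^ k / INR (fact k)) (fun i => / INR (fact i) * r ^ i)); auto.
  intros; unfold Rdiv; ring. }
destruct (C eps He) as [N HN]. exists N. intros n p Hn.
assert (H : Rdist (sum_f_R0 (fun k => r ^ k / INR (fact k)) (n + p))
              (sum_f_R0 (fun k => r ^ k / INR (fact k)) n) < eps) by (apply HN; lia).
unfold Rdist in H. apply Rabs_def2 in H. lra.
Qed.

Lemma picard_diff_sum (r x : R) n p : Rabs x <= r ->
  Rabs (fst (picard (n + p)) x - fst (picard n) x) <=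
    (Rabs a + Rabs b) * (sum_f_R0 (fun k => (K * r) ^ k / INR (fact k)) (n + p) -
                         sum_f_R0 (fun k => (K * r) ^ k / INR (fact k)) n) /\
  Rabs (snd (picard (n + p)) x - snd (picard n) x) <=
    (Rabs a + Rabs b) * (sum_f_R0 (fun k => (K * r) ^ k / INR (fact k)) (n + p) -
                         sum_f_R0 (fun k => (K * r) ^ k / INR (fact k)) n).
Proof.
intros Hx. assert (Pa := Rabs_pos a). assert (Pb := Rabs_pos b).
induction p as [|p [IH1 IH2]].
- rewrite Nat.add_0_r, !Rminus_diag, !Rabs_R0. lra.
- rewrite Nat.add_succ_r. set (m := (n + p)%nat) in *.
  destruct (picard_diff m x) as [D1 D2].
  assert (B : (Rabs a + Rabs b) * K ^ S m * (Rabs x ^ S m / INR (fact (S m))) <=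
              (Rabs a + Rabs b) * ((K * r) ^ S m / INR (fact (S m)))).
  { rewrite Rpow_mult_distr. unfold Rdiv. rewrite <- !Rmult_assoc.
    apply Rmult_le_compat_r; [left; apply Rinv_0_lt_compat, INR_fact_lt_0|].
    rewrite !Rmult_assoc.
    apply Rmult_le_compat_l; [lra|]. apply Rmult_le_compat_l; [apply pow_le; lra|].
    apply pow_incr. split; auto. apply Rabs_pos. }
  rewrite tech5. split.
  + replace (fst (picard (S m)) x - fst (picard n) x)
      with ((fst (picard (S m)) x - fst (picard m) x) + (fst (picard m) x - fst (picard n) x)) by ring.
    eapply Rle_trans; [apply Rabs_triang|]. cbv beta. lra.
  + replace (snd (picard (S m)) x - snd (picard n) x)
      with ((snd (picard (S m)) x - snd (picard m) x) + (snd (picard m) x - snd (picard n) x)) by ring.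
    eapply Rle_trans; [apply Rabs_triang|]. cbv beta. lra.
Qed.

Lemma picard_cauchy (r eps : R) : 0 < eps -> exists N, forall n m x,
  (N <= n)%nat -> (N <= m)%nat -> Rabs x <= r ->
  Rabs (fst (picard n) x - fst (picard m) x) < eps /\
  Rabs (snd (picard n) x - snd (picard m) x) < eps.
Proof.
intros He. assert (Pa := Rabs_pos a). assert (Pb := Rabs_pos b).
assert (He' : 0 < eps / (Rabs a + Rabs b + 1)) by (apply Rdiv_lt_0_compat; lra).
destruct (exp_series_cauchy (K * r) _ He') as [N HN]. exists N.
assert (A : forall n p x, (N <= n)%nat -> Rabs x <= r ->
  Rabs (fst (picard (n + p)) x - fst (picard n) x) < eps /\
  Rabs (snd (picard (n + p)) x - snd (picard n) x) < eps).
{ intros n p x Hn Hx. specialize (HN n p Hn).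
  destruct (picard_diff_sum r x n p Hx) as [D1 D2].
  assert (E : eps / (Rabs a + Rabs b + 1) * (Rabs a + Rabs b + 1) = eps) by (field; lra).
  assert (G : (Rabs a + Rabs b) * (sum_f_R0 (fun k => (K * r) ^ k / INR (fact k)) (n + p) -
                         sum_f_R0 (fun k => (K * r) ^ k / INR (fact k)) n) < eps).
  { apply Rle_lt_trans with ((Rabs a + Rabs b) * (eps / (Rabs a + Rabs b + 1))).
    - apply Rmult_le_compat_l; lra.
    - lra. }
  lra. }
intros n m x Hn Hm Hx. destruct (Nat.le_ge_cases n m) as [L|L].
- rewrite Rabs_minus_sym, (Rabs_minus_sym (snd _ x)).
  replace m with (n + (m - n))%nat by lia. now apply A.
- replace n with (m + (n - m))%nat by lia. now apply A.
Qed.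

(** On a bounded open interval around [x] the iterates and their derivatives converge uniformly, so
    differentiation passes to the limit. The index is shifted by one because only [picard (S n)] is
    a primitive built from the preceding stage. *)
Lemma picard_limit_derive (x : R) :
  is_derive (fun x => real (Lim_seq (fun n => fst (picard n) x))) x
    (real (Lim_seq (fun n => snd (picard n) x))) /\
  is_derive (fun x => real (Lim_seq (fun n => snd (picard n) x))) x
    (Q x * real (Lim_seq (fun n => fst (picard n) x))).
Proof.
set (r := Rabs x + 1). set (D := fun t => - r < t < r).
assert (DO : open D).
{ apply open_and; [apply open_gt | apply open_lt]. }
assert (DC : is_connected D).
{ intros u v w Hu Hv Hw. unfold D in *. lra. }
assert (DX : D x).
{ unfold D, r. assert (H := Rabs_pos x). unfold Rabs in *. destruct (Rcase_abs x); lra. }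
assert (DB : forall t, D t -> Rabs t <= r) by (intros t Ht; apply Rabs_le; unfold D in Ht; lra).
assert (D1 : forall n t, Derive (fst (picard (S n))) t = snd (picard n) t).
{ intros n t. apply is_derive_unique, picard_derive. }
assert (D2 : forall n t, Derive (snd (picard (S n))) t = Q t * fst (picard n) t).
{ intros n t. apply is_derive_unique, picard_derive. }
assert (C2 : CVU_dom (fun n t => Q t * fst (picard n) t) D).
{ apply CVU_dom_cauchy. intros eps.
  assert (He : 0 < eps / K) by (apply Rdiv_lt_0_compat; [apply cond_pos | lra]).
  destruct (picard_cauchy r _ He) as [N HN].
  exists N. intros n m t Ht Hn Hm.
  rewrite <- Rmult_minus_distr_l, Rabs_mult.
  apply Rle_lt_trans with (K * Rabs (fst (picard n) t - fst (picard m) t)).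
  - apply Rmult_le_compat_r; auto. apply Rabs_pos.
  - replace (pos eps) with (K * (eps / K)) by (field; lra).
    apply Rmult_lt_compat_l; [lra|]. now apply HN; auto. }
split.
- apply is_derive_ext with (fun x => real (Lim_seq (fun n => fst (picard (S n)) x))).
  { intros t. now rewrite (Lim_seq_incr_1 (fun n => fst (picard n) t)). }
  rewrite (Lim_seq_ext _ (fun n => Derive (fst (picard (S n))) x)) by (intros; now rewrite D1).
  apply (CVU_Derive (fun n => fst (picard (S n))) D); auto.
  + apply CVU_dom_cauchy. intros eps. destruct (picard_cauchy r eps (cond_pos eps)) as [N HN].
    exists N. intros n m t Ht Hn Hm. apply HN; auto.
  + intros n t _. exists (snd (picard n) t). apply picard_derive.
  + intros n t _. apply continuity_pt_filterlim.
    apply (continuous_ext (snd (picard n))); [intros; now rewrite D1|].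
    apply picard_cont.
  + apply CVU_dom_cauchy. intros eps. destruct (picard_cauchy r eps (cond_pos eps)) as [N HN].
    exists N. intros n m t Ht Hn Hm. rewrite !D1. apply HN; auto.
- apply is_derive_ext with (fun x => real (Lim_seq (fun n => snd (picard (S n)) x))).
  { intros t. now rewrite (Lim_seq_incr_1 (fun n => snd (picard n) t)). }
  replace (Q x * real (Lim_seq (fun n => fst (picard n) x)))
    with (real (Lim_seq (fun n => Derive (snd (picard (S n))) x))).
  2:{ rewrite (Lim_seq_ext _ (fun n => Q x * fst (picard n) x)) by (intros; now rewrite D2).
      rewrite Lim_seq_scal_l. 
      (* The infinite cases are contradictory, the sequence being Cauchy. *)
      destruct (Lim_seq (fun n => fst (picard n) x)) as [l| |] eqn:El; simpl; auto.
      all: exfalso.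
      all: assert (X : ex_finite_lim_seq (fun n => fst (picard n) x)) by
        (apply ex_lim_seq_cauchy_corr; intros eps;
         destruct (picard_cauchy r eps (cond_pos eps)) as [N HN]; exists N;
         intros n m Hn Hm; apply HN; auto).
      all: destruct X as [l Hl]; apply is_lim_seq_unique in Hl; congruence. }
  apply (CVU_Derive (fun n => snd (picard (S n))) D); auto.
  + apply CVU_dom_cauchy. intros eps. destruct (picard_cauchy r eps (cond_pos eps)) as [N HN].
    exists N. intros n m t Ht Hn Hm. apply HN; auto.
  + intros n t _. exists (Q t * fst (picard n) t). apply picard_derive.
  + intros n t _. apply continuity_pt_filterlim.
    apply (continuous_ext (fun t => Q t * fst (picard n) t)); [intros; now rewrite D2|].
    apply (continuous_mult (K := R_AbsRing) Q (fst (picard n)) t); auto. apply picard_cont.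
  + apply CVU_dom_cauchy. apply CVU_dom_cauchy in C2. intros eps. destruct (C2 eps) as [N HN].
    exists N. intros n m t Ht Hn Hm. rewrite !D2. now apply HN.
Qed.

End Picard.

Lemma linear_solution_exists (Q : R -> R) (K a b : R) :
  (forall x, continuous Q x) -> (forall x, Rabs (Q x) <= K) ->
  exists y dy, linear_solution Q y dy /\ y 0 = a /\ dy 0 = b.
Proof.
intros HQ HK.
exists (fun x => real (Lim_seq (fun n => fst (picard Q a b n) x))).
exists (fun x => real (Lim_seq (fun n => snd (picard Q a b n) x))).
assert (HK' : forall x, Rabs (Q x) <= Rmax 1 K).
{ intros x. eapply Rle_trans; [apply HK | apply Rmax_r]. }
split; [split; intros x; apply (picard_limit_derive Q a b HQ (Rmax 1 K) (Rmax_l _ _) HK')|].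
split.
- rewrite (Lim_seq_ext _ (fun _ => a)) by (intros; apply picard_0). now rewrite Lim_seq_const.
- rewrite (Lim_seq_ext _ (fun _ => b)) by (intros; apply picard_0). now rewrite Lim_seq_const.
Qed.

(** * Fundamental systems, variation of constants and energy estimates *)

Definition fundamental_system (Q y1 d1 y2 d2 : R -> R) : Prop :=
  linear_solution Q y1 d1 /\ linear_solution Q y2 d2 /\
  y1 0 = 1 /\ d1 0 = 0 /\ y2 0 = 0 /\ d2 0 = 1.

Lemma linear_solution_cont (Q y d : R -> R) (x : R) :
  linear_solution Q y d -> continuous y x.
Proof. intros [H _]. now apply is_derive_continuous with (d x). Qed.

Lemma continuous_mul (f g : R -> R) (x : R) :
  continuous f x -> continuous g x -> continuous (fun t => f t * g t) x.
Proof. apply (continuous_mult (K := R_AbsRing) f g x). Qed.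

Lemma continuous_sub (f g : R -> R) (x : R) :
  continuous f x -> continuous g x -> continuous (fun t => f t - g t) x.
Proof. apply (continuous_minus (V := R_NormedModule) f g x). Qed.

Lemma wronskian (Q y1 d1 y2 d2 : R -> R) :
  fundamental_system Q y1 d1 y2 d2 -> forall x, y1 x * d2 x - y2 x * d1 x = 1.
Proof.
intros [[H1 H1'] [[H2 H2'] [E1 [E2 [E3 E4]]]]] x.
rewrite (derive_zero_const (fun x => y1 x * d2 x - y2 x * d1 x) x 0).
- rewrite E1, E2, E3, E4. ring.
- intros t. eapply is_derive_eq.
  + apply derive_minus; apply derive_mult; auto.
  + ring.
Qed.

Section Lagrange.

Variables (Q P y1 d1 y2 d2 z dz : R -> R).
Hypotheses (Q_cont : forall x, continuous Q x) (P_cont : forall x, continuous P x).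
Hypothesis fund : fundamental_system Q y1 d1 y2 d2.
Hypothesis sol : linear_solution P z dz.

(* The coordinates of [(z, z')] in the basis
   [(y1, y1'), (y2, y2')] move only through the difference of the potentials. *)
Lemma variation_of_constants (x : R) :
  z x = y1 x * (z 0 + RInt (fun t => (Q t - P t) * (y2 t * z t)) 0 x) +
        y2 x * (dz 0 - RInt (fun t => (Q t - P t) * (y1 t * z t)) 0 x) /\
  dz x = d1 x * (z 0 + RInt (fun t => (Q t - P t) * (y2 t * z t)) 0 x) +
         d2 x * (dz 0 - RInt (fun t => (Q t - P t) * (y1 t * z t)) 0 x).
Proof.
assert (W := wronskian _ _ _ _ _ fund x).
destruct fund as [[H1 H1'] [[H2 H2'] [E1 [E2 [E3 E4]]]]]. destruct sol as [Hz Hz'].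
assert (C : forall y d, linear_solution Q y d -> forall x,
   continuous (fun t => (Q t - P t) * (y t * z t)) x).
{ intros y d Hy t. apply continuous_mul.
  - now apply continuous_sub.
  - apply continuous_mul; eapply linear_solution_cont; eauto. }
(* As the Wronskian is 1, the coordinates of [(z, z')] are [d2 z - y2 z'] and [y1 z' - d1 z]; their
   derivatives are [(Q - P) y2 z] and [- (Q - P) y1 z]. *)
assert (A1 : d2 x * z x - y2 x * dz x = z 0 + RInt (fun t => (Q t - P t) * (y2 t * z t)) 0 x).
{ assert (D : (d2 x * z x - y2 x * dz x) - (z 0 + RInt (fun t => (Q t - P t) * (y2 t * z t)) 0 x) =
              (d2 0 * z 0 - y2 0 * dz 0) - (z 0 + RInt (fun t => (Q t - P t) * (y2 t * z t)) 0 0)).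
  { apply (derive_zero_const (fun x => (d2 x * z x - y2 x * dz x)
              - (z 0 + RInt (fun t => (Q t - P t) * (y2 t * z t)) 0 x))).
    intros t. eapply is_derive_eq.
    - apply derive_minus.
      + apply derive_minus; apply derive_mult; auto.
      + exact (derive_primitive (fun t => (Q t - P t) * (y2 t * z t)) (z 0) t
                 (C y2 d2 (conj H2 H2'))).
    - simpl. ring. }
  rewrite RInt_point, E3, E4 in D. unfold zero in D; simpl in D. lra. }
assert (A2 : y1 x * dz x - d1 x * z x = dz 0 - RInt (fun t => (Q t - P t) * (y1 t * z t)) 0 x).
{ assert (D : (y1 x * dz x - d1 x * z x) + (0 + RInt (fun t => (Q t - P t) * (y1 t * z t)) 0 x) =
              (y1 0 * dz 0 - d1 0 * z 0) + (0 + RInt (fun t => (Q t - P t) * (y1 t * z t)) 0 0)).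
  { apply (derive_zero_const (fun x => (y1 x * dz x - d1 x * z x)
              + (0 + RInt (fun t => (Q t - P t) * (y1 t * z t)) 0 x))).
    intros t. eapply is_derive_eq.
    - apply derive_plus.
      + apply derive_minus; apply derive_mult; auto.
      + exact (derive_primitive (fun t => (Q t - P t) * (y1 t * z t)) 0 t
                 (C y1 d1 (conj H1 H1'))).
    - simpl. ring. }
  rewrite RInt_point, E1, E2 in D. unfold zero in D; simpl in D. lra. }
rewrite <- A1, <- A2. split.
- transitivity (z x * (y1 x * d2 x - y2 x * d1 x)); [rewrite W|]; ring.
- transitivity (dz x * (y1 x * d2 x - y2 x * d1 x)); [rewrite W|]; ring.
Qed.

End Lagrange.

(** Uniqueness for the initial value problem: for a solution with the same potential both Wronskian
    coordinates are constant. *)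
Lemma solution_coordinates (Q y1 d1 y2 d2 z dz : R -> R) :
  fundamental_system Q y1 d1 y2 d2 -> linear_solution Q z dz ->
  forall x, z x = z 0 * y1 x + dz 0 * y2 x /\ dz x = z 0 * d1 x + dz 0 * d2 x.
Proof.
intros F [Hz Hz'] x.
assert (W := wronskian _ _ _ _ _ F x).
destruct F as [[H1 H1'] [[H2 H2'] [E1 [E2 [E3 E4]]]]].
assert (A1 : d2 x * z x - y2 x * dz x = d2 0 * z 0 - y2 0 * dz 0).
{ apply (derive_zero_const (fun x => d2 x * z x - y2 x * dz x)). intros t.
  eapply is_derive_eq; [apply derive_minus; apply derive_mult; auto | simpl; ring]. }
assert (A2 : y1 x * dz x - d1 x * z x = y1 0 * dz 0 - d1 0 * z 0).
{ apply (derive_zero_const (fun x => y1 x * dz x - d1 x * z x)). intros t.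
  eapply is_derive_eq; [apply derive_minus; apply derive_mult; auto | simpl; ring]. }
rewrite E1, E2, E3, E4 in *. split.
- transitivity ((d2 x * z x - y2 x * dz x) * y1 x + (y1 x * dz x - d1 x * z x) * y2 x).
  + transitivity (z x * (y1 x * d2 x - y2 x * d1 x)); [rewrite W|]; ring.
  + rewrite A1, A2. ring.
- transitivity ((d2 x * z x - y2 x * dz x) * d1 x + (y1 x * dz x - d1 x * z x) * d2 x).
  + transitivity (dz x * (y1 x * d2 x - y2 x * d1 x)); [rewrite W|]; ring.
  + rewrite A1, A2. ring.
Qed.

Lemma fundamental_system_exists (Q : R -> R) (K : R) :
  (forall x, continuous Q x) -> (forall x, Rabs (Q x) <= K) ->
  exists y1 d1 y2 d2, fundamental_system Q y1 d1 y2 d2.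
Proof.
intros HQ HK.
destruct (linear_solution_exists Q K 1 0 HQ HK) as [y1 [d1 [H1 [E1 E2]]]].
destruct (linear_solution_exists Q K 0 1 HQ HK) as [y2 [d2 [H2 [E3 E4]]]].
exists y1, d1, y2, d2. unfold fundamental_system. tauto.
Qed.

(* The four functions are the real and imaginary parts of a complex solution of
   [y'' = (- w^2 + rho - i iota) y] and of its derivative. *)
Lemma energy_bound (w k b : R) (u du v dv rho iota : R -> R) :
  1 <= w -> 0 <= b ->
  (forall x, 0 <= x <= b -> Rabs (rho x) <= k /\ Rabs (iota x) <= k) ->
  (forall x, 0 <= x <= b -> is_derive u x (du x)) ->
  (forall x, 0 <= x <= b -> is_derive v x (dv x)) ->
  (forall x, 0 <= x <= b -> is_derive du x (- w ^ 2 * u x + (rho x * u x + iota x * v x))) ->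
  (forall x, 0 <= x <= b -> is_derive dv x (- w ^ 2 * v x + (rho x * v x - iota x * u x))) ->
  du b ^ 2 + dv b ^ 2 + w ^ 2 * (u b ^ 2 + v b ^ 2) <=
  (du 0 ^ 2 + dv 0 ^ 2 + w ^ 2 * (u 0 ^ 2 + v 0 ^ 2)) * exp (2 * k * b).
Proof.
intros Hw Hb Hk Hu Hv Hdu Hdv.
(* In the derivative of the energy the terms with [w ^ 2] cancel, so the rate [2 k] does not depend
   on [w]. *)
apply (gronwall (fun x => du x ^ 2 + dv x ^ 2 + w ^ 2 * (u x ^ 2 + v x ^ 2))
  (fun x => 2 * rho x * (u x * du x + v x * dv x) + 2 * iota x * (v x * du x - u x * dv x))); auto.
- intros x Hx. specialize (Hu x Hx). specialize (Hv x Hx). specialize (Hdu x Hx). specialize (Hdv x Hx).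
  apply (is_derive_ext (fun x => du x * du x + dv x * dv x + w ^ 2 * (u x * u x + v x * v x))).
  { intros t. simpl. ring. }
  eapply is_derive_eq.
  + apply derive_plus; [apply derive_plus; apply derive_mult; eauto|].
    apply derive_scal. apply derive_plus; apply derive_mult; eauto.
  + simpl. ring.
- intros x Hx. destruct (Hk x Hx) as [K1 K2].
  (* The arithmetic-geometric mean inequality, with [1 <= w] absorbing [a1 ^ 2 + a2 ^ 2] into the
     weighted part. It serves the [rho] term and, after a change of sign, the [iota] term. *)
  assert (A : forall r s a1 b1 a2 b2, Rabs r <= k -> s = a1 * b1 + a2 * b2 ->
     2 * r * s <= k * (b1 ^ 2 + b2 ^ 2 + w ^ 2 * (a1 ^ 2 + a2 ^ 2))).
  { intros r s a1 b1 a2 b2 Hr Hs.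
    assert (S1 : Rabs (2 * s) <= b1 ^ 2 + b2 ^ 2 + w ^ 2 * (a1 ^ 2 + a2 ^ 2)).
    { assert (W1 : 1 <= w ^ 2) by nra.
      assert (0 <= (w ^ 2 - 1) * (a1 ^ 2 + a2 ^ 2)).
      { apply Rmult_le_pos; [lra|]. assert (0 <= a1 ^ 2) by apply pow2_ge_0.
        assert (0 <= a2 ^ 2) by apply pow2_ge_0. lra. }
      assert (0 <= (a1 - b1) ^ 2) by apply pow2_ge_0.
      assert (0 <= (a2 - b2) ^ 2) by apply pow2_ge_0.
      assert (0 <= (a1 + b1) ^ 2) by apply pow2_ge_0.
      assert (0 <= (a2 + b2) ^ 2) by apply pow2_ge_0.
      apply Rabs_le. subst s. split; nra. }
    apply Rle_trans with (Rabs (r * (2 * s))).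
    - eapply Rle_trans; [|apply Rle_abs]. right; ring.
    - rewrite Rabs_mult. apply Rmult_le_compat; auto; apply Rabs_pos. }
  assert (B1 := A (rho x) (u x * du x + v x * dv x) (u x) (du x) (v x) (dv x) K1 eq_refl).
  assert (B2 := A (iota x) (v x * du x - u x * dv x) (v x) (du x) (u x) (- dv x) K2 ltac:(ring)).
  assert (B3 : (- dv x) ^ 2 = dv x ^ 2) by ring. rewrite B3 in B2.
  lra.
Qed.

Lemma exp_le_compat (x y : R) : x <= y -> exp x <= exp y.
Proof. intros [H| ->]; [left; now apply exp_increasing | lra]. Qed.

Lemma sqr_le_abs (x y : R) : 0 <= y -> x ^ 2 <= y ^ 2 -> Rabs x <= y.
Proof.
intros Hy H. rewrite <- (pow2_abs x) in H. assert (P := Rabs_pos x). nra.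
Qed.

Section Bounds.

Variables (Q : R -> R) (w k : R).
Hypothesis w_ge1 : 1 <= w.
Hypothesis Q_near : forall x, Rabs (Q x + w ^ 2) <= k.

(** The real case [v = 0] of [energy_bound]. The factor [exp k] depends only on the distance of [Q]
    from [- w ^ 2], and [y] is smaller than [y'] by a factor [w]. *)
Lemma solution_bound (y d : R -> R) (G x : R) :
  linear_solution Q y d -> 0 <= G -> d 0 ^ 2 + w ^ 2 * y 0 ^ 2 <= G ^ 2 -> 0 <= x <= 1 ->
  Rabs (y x) <= G * exp k / w /\ Rabs (d x) <= G * exp k.
Proof.
intros [Hy Hd] HG H0 Hx.
assert (k0 : 0 <= k) by (eapply Rle_trans; [apply Rabs_pos | apply (Q_near 0)]).
assert (E := energy_bound w k x y d (fun _ => 0) (fun _ => 0) (fun x => Q x + w ^ 2) (fun _ => 0)).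
assert (E' : d x ^ 2 + 0 ^ 2 + w ^ 2 * (y x ^ 2 + 0 ^ 2) <=
   (d 0 ^ 2 + 0 ^ 2 + w ^ 2 * (y 0 ^ 2 + 0 ^ 2)) * exp (2 * k * x)).
{ apply E; auto; try lra.
  - intros t _. rewrite Rabs_R0. split; auto.
  - intros; apply derive_const.
  - intros t _. apply is_derive_eq with (Q t * y t); auto. ring.
  - intros t _. eapply is_derive_eq; [apply derive_const|ring]. }
assert (X : exp (2 * k * x) <= exp k ^ 2).
{ replace (exp k ^ 2) with (exp (k + k)) by (rewrite exp_plus; ring).
  apply exp_le_compat. nra. }
assert (P := exp_pos (2 * k * x)).
assert (T : d x ^ 2 + w ^ 2 * y x ^ 2 <= (G * exp k) ^ 2).
{ rewrite Rpow_mult_distr.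
  apply Rle_trans with ((d 0 ^ 2 + w ^ 2 * y 0 ^ 2) * exp (2 * k * x)); [lra|].
  apply Rmult_le_compat; try lra.
  assert (0 <= d 0 ^ 2) by apply pow2_ge_0. assert (0 <= (w * y 0) ^ 2) by apply pow2_ge_0.
  rewrite Rpow_mult_distr in *. lra. }
assert (HP : 0 <= G * exp k) by (apply Rmult_le_pos; [auto | left; apply exp_pos]).
assert (0 <= d x ^ 2) by apply pow2_ge_0. assert (0 <= (w * y x) ^ 2) by apply pow2_ge_0.
assert (S : (w * y x) ^ 2 = w ^ 2 * y x ^ 2) by ring.
split.
- assert (A : Rabs (w * y x) <= G * exp k) by (apply sqr_le_abs; lra).
  rewrite Rabs_mult, Rabs_right in A by lra.
  apply Rmult_le_reg_l with w; [lra|]. unfold Rdiv.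
  replace (w * (G * exp k * / w)) with (G * exp k) by (field; lra). exact A.
- apply sqr_le_abs; lra.
Qed.

Lemma fundamental_bound (y1 d1 y2 d2 : R -> R) (x : R) :
  fundamental_system Q y1 d1 y2 d2 -> 0 <= x <= 1 ->
  Rabs (y1 x) <= exp k /\ Rabs (d1 x) <= w * exp k /\
  Rabs (y2 x) <= exp k / w /\ Rabs (d2 x) <= exp k.
Proof.
intros [H1 [H2 [E1 [E2 [E3 E4]]]]] Hx.
destruct (solution_bound y1 d1 w x H1) as [A B]; auto; try lra.
{ rewrite E1, E2. right; ring. }
destruct (solution_bound y2 d2 1 x H2) as [C D]; auto; try lra.
{ rewrite E3, E4. right; ring. }
rewrite Rmult_1_l in *. repeat split; auto.
replace (w * exp k / w) with (exp k) in A by (field; lra). exact A.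
Qed.

End Bounds.

Lemma RInt_abs_le (f : R -> R) (x K : R) :
  0 <= x -> (forall t, continuous f t) ->
  (forall t, 0 <= t <= x -> Rabs (f t) <= K) -> Rabs (RInt f 0 x) <= K * x.
Proof.
intros Hx Hf HK. eapply Rle_trans; [apply abs_RInt_le_const|]; eauto.
- apply (@ex_RInt_continuous R_CompleteNormedModule). auto.
- right; ring.
Qed.

Section TraceDifference.

Variables (Q P y1 d1 y2 d2 z1 e1 z2 e2 : R -> R).
Hypotheses (Q_cont : forall x, continuous Q x) (P_cont : forall x, continuous P x).
Hypothesis fund_Q : fundamental_system Q y1 d1 y2 d2.
Hypothesis fund_P : fundamental_system P z1 e1 z2 e2.

Lemma trace_difference :
  (z1 1 + e2 1) - (y1 1 + d2 1) =
  y1 1 * RInt (fun t => (Q t - P t) * (y2 t * z1 t)) 0 1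
  - y2 1 * RInt (fun t => (Q t - P t) * (y1 t * z1 t)) 0 1
  + d1 1 * RInt (fun t => (Q t - P t) * (y2 t * z2 t)) 0 1
  - d2 1 * RInt (fun t => (Q t - P t) * (y1 t * z2 t)) 0 1.
Proof.
destruct fund_P as [H1 [H2 [E1 [E2 [E3 E4]]]]].
destruct (variation_of_constants Q P y1 d1 y2 d2 z1 e1 Q_cont P_cont fund_Q H1 1) as [A _].
destruct (variation_of_constants Q P y1 d1 y2 d2 z2 e2 Q_cont P_cont fund_Q H2 1) as [_ B].
rewrite A, B, E1, E2, E3, E4. ring.
Qed.

(** In each of the four terms of [trace_difference] the weights ([w] for [d1], [1 / w] for [y2] and
    [z2], 1 for [y1], [d2] and [z1]) multiply to [1 / w]. This is the source of the decay
    [lambda^(-1/2)] of the derivative of the discriminant. *)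
Lemma trace_difference_bound (w k delta : R) :
  1 <= w ->
  (forall x, Rabs (Q x + w ^ 2) <= k) -> (forall x, Rabs (P x + w ^ 2) <= k) ->
  (forall x, Rabs (Q x - P x) <= delta) ->
  Rabs ((z1 1 + e2 1) - (y1 1 + d2 1)) <= 4 * exp k ^ 3 / w * delta.
Proof.
intros Hw HQ HP Hd.
set (A := exp k). assert (A0 : 0 < A) by apply exp_pos.
assert (BQ : forall x, 0 <= x <= 1 -> _) by (intros x Hx; exact (fundamental_bound Q w k Hw HQ y1 d1 y2 d2 x fund_Q Hx)).
assert (BP : forall x, 0 <= x <= 1 -> _) by (intros x Hx; exact (fundamental_bound P w k Hw HP z1 e1 z2 e2 x fund_P Hx)).
fold A in BQ, BP.
assert (d0 : 0 <= delta) by (eapply Rle_trans; [apply Rabs_pos | apply (Hd 0)]).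
assert (iw : 0 < / w) by (apply Rinv_0_lt_compat; lra).
assert (I : forall m f g K L M, (forall x, continuous f x) -> (forall x, continuous g x) ->
   0 <= K -> 0 <= L ->
   Rabs m <= M -> (forall x, 0 <= x <= 1 -> Rabs (f x) <= K) -> (forall x, 0 <= x <= 1 -> Rabs (g x) <= L) ->
   M * (K * L) = A ^ 3 / w ->
   Rabs (m * RInt (fun t => (Q t - P t) * (f t * g t)) 0 1) <= A ^ 3 / w * delta).
{ intros m f g K L M Cf Cg K0 L0 Hm Hf Hg E. rewrite Rabs_mult.
  assert (Hi : Rabs (RInt (fun t => (Q t - P t) * (f t * g t)) 0 1) <= (delta * (K * L)) * 1).
  { apply RInt_abs_le; [lra| |].
    - intros t. apply continuous_mul; [now apply continuous_sub | now apply continuous_mul].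
    - intros t Ht. rewrite !Rabs_mult. apply Rmult_le_compat; auto; try apply Rabs_pos.
      + apply Rmult_le_pos; apply Rabs_pos.
      + apply Rmult_le_compat; auto; apply Rabs_pos. }
  rewrite <- E. replace (M * (K * L) * delta) with (M * (delta * (K * L) * 1)) by ring.
  apply Rmult_le_compat; auto; apply Rabs_pos. }
rewrite trace_difference.
destruct (BQ 1 ltac:(lra)) as [M1 [M2 [M3 M4]]].
destruct fund_Q as [Y1 [Y2 _]]. destruct fund_P as [Z1 [Z2 _]].
assert (Cy1 : forall x, continuous y1 x) by (intros; eapply linear_solution_cont; eauto).
assert (Cy2 : forall x, continuous y2 x) by (intros; eapply linear_solution_cont; eauto).
assert (Cz1 : forall x, continuous z1 x) by (intros; eapply linear_solution_cont; eauto).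
assert (Cz2 : forall x, continuous z2 x) by (intros; eapply linear_solution_cont; eauto).
assert (Aw : 0 <= A / w) by (apply Rmult_le_pos; lra).
assert (T1 := I (y1 1) y2 z1 (A / w) A A Cy2 Cz1 Aw (Rlt_le _ _ A0) M1
  (fun x Hx => proj1 (proj2 (proj2 (BQ x Hx)))) (fun x Hx => proj1 (BP x Hx)) ltac:(field; lra)).
assert (T2 := I (y2 1) y1 z1 A A (A / w) Cy1 Cz1 (Rlt_le _ _ A0) (Rlt_le _ _ A0) M3
  (fun x Hx => proj1 (BQ x Hx)) (fun x Hx => proj1 (BP x Hx)) ltac:(field; lra)).
assert (T3 := I (d1 1) y2 z2 (A / w) (A / w) (w * A) Cy2 Cz2 Aw Aw M2
  (fun x Hx => proj1 (proj2 (proj2 (BQ x Hx)))) (fun x Hx => proj1 (proj2 (proj2 (BP x Hx)))) ltac:(field; lra)).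
assert (T4 := I (d2 1) y1 z2 A (A / w) A Cy1 Cz2 (Rlt_le _ _ A0) Aw M4
  (fun x Hx => proj1 (BQ x Hx)) (fun x Hx => proj1 (proj2 (proj2 (BP x Hx)))) ltac:(field; lra)).
replace (4 * A ^ 3 / w * delta) with (4 * (A ^ 3 / w * delta)) by (field; lra).
apply Rabs_le_between in T1, T2, T3, T4. apply Rabs_le. lra.
Qed.

End TraceDifference.

(** * The discriminant *)

(* Coquelicot states some equalities at a structure type that unfolds to [R]. *)
Ltac real_ring := match goal with |- ?u = ?v => change (@eq R u v); ring end.

(** Variation of constants gives the difference quotient of the discriminant in closed form, so in
    this formulation its derivative in [lambda] follows from continuity of that quotient alone. *)
Lemma caratheodory (f h : R -> R) (x : R) :
  (forall y, f y - f x = (y - x) * h y) -> continuous h x -> is_derive f x (h x).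
Proof.
intros E C. apply is_derive_Reals. intros eps He.
apply continuity_pt_filterlim in C. destruct (C eps He) as [d [Hd H]].
exists (mkposreal d Hd). intros t Ht Htd. simpl in Htd.
rewrite E. replace ((x + t - x) * h (x + t) / t - h x) with (h (x + t) - h x) by (field; auto).
apply (H (x + t)). split.
- split; [exact I | lra].
- simpl. unfold Rdist. now replace (x + t - x) with t by ring.
Qed.

Lemma continuous_of_lipschitz_at (h : R -> R) (x K : R) :
  (forall y, Rabs (y - x) <= 1 -> Rabs (h y - h x) <= K * Rabs (y - x)) -> continuous h x.
Proof.
intros H. apply continuity_pt_filterlim. intros eps He.
assert (K1 : 0 < Rabs K + 1) by (assert (P := Rabs_pos K); lra).
exists (Rmin 1 (eps / (Rabs K + 1))). split.
- apply Rmin_pos; [lra|]. now apply Rdiv_lt_0_compat.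
- intros y [_ Hy]. simpl in *. unfold Rdist in *.
  assert (Hy1 := Rmin_l 1 (eps / (Rabs K + 1))). assert (Hy2 := Rmin_r 1 (eps / (Rabs K + 1))).
  specialize (H y ltac:(lra)). assert (P := Rabs_pos (y - x)). assert (PK := Rle_abs K).
  apply Rle_lt_trans with ((Rabs K + 1) * Rabs (y - x)).
  + eapply Rle_trans; [exact H|]. apply Rmult_le_compat_r; lra.
  + replace eps with ((Rabs K + 1) * (eps / (Rabs K + 1))) by (field; lra).
    apply Rmult_lt_compat_l; lra.
Qed.

Lemma continuous_pos_near (h : R -> R) (x : R) :
  continuous h x -> 0 < h x -> exists d, 0 < d /\ forall y, Rabs (y - x) < d -> 0 < h y.
Proof.
intros C H. apply continuity_pt_filterlim in C. destruct (C (h x) H) as [d [Hd A]].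
exists d. split; auto. intros y Hy. destruct (Req_dec y x) as [->|N]; auto.
assert (B : Rabs (h y - h x) < h x).
{ apply (A y). split; [split; [exact I | auto] | exact Hy]. }
apply Rabs_def2 in B. lra.
Qed.

Lemma RInt_linear (f g : R -> R) (u v x : R) :
  (forall t, continuous f t) -> (forall t, continuous g t) ->
  RInt (fun t => u * f t + v * g t) 0 x = u * RInt f 0 x + v * RInt g 0 x.
Proof.
intros Hf Hg. apply (@is_RInt_unique R_CompleteNormedModule).
apply (@is_RInt_plus R_NormedModule); apply (@is_RInt_scal R_NormedModule);
  apply (@RInt_correct R_CompleteNormedModule);
  apply (@ex_RInt_continuous R_CompleteNormedModule); auto.
Qed.

(** If the integral vanished, [f] would vanish on [(0, 1)], and with it [df]. The point 1/2 stands
    for any interior point at which this can be contradicted. *)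
Lemma RInt_square_pos (f df : R -> R) :
  (forall x, is_derive f x (df x)) -> (f (1/2) <> 0 \/ df (1/2) <> 0) ->
  0 < RInt (fun t => f t * f t) 0 1.
Proof.
intros Hf Hne.
set (F := fun x => 0 + RInt (fun t => f t * f t) 0 x).
assert (Cf : forall t, continuous (fun t => f t * f t) t).
{ intros t. assert (continuous f t) by now apply is_derive_continuous with (df t).
  now apply continuous_mul. }
assert (HF : forall x, is_derive F x (f x * f x)).
{ intros x. apply (derive_primitive (fun t => f t * f t) 0 x Cf). }
assert (F0 : F 0 = 0) by (unfold F; rewrite RInt_point; unfold zero; simpl; ring).
assert (mono : forall a b, a <= b -> F a <= F b).
{ intros a b Hab. apply derive_nonneg_le with (fun x => f x * f x); auto. intros; nra. }
destruct (Rlt_le_dec 0 (F 1)) as [P|P]; [unfold F in P; lra|exfalso].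
assert (Z : forall x, 0 <= x <= 1 -> F x = 0).
{ intros x Hx. assert (A := mono 0 x ltac:(lra)). assert (B := mono x 1 ltac:(lra)). lra. }
assert (LZ : forall (g dg : R -> R) x, 0 < x < 1 -> (forall t, 0 < t < 1 -> g t = 0) ->
   is_derive g x (dg x) -> dg x = 0).
{ intros g dg x Hx Hg Hd.
  assert (H0 : is_derive g x 0).
  { apply (is_derive_ext_loc (fun _ => 0)).
    - assert (Hp : 0 < Rmin x (1 - x)) by (apply Rmin_pos; lra).
      exists (mkposreal _ Hp). intros t Ht. unfold ball in Ht; simpl in Ht.
      unfold AbsRing_ball, abs, minus, plus, opp in Ht; simpl in Ht.
      assert (H1 := Rmin_l x (1 - x)). assert (H2 := Rmin_r x (1 - x)).
      apply Rabs_def2 in Ht. symmetry. apply Hg. lra.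
    - apply derive_const. }
  apply is_derive_unique in H0. apply is_derive_unique in Hd. congruence. }
assert (fz : forall x, 0 < x < 1 -> f x = 0).
{ intros x Hx. assert (A : f x * f x = 0).
  { apply (LZ F (fun x => f x * f x)); auto. intros; apply Z; lra. }
  nra. }
assert (dz : df (1/2) = 0) by (apply (LZ f df); auto; lra).
assert (A := fz (1/2) ltac:(lra)). tauto.
Qed.

Section Discriminant.

Variables (q : R -> R) (Q0 : R) (Y1 D1 Y2 D2 : R -> R -> R).
Hypothesis q_cont : forall x, continuous q x.
Hypothesis q_le : forall x, Rabs (q x) <= Q0.
Hypothesis Y_fund : forall lam,
  fundamental_system (fun x => q x - lam) (Y1 lam) (D1 lam) (Y2 lam) (D2 lam).

(** The trace over the full interval [[0, 1]], which detects 1-periodic solutions; [is_Delta_H] is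
    the trace over half of it. *)
Definition discriminant (lam : R) : R := Y1 lam 1 + D2 lam 1.

Definition trivial_monodromy (lam : R) : Prop :=
  Y1 lam 1 = 1 /\ D1 lam 1 = 0 /\ Y2 lam 1 = 0 /\ D2 lam 1 = 1.

Lemma monodromy_det lam : Y1 lam 1 * D2 lam 1 - Y2 lam 1 * D1 lam 1 = 1.
Proof. apply (wronskian _ _ _ _ _ (Y_fund lam)). Qed.

Lemma potential_cont lam x : continuous (fun x => q x - lam) x.
Proof. apply continuous_sub; [apply q_cont | apply continuous_const]. Qed.

Lemma Y1_cont lam x : continuous (Y1 lam) x.
Proof. exact (linear_solution_cont _ _ _ x (proj1 (Y_fund lam))). Qed.

Lemma Y2_cont lam x : continuous (Y2 lam) x.
Proof. exact (linear_solution_cont _ _ _ x (proj1 (proj2 (Y_fund lam)))). Qed.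

Lemma RInt_lambda_difference lam mu (y z : R -> R) x :
  (forall t, continuous y t) -> (forall t, continuous z t) ->
  RInt (fun t => ((q t - lam) - (q t - mu)) * (y t * z t)) 0 x =
  (mu - lam) * RInt (fun t => y t * z t) 0 x.
Proof.
intros Hy Hz.
rewrite (RInt_ext _ (fun t => (mu - lam) * (y t * z t) + 0 * (y t * z t))).
- rewrite RInt_linear by (intros; now apply continuous_mul).
  real_ring.
- intros; real_ring.
Qed.

Lemma solution_lambda_lipschitz lam : exists K, 0 <= K /\ forall mu x,
  Rabs (mu - lam) <= 1 -> 0 <= x <= 1 ->
  Rabs (Y1 lam x) <= K /\ Rabs (Y2 lam x) <= K /\
  Rabs (Y1 mu x - Y1 lam x) <= K * Rabs (mu - lam) /\
  Rabs (Y2 mu x - Y2 lam x) <= K * Rabs (mu - lam).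
Proof.
(* Only continuity in [mu] is sought, so the weight [w = 1] suffices: for [|nu - lam| <= 1] the
   value [|q - nu + 1|] is at most [Q0 + (|lam| + 1) + 1]. *)
set (k := Q0 + Rabs lam + 2). set (A := exp k).
assert (A0 : 0 < A) by apply exp_pos.
assert (A1 : 1 <= A).
{ unfold A. rewrite <- exp_0. apply exp_le_compat. unfold k.
  assert (P := Rabs_pos lam). assert (P' := Rabs_pos (q 0)). specialize (q_le 0). lra. }
exists (2 * A ^ 3). split; [nra|]. intros mu x Hmu Hx.
assert (near : forall nu, Rabs (nu - lam) <= 1 -> forall x, Rabs (q x - nu + 1 ^ 2) <= k).
{ intros nu Hnu t. unfold k. specialize (q_le t). apply Rabs_le_between in Hnu, q_le.
  assert (P := Rle_abs lam). assert (P' := Rle_abs (- lam)). rewrite Rabs_Ropp in P'.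
  apply Rabs_le. lra. }
assert (Hlam : Rabs (lam - lam) <= 1) by (rewrite Rminus_diag, Rabs_R0; lra).
assert (bd : forall nu t, Rabs (nu - lam) <= 1 -> 0 <= t <= 1 ->
   Rabs (Y1 nu t) <= A /\ Rabs (Y2 nu t) <= A).
{ intros nu t Hnu Ht.
  destruct (fundamental_bound _ 1 k (Rle_refl 1) (near nu Hnu) _ _ _ _ t (Y_fund nu) Ht)
    as [B1 [_ [B2 _]]].
  fold A in B1, B2. rewrite Rdiv_1_r in B2. auto. }
assert (A3 : A <= 2 * A ^ 3) by nra.
destruct (bd lam x Hlam Hx) as [B1 B2].
repeat split; try lra.
- destruct (Y_fund mu) as [S [_ [E1 [E2 _]]]].
  destruct (variation_of_constants _ _ _ _ _ _ _ _ (potential_cont lam) (potential_cont mu)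
    (Y_fund lam) S x) as [V _].
  rewrite E1, E2, !RInt_lambda_difference in V by (apply Y1_cont || apply Y2_cont).
  assert (I1 : Rabs (RInt (fun t => Y2 lam t * Y1 mu t) 0 x) <= A * A * x).
  { apply RInt_abs_le; [lra | intros; apply continuous_mul; [apply Y2_cont | apply Y1_cont] |].
    intros t Ht. rewrite Rabs_mult. apply Rmult_le_compat; try apply Rabs_pos; apply bd; auto; lra. }
  assert (I2 : Rabs (RInt (fun t => Y1 lam t * Y1 mu t) 0 x) <= A * A * x).
  { apply RInt_abs_le; [lra | intros; apply continuous_mul; [apply Y1_cont | apply Y1_cont] |].
    intros t Ht. rewrite Rabs_mult. apply Rmult_le_compat; try apply Rabs_pos; apply bd; auto; lra. }
  replace (Y1 mu x - Y1 lam x) with ((Y1 lam x * RInt (fun t => Y2 lam t * Y1 mu t) 0 x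
     + - (Y2 lam x * RInt (fun t => Y1 lam t * Y1 mu t) 0 x)) * (mu - lam)) by (rewrite V; ring).
  rewrite Rabs_mult. apply Rmult_le_compat_r; [apply Rabs_pos|].
  eapply Rle_trans; [apply Rabs_triang|]. rewrite Rabs_Ropp, !Rabs_mult.
  assert (AA : 0 <= A * A) by nra.
  assert (M1 : Rabs (Y1 lam x) * Rabs (RInt (fun t => Y2 lam t * Y1 mu t) 0 x) <= A * (A * A)).
  { apply Rmult_le_compat; try apply Rabs_pos; auto. nra. }
  assert (M2 : Rabs (Y2 lam x) * Rabs (RInt (fun t => Y1 lam t * Y1 mu t) 0 x) <= A * (A * A)).
  { apply Rmult_le_compat; try apply Rabs_pos; auto. nra. }
  replace (2 * A ^ 3) with (A * (A * A) + A * (A * A)) by ring. lra.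
- destruct (Y_fund mu) as [_ [S [_ [_ [E1 E2]]]]].
  destruct (variation_of_constants _ _ _ _ _ _ _ _ (potential_cont lam) (potential_cont mu)
    (Y_fund lam) S x) as [V _].
  rewrite E1, E2, !RInt_lambda_difference in V by (apply Y1_cont || apply Y2_cont).
  assert (I1 : Rabs (RInt (fun t => Y2 lam t * Y2 mu t) 0 x) <= A * A * x).
  { apply RInt_abs_le; [lra | intros; apply continuous_mul; [apply Y2_cont | apply Y2_cont] |].
    intros t Ht. rewrite Rabs_mult. apply Rmult_le_compat; try apply Rabs_pos; apply bd; auto; lra. }
  assert (I2 : Rabs (RInt (fun t => Y1 lam t * Y2 mu t) 0 x) <= A * A * x).
  { apply RInt_abs_le; [lra | intros; apply continuous_mul; [apply Y1_cont | apply Y2_cont] |].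
    intros t Ht. rewrite Rabs_mult. apply Rmult_le_compat; try apply Rabs_pos; apply bd; auto; lra. }
  replace (Y2 mu x - Y2 lam x) with ((Y1 lam x * RInt (fun t => Y2 lam t * Y2 mu t) 0 x
     + - (Y2 lam x * RInt (fun t => Y1 lam t * Y2 mu t) 0 x)) * (mu - lam)) by (rewrite V; ring).
  rewrite Rabs_mult. apply Rmult_le_compat_r; [apply Rabs_pos|].
  eapply Rle_trans; [apply Rabs_triang|]. rewrite Rabs_Ropp, !Rabs_mult.
  assert (AA : 0 <= A * A) by nra.
  assert (M1 : Rabs (Y1 lam x) * Rabs (RInt (fun t => Y2 lam t * Y2 mu t) 0 x) <= A * (A * A)).
  { apply Rmult_le_compat; try apply Rabs_pos; auto. nra. }
  assert (M2 : Rabs (Y2 lam x) * Rabs (RInt (fun t => Y1 lam t * Y2 mu t) 0 x) <= A * (A * A)).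
  { apply Rmult_le_compat; try apply Rabs_pos; auto. nra. }
  replace (2 * A ^ 3) with (A * (A * A) + A * (A * A)) by ring. lra.
Qed.

Lemma overlap_cont lam (Y Z : R -> R -> R) :
  (forall mu x, continuous (Y mu) x) -> (forall mu x, continuous (Z mu) x) ->
  (Y = Y1 \/ Y = Y2) -> (Z = Y1 \/ Z = Y2) ->
  continuous (fun mu => RInt (fun t => Y lam t * Z mu t) 0 1) lam.
Proof.
intros CY CZ HY HZ. destruct (solution_lambda_lipschitz lam) as [K [K0 HK]].
apply continuous_of_lipschitz_at with (K * K). intros mu Hmu.
assert (D : RInt (fun t => Y lam t * Z mu t) 0 1 - RInt (fun t => Y lam t * Z lam t) 0 1 =
            RInt (fun t => 1 * (Y lam t * Z mu t) + (-1) * (Y lam t * Z lam t)) 0 1).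
{ rewrite RInt_linear by (intros; now apply continuous_mul). ring. }
rewrite D. rewrite <- (Rmult_1_r (K * K * Rabs (mu - lam))). apply RInt_abs_le; [lra| |].
- intros t. apply (continuous_plus (V := R_NormedModule)
    (fun t => 1 * (Y lam t * Z mu t)) (fun t => -1 * (Y lam t * Z lam t))).
  + apply (continuous_mul (fun _ => 1)); [apply continuous_const | now apply continuous_mul].
  + apply (continuous_mul (fun _ => -1)); [apply continuous_const | now apply continuous_mul].
- intros t Ht. replace (1 * (Y lam t * Z mu t) + -1 * (Y lam t * Z lam t))
    with (Y lam t * (Z mu t - Z lam t)) by ring.
  destruct (HK mu t Hmu Ht) as [A1 [A2 [A3 A4]]].
  rewrite Rabs_mult, Rmult_assoc. apply Rmult_le_compat; try apply Rabs_pos.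
  + destruct HY; subst Y; auto.
  + destruct HZ; subst Z; auto.
Qed.

(** The divided difference of [discriminant] between [lam] and [mu]; on the diagonal it is the
    derivative. *)
Definition discriminant_slope lam mu : R :=
  Y1 lam 1 * RInt (fun t => Y2 lam t * Y1 mu t) 0 1
  - Y2 lam 1 * RInt (fun t => Y1 lam t * Y1 mu t) 0 1
  + D1 lam 1 * RInt (fun t => Y2 lam t * Y2 mu t) 0 1
  - D2 lam 1 * RInt (fun t => Y1 lam t * Y2 mu t) 0 1.

Lemma discriminant_difference lam mu :
  discriminant mu - discriminant lam = (mu - lam) * discriminant_slope lam mu.
Proof.
unfold discriminant.
rewrite (trace_difference (fun x => q x - lam) (fun x => q x - mu)
  (Y1 lam) (D1 lam) (Y2 lam) (D2 lam) (Y1 mu) (D1 mu) (Y2 mu) (D2 mu)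
  (potential_cont lam) (potential_cont mu) (Y_fund lam) (Y_fund mu)).
rewrite !RInt_lambda_difference by (apply Y1_cont || apply Y2_cont).
unfold discriminant_slope. ring.
Qed.

Lemma discriminant_derive lam :
  is_derive discriminant lam (discriminant_slope lam lam).
Proof.
apply (caratheodory discriminant (discriminant_slope lam)).
- intros mu. apply discriminant_difference.
- unfold discriminant_slope.
  assert (C : forall m Y Z, (Y = Y1 \/ Y = Y2) -> (Z = Y1 \/ Z = Y2) ->
    continuous (fun mu => m * RInt (fun t => Y lam t * Z mu t) 0 1) lam).
  { intros m Y Z HY HZ. apply (continuous_mul (fun _ => m)); [apply continuous_const|].
    apply overlap_cont; auto.
    - intros mu x. destruct HY; subst Y; [apply Y1_cont | apply Y2_cont].
    - intros mu x. destruct HZ; subst Z; [apply Y1_cont | apply Y2_cont]. }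
  apply (continuous_minus (V := R_NormedModule)
     (fun mu => Y1 lam 1 * RInt (fun t => Y2 lam t * Y1 mu t) 0 1
      - Y2 lam 1 * RInt (fun t => Y1 lam t * Y1 mu t) 0 1
      + D1 lam 1 * RInt (fun t => Y2 lam t * Y2 mu t) 0 1)
     (fun mu => D2 lam 1 * RInt (fun t => Y1 lam t * Y2 mu t) 0 1)); [|apply C; auto].
  apply (continuous_plus (V := R_NormedModule)
     (fun mu => Y1 lam 1 * RInt (fun t => Y2 lam t * Y1 mu t) 0 1
      - Y2 lam 1 * RInt (fun t => Y1 lam t * Y1 mu t) 0 1)
     (fun mu => D1 lam 1 * RInt (fun t => Y2 lam t * Y2 mu t) 0 1)); [|apply C; auto].
  apply continuous_sub; apply C; auto.
Qed.

(** The form is the integral of [(p Y1 + r Y2) ^ 2], and by the Wronskian a nontrivial combination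
    cannot vanish together with its derivative at 1/2. *)
Lemma gram_pos lam p r : (p <> 0 \/ r <> 0) ->
  0 < p ^ 2 * RInt (fun t => Y1 lam t * Y1 lam t) 0 1
      + 2 * p * r * RInt (fun t => Y1 lam t * Y2 lam t) 0 1
      + r ^ 2 * RInt (fun t => Y2 lam t * Y2 lam t) 0 1.
Proof.
intros Hpr.
assert (W := wronskian _ _ _ _ _ (Y_fund lam) (1/2)).
assert (C1 := Y1_cont lam). assert (C2 := Y2_cont lam).
destruct (Y_fund lam) as [[H1 H1'] [[H2 H2'] _]].
assert (P : 0 < RInt (fun t => (p * Y1 lam t + r * Y2 lam t) * (p * Y1 lam t + r * Y2 lam t)) 0 1).
{ apply (RInt_square_pos _ (fun t => p * D1 lam t + r * D2 lam t)).
  - intros x. apply derive_plus; now apply derive_scal.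
  - apply not_and_or. intros [Z1 Z2].
    assert (p = 0).
    { transitivity (p * (Y1 lam (1/2) * D2 lam (1/2) - Y2 lam (1/2) * D1 lam (1/2))); [rewrite W; ring|].
      transitivity ((p * Y1 lam (1/2) + r * Y2 lam (1/2)) * D2 lam (1/2)
        - (p * D1 lam (1/2) + r * D2 lam (1/2)) * Y2 lam (1/2)); [ring|rewrite Z1, Z2; ring]. }
    assert (r = 0).
    { transitivity (r * (Y1 lam (1/2) * D2 lam (1/2) - Y2 lam (1/2) * D1 lam (1/2))); [rewrite W; ring|].
      transitivity ((p * D1 lam (1/2) + r * D2 lam (1/2)) * Y1 lam (1/2)
        - (p * Y1 lam (1/2) + r * Y2 lam (1/2)) * D1 lam (1/2)); [ring|rewrite Z1, Z2; ring]. }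
    tauto. }
rewrite (RInt_ext _ (fun t => 1 * (p ^ 2 * (Y1 lam t * Y1 lam t) + 2 * p * r * (Y1 lam t * Y2 lam t))
   + r ^ 2 * (Y2 lam t * Y2 lam t))) in P by (intros; real_ring).
rewrite (RInt_linear (fun t => p ^ 2 * (Y1 lam t * Y1 lam t) + 2 * p * r * (Y1 lam t * Y2 lam t))) in P.
- rewrite (RInt_linear (fun t => Y1 lam t * Y1 lam t)) in P by (intros; now apply continuous_mul). lra.
- intros t. apply (continuous_plus (V := R_NormedModule) (fun t => p ^ 2 * (Y1 lam t * Y1 lam t))
    (fun t => 2 * p * r * (Y1 lam t * Y2 lam t))).
  + apply (continuous_mul (fun _ => p ^ 2)); [apply continuous_const | now apply continuous_mul].
  + apply (continuous_mul (fun _ => 2 * p * r)); [apply continuous_const | now apply continuous_mul].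
- intros t. now apply continuous_mul.
Qed.

Lemma overlap_sym lam : RInt (fun t => Y2 lam t * Y1 lam t) 0 1 = RInt (fun t => Y1 lam t * Y2 lam t) 0 1.
Proof. apply RInt_ext. intros; real_ring. Qed.

(* [discriminant_slope lam lam] is the integral of a quadratic form in
   [(Y1 lam, Y2 lam)] of discriminant [discriminant lam ^ 2 - 4]. *)
Lemma discriminant_slope_nonzero lam :
  (Rabs (discriminant lam) < 2 \/ (discriminant lam = 2 /\ ~ trivial_monodromy lam)) ->
  discriminant_slope lam lam <> 0.
Proof.
intros H S0. assert (W := monodromy_det lam). unfold discriminant in *.
unfold discriminant_slope in S0. rewrite overlap_sym in S0.
assert (G := gram_pos lam).
set (a := RInt (fun t => Y1 lam t * Y1 lam t) 0 1) in *.
set (b := RInt (fun t => Y1 lam t * Y2 lam t) 0 1) in *.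
set (c := RInt (fun t => Y2 lam t * Y2 lam t) 0 1) in *.
unfold trivial_monodromy in H.
set (m11 := Y1 lam 1) in *. set (m12 := Y2 lam 1) in *.
set (m21 := D1 lam 1) in *. set (m22 := D2 lam 1) in *.
assert (c0 : 0 < c) by (specialize (G 0 1 ltac:(lra)); lra).
(* The Gram form at [(2 m12, m22 - m11)]. If the slope vanishes, its value is
   [(disc ^ 2 - 4) c <= 0], so positivity forces [m12 = 0]. Then [|disc| < 2] would make
   [(m22 - m11) ^ 2 c] negative, while [disc = 2] gives [m11 = m22 = 1] and slope [m21 c], hence
   trivial monodromy. *)
assert (K : (2 * m12) ^ 2 * a + 2 * (2 * m12) * (m22 - m11) * b + (m22 - m11) ^ 2 * c =
            -4 * m12 * (m11 * b - m12 * a + m21 * c - m22 * b)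
            + ((m11 + m22) ^ 2 - 4 * (m11 * m22 - m12 * m21)) * c) by ring.
rewrite S0, W in K.
destruct (Req_dec m12 0) as [Z|Z].
- rewrite Z in *. destruct H as [H|[H N]].
  + apply Rabs_def2 in H. assert (0 <= (m11 - m22) ^ 2) by apply pow2_ge_0.
    assert ((m11 + m22) ^ 2 < 4) by nra. lra.
  + assert (m22 = 2 - m11) by lra. assert (m11 = 1).
    { apply Rminus_diag_uniq, Rsqr_eq_0. unfold Rsqr. subst m22. nra. }
    assert (m22 = 1) by lra.
    destruct (Req_dec m21 0) as [Z'|Z'].
    * apply N. auto.
    * apply Z'. rewrite H1, H2 in S0.
      apply Rmult_eq_reg_r with c; lra.
- specialize (G (2 * m12) (m22 - m11) ltac:(lra)).
  destruct H as [H|[H N]].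
  + apply Rabs_def2 in H. assert ((m11 + m22) ^ 2 < 4) by nra. nra.
  + rewrite H in K. lra.
Qed.

(** With [e = mu - lam], variation of constants turns the monodromy at [mu] into the identity plus
    [e] times a traceless-looking matrix of overlaps, of trace [I21 - I12] and determinant [h mu].
    Since the monodromy has determinant 1, [e (I21 - I12) = - e ^ 2 h mu], that is,
    [disc mu = 2 - e ^ 2 h mu]. At [lam] itself [h] is the Gram determinant, which is positive, and
    [h] is continuous there. *)
Lemma discriminant_lt_near_trivial lam : trivial_monodromy lam ->
  exists d, 0 < d /\ forall mu, mu <> lam -> Rabs (mu - lam) < d -> discriminant mu < 2.
Proof.
intros [M1 [M2 [M3 M4]]].
set (h := fun mu => RInt (fun t => Y1 lam t * Y1 mu t) 0 1 * RInt (fun t => Y2 lam t * Y2 mu t) 0 1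
   - RInt (fun t => Y1 lam t * Y2 mu t) 0 1 * RInt (fun t => Y2 lam t * Y1 mu t) 0 1).
assert (Hc : continuous h lam).
{ apply continuous_sub; apply continuous_mul; apply overlap_cont; auto;
    intros; apply Y1_cont || apply Y2_cont. }
assert (Hp : 0 < h lam).
{ unfold h. rewrite overlap_sym. assert (G := gram_pos lam).
  set (a := RInt (fun t => Y1 lam t * Y1 lam t) 0 1) in *.
  set (b := RInt (fun t => Y1 lam t * Y2 lam t) 0 1) in *.
  set (c := RInt (fun t => Y2 lam t * Y2 lam t) 0 1) in *.
  assert (c0 : 0 < c) by (specialize (G 0 1 ltac:(lra)); lra).
  (* The Gram form at [(c, - b)] equals [c (a c - b ^ 2)]. *)
  specialize (G c (- b) ltac:(lra)). nra. }
destruct (continuous_pos_near h lam Hc Hp) as [d [Hd H]].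
exists d. split; auto. intros mu Hne Hmu. specialize (H mu Hmu).
assert (W := monodromy_det mu).
destruct (Y_fund mu) as [S1 [S2 [E1 [E2 [E3 E4]]]]].
destruct (variation_of_constants _ _ _ _ _ _ _ _ (potential_cont lam) (potential_cont mu)
    (Y_fund lam) S1 1) as [V1 V1'].
destruct (variation_of_constants _ _ _ _ _ _ _ _ (potential_cont lam) (potential_cont mu)
    (Y_fund lam) S2 1) as [V2 V2'].
rewrite !RInt_lambda_difference in V1, V1', V2, V2' by (apply Y1_cont || apply Y2_cont).
rewrite E1, E2, M1, M3 in V1. rewrite E1, E2, M2, M4 in V1'.
rewrite E3, E4, M1, M3 in V2. rewrite E3, E4, M2, M4 in V2'.
unfold discriminant. unfold h in H.
set (I11 := RInt (fun t => Y1 lam t * Y1 mu t) 0 1) in *.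
set (I12 := RInt (fun t => Y1 lam t * Y2 mu t) 0 1) in *.
set (I21 := RInt (fun t => Y2 lam t * Y1 mu t) 0 1) in *.
set (I22 := RInt (fun t => Y2 lam t * Y2 mu t) 0 1) in *.
rewrite V1, V1', V2, V2' in W.
rewrite V1, V2'.
assert (E : 0 < (mu - lam) ^ 2) by (apply pow2_gt_0; lra).
assert (0 < (mu - lam) ^ 2 * (I11 * I22 - I12 * I21)) by now apply Rmult_lt_0_compat.
nra.
Qed.

End Discriminant.

(** * Global behaviour of the discriminant on the real line *)

Lemma pos_of_square_ge1 (f df : R -> R) :
  (forall x, is_derive f x (df x)) -> f 0 = 1 ->
  (forall x, 0 <= x <= 1 -> 1 <= f x * f x) -> 0 < f 1.
Proof.
intros Hf H0 H1. destruct (Rlt_le_dec 0 (f 1)) as [P|P]; auto. exfalso.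
destruct (IVT_gen f 0 1 0) as [x [Hx Z]].
- intros x. now apply is_derive_continuity_pt with (df x).
- rewrite H0, Rmin_right, Rmax_left by lra. lra.
- rewrite Rmin_left, Rmax_right in Hx by lra. specialize (H1 x Hx). rewrite Z in H1. lra.
Qed.

(** For [Q > 0] each product [y y'] is nondecreasing from 0, so [y1 ^ 2] and [d2 ^ 2] stay above 1
    and neither function changes sign. This bounds the spectrum from below and fixes the sign of
    [disc - 2] at minus infinity. *)
Lemma trace_gt_2_of_pos (Q y1 d1 y2 d2 : R -> R) :
  fundamental_system Q y1 d1 y2 d2 -> (forall x, 0 < Q x) -> 2 < y1 1 + d2 1.
Proof.
intros [[H1 H1'] [[H2 H2'] [E1 [E2 [E3 E4]]]]] HQ.
assert (prod : forall y d : R -> R, (forall x, is_derive y x (d x)) -> (forall x, is_derive d x (Q x * y x)) ->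
   forall x, is_derive (fun x => y x * d x) x (d x * d x + Q x * (y x * y x))).
{ intros y d Hy Hd x. eapply is_derive_eq; [apply derive_mult; auto | simpl; ring]. }
assert (sq : forall y d : R -> R, (forall x, is_derive y x (d x)) ->
   forall x, is_derive (fun x => y x * y x) x (2 * (y x * d x))).
{ intros y d Hy x. eapply is_derive_eq; [apply derive_mult; auto | simpl; ring]. }
assert (pos : forall y d : R -> R, (forall x, is_derive y x (d x)) -> (forall x, is_derive d x (Q x * y x)) ->
   y 0 * d 0 = 0 -> forall x, 0 <= x -> 0 <= y x * d x).
{ intros y d Hy Hd Z x Hx. rewrite <- Z.
  apply (derive_nonneg_le (fun x => y x * d x) _ 0 x Hx (fun t _ => prod y d Hy Hd t)).
  intros t _. specialize (HQ t). assert (0 <= y t * y t) by nra.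
  assert (0 <= Q t * (y t * y t)) by (apply Rmult_le_pos; lra). assert (0 <= d t * d t) by nra. cbv beta. lra. }
assert (A1 : forall x, 0 <= x -> 1 <= y1 x * y1 x).
{ intros x Hx. replace 1 with (y1 0 * y1 0) by (rewrite E1; ring).
  apply (derive_nonneg_le (fun x => y1 x * y1 x) _ 0 x Hx (fun t _ => sq y1 d1 H1 t)).
  intros t Ht. assert (P := pos y1 d1 H1 H1' ltac:(rewrite E2; ring) t ltac:(lra)). lra. }
assert (A2 : forall x, 0 <= x -> 1 <= d2 x * d2 x).
{ intros x Hx. replace 1 with (d2 0 * d2 0) by (rewrite E4; ring).
  apply (derive_nonneg_le (fun x => d2 x * d2 x) _ 0 x Hx
     (fun t _ => sq d2 (fun x => Q x * y2 x) H2' t)).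
  intros t Ht. assert (P := pos y2 d2 H2 H2' ltac:(rewrite E3; ring) t ltac:(lra)).
  specialize (HQ t). assert (0 <= Q t * (y2 t * d2 t)) by (apply Rmult_le_pos; lra). lra. }
assert (B1 := pos_of_square_ge1 y1 d1 H1 E1 (fun x Hx => A1 x (proj1 Hx))).
assert (B2 := pos_of_square_ge1 d2 _ H2' E4 (fun x Hx => A2 x (proj1 Hx))).
assert (S1 : forall x, 0 < x -> 0 < y1 x * d1 x).
{ intros x Hx. replace 0 with (y1 0 * d1 0) by (rewrite E2; ring).
  apply (derive_pos_lt (fun x => y1 x * d1 x) _ 0 x Hx (fun t _ => prod y1 d1 H1 H1' t)).
  intros t Ht. specialize (HQ t). specialize (A1 t (proj1 Ht)).
  assert (0 < Q t * (y1 t * y1 t)) by (apply Rmult_lt_0_compat; lra). assert (0 <= d1 t * d1 t) by nra. cbv beta. lra. }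
(* Strict growth is taken on [[1/2, 1]] because [y1 d1] vanishes at 0. *)
assert (S2 : y1 (1/2) * y1 (1/2) < y1 1 * y1 1).
{ apply (derive_pos_lt (fun x => y1 x * y1 x) _ (1/2) 1 ltac:(lra) (fun t _ => sq y1 d1 H1 t)).
  intros t Ht. specialize (S1 t ltac:(lra)). lra. }
assert (A3 := A1 (1/2) ltac:(lra)). assert (A4 := A2 1 ltac:(lra)).
assert (1 < y1 1) by nra. assert (1 <= d2 1) by nra. lra.
Qed.

Lemma trigonometric_fundamental_system (w : R) : w <> 0 ->
  fundamental_system (fun _ => - w ^ 2) (fun x => cos (w * x)) (fun x => - w * sin (w * x))
    (fun x => sin (w * x) / w) (fun x => cos (w * x)).
Proof.
intros Hw.
split; [|split; [|split; [|split; [|split]]]].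
- split; intros x; auto_derive; auto; field; auto.
- split; intros x; auto_derive; auto; field; auto.
- rewrite Rmult_0_r. apply cos_0.
- rewrite Rmult_0_r, sin_0. ring.
- rewrite Rmult_0_r, sin_0. field; auto.
- rewrite Rmult_0_r. apply cos_0.
Qed.

Lemma interior_minimum (f df : R -> R) (a b c : R) :
  (forall x, is_derive f x (df x)) -> a < c < b -> (forall x, a < x < b -> f c <= f x) -> df c = 0.
Proof.
intros Hf Hc Hm.
assert (pr : derivable_pt f c) by (exists (df c); apply is_derive_Reals, Hf).
rewrite <- (deriv_minimum f a b c pr); try apply Hc.
- symmetry. apply derive_pt_eq_0. apply is_derive_Reals, Hf.
- intros x H1 H2. apply Hm. lra.
Qed.

Lemma interior_maximum (f df : R -> R) (a b c : R) :
  (forall x, is_derive f x (df x)) -> a < c < b -> (forall x, a < x < b -> f x <= f c) -> df c = 0.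
Proof.
intros Hf Hc Hm.
assert (pr : derivable_pt f c) by (exists (df c); apply is_derive_Reals, Hf).
rewrite <- (deriv_maximum f a b c pr); try apply Hc.
- symmetry. apply derive_pt_eq_0. apply is_derive_Reals, Hf.
- intros x H1 H2. apply Hm. lra.
Qed.

Section DiscriminantGlobal.

Variables (q : R -> R) (Q0 : R) (Y1 D1 Y2 D2 : R -> R -> R).
Hypothesis q_cont : forall x, continuous q x.
Hypothesis q_le : forall x, Rabs (q x) <= Q0.
Hypothesis Y_fund : forall lam,
  fundamental_system (fun x => q x - lam) (Y1 lam) (D1 lam) (Y2 lam) (D2 lam).

Notation disc := (discriminant Y1 D2).
Notation slope := (discriminant_slope Y1 D1 Y2 D2).

Lemma disc_derive x : is_derive disc x (slope x x).
Proof. now apply (discriminant_derive q Q0). Qed.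

Lemma disc_continuity : continuity disc.
Proof. intros x. apply is_derive_continuity_pt with (slope x x). apply disc_derive. Qed.

Lemma disc_below lam : lam < - Q0 -> 2 < disc lam.
Proof.
intros H. apply (trace_gt_2_of_pos _ _ _ _ _ (Y_fund lam)).
intros x. specialize (q_le x). apply Rabs_le_between in q_le. lra.
Qed.

(** The window 6 is the gap length required in the end. With [w ^ 2 = lam + Q0 + 1] both potentials
    stay within [Q0 + 6 + (Q0 + 1) = 2 Q0 + 7] of [- w ^ 2]. *)
Lemma disc_lipschitz lam mu : - Q0 <= lam -> Rabs (mu - lam) <= 6 ->
  Rabs (disc mu - disc lam) <= 4 * exp (2 * Q0 + 7) ^ 3 / sqrt (lam + Q0 + 1) * Rabs (mu - lam).
Proof.
intros Hlam Hmu.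
assert (Hs : sqrt (lam + Q0 + 1) ^ 2 = lam + Q0 + 1) by (apply pow2_sqrt; lra).
assert (H1 : 1 <= sqrt (lam + Q0 + 1)) by (rewrite <- sqrt_1 at 1; apply sqrt_le_1; lra).
apply (trace_difference_bound (fun x => q x - lam) (fun x => q x - mu)
  (Y1 lam) (D1 lam) (Y2 lam) (D2 lam) (Y1 mu) (D1 mu) (Y2 mu) (D2 mu)); auto.
- intros; apply continuous_sub; [apply q_cont | apply continuous_const].
- intros; apply continuous_sub; [apply q_cont | apply continuous_const].
- intros x. rewrite Hs. specialize (q_le x). apply Rabs_le_between in q_le. apply Rabs_le. lra.
- intros x. rewrite Hs. specialize (q_le x). apply Rabs_le_between in q_le, Hmu. apply Rabs_le. lra.
- intros x. right. f_equal. simpl. ring.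
Qed.

Lemma disc_asymptotic w : 1 <= w ->
  Rabs (disc (w ^ 2) - 2 * cos w) <= 4 * exp Q0 ^ 3 / w * Q0.
Proof.
intros Hw.
assert (0 <= Q0) by (eapply Rle_trans; [apply Rabs_pos | apply (q_le 0)]).
replace (2 * cos w) with (cos (w * 1) + cos (w * 1)) by (rewrite Rmult_1_r; ring).
apply (trace_difference_bound (fun _ => - w ^ 2) (fun x => q x - w ^ 2)
  (fun x => cos (w * x)) (fun x => - w * sin (w * x))
  (fun x => sin (w * x) / w) (fun x => cos (w * x))
  (Y1 (w ^ 2)) (D1 (w ^ 2)) (Y2 (w ^ 2)) (D2 (w ^ 2))); auto.
- intros; apply continuous_const.
- intros; apply continuous_sub; [apply q_cont | apply continuous_const].
- apply trigonometric_fundamental_system. lra.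
- intros x. replace (- w ^ 2 + w ^ 2) with 0 by ring. now rewrite Rabs_R0.
- intros x. now replace (q x - w ^ 2 + w ^ 2) with (q x) by ring.
- intros x. replace (- w ^ 2 - (q x - w ^ 2)) with (- q x) by ring. now rewrite Rabs_Ropp.
Qed.

Lemma disc_critical x : slope x x = 0 -> disc x <= -2 \/ 2 <= disc x.
Proof.
intros S. apply NNPP. intros N.
apply (discriminant_slope_nonzero q Y1 D1 Y2 D2 Y_fund x); auto.
left. apply Rabs_def1; lra.
Qed.

Lemma disc_dip a b : a < b -> disc a = 2 -> disc b = 2 ->
  (forall x, a < x < b -> disc x < 2) -> exists x, a < x < b /\ disc x <= -2.
Proof.
intros Hab Ha Hb H.
destruct (continuity_ab_min disc a b (Rlt_le _ _ Hab)) as [m [Hm Hmab]].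
{ intros; apply disc_continuity. }
assert (A := Hm ((a + b) / 2) ltac:(lra)). assert (B := H ((a + b) / 2) ltac:(lra)).
assert (Hma : m <> a) by (intros ->; lra). assert (Hmb : m <> b) by (intros ->; lra).
assert (Hi : a < m < b) by lra.
exists m. split; auto.
destruct (disc_critical m) as [C|C]; auto; [|lra].
apply (interior_minimum disc (fun x => slope x x) a b m); auto.
- apply disc_derive.
- intros x Hx. apply Hm. lra.
Qed.

(** The maximum lies in the interior, hence is a critical value, and it exceeds -2. *)
Lemma disc_peak a c b : a < c < b -> disc a < disc c -> disc b < disc c -> -2 < disc c ->
  exists x, a < x < b /\ 2 <= disc x.
Proof.
intros Hc Ha Hb H.
destruct (continuity_ab_maj disc a b ltac:(lra)) as [m [Hm Hmab]].
{ intros; apply disc_continuity. }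
assert (A := Hm c ltac:(lra)).
assert (Hma : m <> a) by (intros ->; lra). assert (Hmb : m <> b) by (intros ->; lra).
assert (Hi : a < m < b) by lra.
exists m. split; auto.
destruct (disc_critical m) as [C|C]; auto; [|lra].
apply (interior_maximum disc (fun x => slope x x) a b m); auto.
- apply disc_derive.
- intros x Hx. apply Hm. lra.
Qed.

Lemma disc_reaches_2 a b : a < b -> (disc a - 2) * (disc b - 2) <= 0 ->
  exists x, a <= x <= b /\ disc x = 2.
Proof.
intros Hab H. destruct (IVT_gen disc a b 2 disc_continuity) as [x [Hx E]].
- unfold Rmin, Rmax. destruct (Rle_dec (disc a) (disc b)); nra.
- rewrite Rmin_left, Rmax_right in Hx by lra. eauto.
Qed.

End DiscriminantGlobal.

(** * Periodic eigenspaces *)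

Lemma is_derive_Re (y : R -> C) (x : R) (d : C) :
  @is_derive R_AbsRing C_R_NormedModule y x d -> is_derive (fun t => Re (y t)) x (Re d).
Proof.
intros H.
apply (filterdiff_ext_lin (fun t => Re (y t)) (fun t => Re (@scal R_AbsRing C_R_NormedModule t d))).
- apply (@filterdiff_comp' R_AbsRing R_NormedModule C_R_NormedModule R_NormedModule y fst x _ fst).
  + exact H.
  + apply filterdiff_linear. apply is_linear_fst.
- intros t. reflexivity.
Qed.

Lemma is_derive_Im (y : R -> C) (x : R) (d : C) :
  @is_derive R_AbsRing C_R_NormedModule y x d -> is_derive (fun t => Im (y t)) x (Im d).
Proof.
intros H.
apply (filterdiff_ext_lin (fun t => Im (y t)) (fun t => Im (@scal R_AbsRing C_R_NormedModule t d))).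
- apply (@filterdiff_comp' R_AbsRing R_NormedModule C_R_NormedModule R_NormedModule y snd x _ snd).
  + exact H.
  + apply filterdiff_linear. apply is_linear_snd.
- intros t. reflexivity.
Qed.

Lemma is_derive_RtoC (u : R -> R) (x d : R) :
  is_derive u x d -> @is_derive R_AbsRing C_R_NormedModule (fun t => RtoC (u t)) x (RtoC d).
Proof.
intros H.
apply (filterdiff_ext_lin (fun t => RtoC (u t)) (fun t => RtoC (scal t d))).
- apply (@filterdiff_comp' R_AbsRing R_NormedModule R_NormedModule C_R_NormedModule u RtoC x _ RtoC).
  + exact H.
  + apply filterdiff_linear. split.
    * intros a b. apply injective_projections; simpl; auto. unfold plus; simpl. ring.
    * intros a b. apply injective_projections; simpl; auto. unfold scal; simpl. unfold mult; simpl. ring.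
    * exists 1. split; [lra|]. intros t. rewrite Rmult_1_l.
      change (sqrt (Rabs t ^ 2 + Rabs 0 ^ 2) <= Rabs t).
      rewrite Rabs_R0, pow_i, Rplus_0_r by lia. rewrite sqrt_pow2; [lra | apply Rabs_pos].
- intros t. apply injective_projections; simpl; auto. unfold scal; simpl. unfold mult; simpl. ring.
Qed.

Lemma schrodinger_real_parts (q : R -> R) (lam : R) (y dy : R -> C) :
  schrodinger_solution q (RtoC lam) y dy ->
  linear_solution (fun x => q x - lam) (fun x => Re (y x)) (fun x => Re (dy x)) /\
  linear_solution (fun x => q x - lam) (fun x => Im (y x)) (fun x => Im (dy x)).
Proof.
intros [ddy [H1 [H2 H3]]].
assert (A : forall x, Re (ddy x) = (q x - lam) * Re (y x) /\ Im (ddy x) = (q x - lam) * Im (y x)).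
{ intros x. specialize (H3 x). assert (R3 := f_equal Re H3). assert (I3 := f_equal Im H3).
  simpl in R3, I3. unfold Re, Im in *. split; lra. }
split; split; intros x.
- now apply is_derive_Re.
- rewrite <- (proj1 (A x)). now apply is_derive_Re.
- now apply is_derive_Im.
- rewrite <- (proj2 (A x)). now apply is_derive_Im.
Qed.

Lemma is_derive_shift (f df : R -> R) (x : R) :
  (forall t, is_derive f t (df t)) -> is_derive (fun t => f (t + 1)) x (df (x + 1)).
Proof.
intros H. apply is_derive_eq with (scal 1 (df (x + 1))).
- apply (@is_derive_comp R_AbsRing R_NormedModule f (fun t => t + 1)); auto.
  auto_derive; auto.
- unfold scal; simpl; unfold mult; simpl; ring.
Qed.

Lemma linear_dependence_2 (v1 v2 w1 w2 : C) : (v1 * w2 - v2 * w1 = 0)%C ->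
  exists c d : C, ~ (c = RtoC 0 /\ d = RtoC 0) /\
    (c * v1 + d * w1 = 0)%C /\ (c * v2 + d * w2 = 0)%C.
Proof.
intros H.
destruct (classic (v1 = 0%C /\ v2 = 0%C)) as [[Z1 Z2]|N].
- exists (RtoC 1), (RtoC 0). rewrite Z1, Z2. repeat split.
  + intros [E _]. apply (f_equal fst) in E. simpl in E. lra.
  + ring.
  + ring.
- destruct (classic (v1 = 0%C)) as [Z1|Z1].
  + exists (- w2)%C, v2. repeat split.
    * intros [_ E]. tauto.
    * transitivity (- (v1 * w2 - v2 * w1))%C; [ring | rewrite H; ring].
    * ring.
  + exists (- w1)%C, v1. repeat split.
    * intros [_ E]. tauto.
    * ring.
    * transitivity (v1 * w2 - v2 * w1)%C; [ring | exact H].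
Qed.

Lemma linear_dependence_3 (u1 u2 v1 v2 w1 w2 : C) :
  exists c d e : C, ~ (c = RtoC 0 /\ d = RtoC 0 /\ e = RtoC 0) /\
    (c * u1 + d * v1 + e * w1 = 0)%C /\ (c * u2 + d * v2 + e * w2 = 0)%C.
Proof.
destruct (classic (u1 * v2 - u2 * v1 = 0)%C) as [Z|Z].
- destruct (linear_dependence_2 _ _ _ _ Z) as [c [d [N [E1 E2]]]].
  exists c, d, (RtoC 0). repeat split.
  + tauto.
  + rewrite E1. ring.
  + rewrite E2. ring.
- exists (v1 * w2 - v2 * w1)%C, (w1 * u2 - w2 * u1)%C, (u1 * v2 - u2 * v1)%C. repeat split.
  + tauto.
  + ring.
  + ring.
Qed.

Lemma lin_comb_zero (n : nat) (fs : list (R -> C)) (x : R) :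
  lin_comb (repeat (RtoC 0) n) fs x = RtoC 0.
Proof.
revert fs. induction n as [|n IH]; intros [|f fs]; try reflexivity.
unfold lin_comb in *. simpl. rewrite IH. ring.
Qed.

Lemma lin_comb_cons (c : C) (cs : list C) (f : R -> C) (fs : list (R -> C)) (x : R) :
  lin_comb (c :: cs) (f :: fs) x = (c * f x + lin_comb cs fs x)%C.
Proof. reflexivity. Qed.

Section Eigenspace.

Variables (q : R -> R) (lam : R) (y1 d1 y2 d2 : R -> R).
Hypothesis q_periodic : forall x, q (x + 1) = q x.
Hypothesis fund : fundamental_system (fun x => q x - lam) y1 d1 y2 d2.

(** The vectors [(y 0, y' 0)] for which the solution [y] has period 1. *)
Definition monodromy_fixes (a b : R) : Prop :=
  y1 1 * a + y2 1 * b = a /\ d1 1 * a + d2 1 * b = b.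

Lemma periodic_solution_fixed (y d : R -> R) :
  linear_solution (fun x => q x - lam) y d -> (forall x, y (x + 1) = y x) ->
  monodromy_fixes (y 0) (d 0).
Proof.
intros S P.
destruct (solution_coordinates _ _ _ _ _ _ _ fund S 1) as [A B]. destruct S as [Hy Hd].
assert (D : d (0 + 1) = d 0).
{ assert (H1 := is_derive_shift y d 0 Hy).
  assert (H2 : is_derive y 0 (d (0 + 1))).
  { apply (is_derive_ext (fun t => y (t + 1))); auto. }
  apply is_derive_unique in H2. rewrite <- H2. apply is_derive_unique, Hy. }
assert (E := P 0). rewrite Rplus_0_l in D, E. split; lra.
Qed.

Lemma eigenfunction_coordinates (f : R -> C) : periodic_eigenspace q (RtoC lam) f ->
  exists v1 v2 : C, (forall x, f x = (v1 * RtoC (y1 x) + v2 * RtoC (y2 x))%C) /\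
    monodromy_fixes (Re v1) (Re v2) /\ monodromy_fixes (Im v1) (Im v2).
Proof.
intros [[df S] P]. destruct (schrodinger_real_parts _ _ _ _ S) as [SR SI].
exists (f 0), (df 0). split; [|split].
- intros x. destruct (solution_coordinates _ _ _ _ _ _ _ fund SR x) as [A _].
  destruct (solution_coordinates _ _ _ _ _ _ _ fund SI x) as [B _].
  apply injective_projections; simpl; unfold Re, Im in *; lra.
- apply (periodic_solution_fixed _ _ SR). intros x. now rewrite P.
- apply (periodic_solution_fixed _ _ SI). intros x. now rewrite P.
Qed.

Lemma fixed_eigenfunction (a b : R) : monodromy_fixes a b ->
  periodic_eigenspace q (RtoC lam) (fun x => RtoC (a * y1 x + b * y2 x)).
Proof.
intros [F1 F2].
assert (S : linear_solution (fun x => q x - lam) (fun x => a * y1 x + b * y2 x) (fun x => a * d1 x + b * d2 x)).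
{ destruct fund as [[H1 H1'] [[H2 H2'] _]]. split; intros x.
  - apply derive_plus; now apply derive_scal.
  - eapply is_derive_eq; [apply derive_plus; apply derive_scal; auto|]. simpl. ring. }
split.
- exists (fun x => RtoC (a * d1 x + b * d2 x)), (fun x => RtoC ((q x - lam) * (a * y1 x + b * y2 x))).
  destruct S as [Hy Hd]. split; [|split]; intros x.
  + now apply is_derive_RtoC.
  + now apply is_derive_RtoC.
  + apply injective_projections; simpl; ring.
- intros x. f_equal. destruct S as [Hy Hd].
  (* The translate solves the same equation, as [q] has period 1, and has the same data at 0, as
     [(a, b)] is fixed. *)
  assert (S' : linear_solution (fun x => q x - lam) (fun x => a * y1 (x + 1) + b * y2 (x + 1))
                 (fun x => a * d1 (x + 1) + b * d2 (x + 1))).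
  { split; intros t.
    - apply (is_derive_shift (fun x => a * y1 x + b * y2 x) (fun x => a * d1 x + b * d2 x)); auto.
    - rewrite <- q_periodic.
      apply (is_derive_shift (fun x => a * d1 x + b * d2 x)
               (fun x => (q x - lam) * (a * y1 x + b * y2 x))); auto. }
  destruct (solution_coordinates _ _ _ _ _ _ _ fund S' x) as [A _]. rewrite A, !Rplus_0_l.
  replace (a * y1 1 + b * y2 1) with a by lra. replace (a * d1 1 + b * d2 1) with b by lra. reflexivity.
Qed.

(** For a monodromy matrix [M] of determinant 1, [det (M - I) = 2 - tr M], so nonzero fixed vectors
    exist exactly when the trace is 2. *)
Lemma eigenspace_dim_nonzero (d : nat) : has_dim (periodic_eigenspace q (RtoC lam)) d ->
  (d <> 0%nat <-> y1 1 + d2 1 = 2).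
Proof.
assert (W := wronskian _ _ _ _ _ fund 1).
assert (T : forall a b, monodromy_fixes a b -> (a <> 0 \/ b <> 0) -> y1 1 + d2 1 = 2).
{ intros a b [F1 F2] H.
  assert (A : (2 - (y1 1 + d2 1)) * a = 0).
  { replace (2 - (y1 1 + d2 1)) with ((y1 1 - 1) * (d2 1 - 1) - y2 1 * d1 1) by lra.
    replace (((y1 1 - 1) * (d2 1 - 1) - y2 1 * d1 1) * a)
      with ((d2 1 - 1) * (y1 1 * a + y2 1 * b - a) - y2 1 * (d1 1 * a + d2 1 * b - b)) by ring.
    rewrite F1, F2. ring. }
  assert (B : (2 - (y1 1 + d2 1)) * b = 0).
  { replace (2 - (y1 1 + d2 1)) with ((y1 1 - 1) * (d2 1 - 1) - y2 1 * d1 1) by lra.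
    replace (((y1 1 - 1) * (d2 1 - 1) - y2 1 * d1 1) * b)
      with ((y1 1 - 1) * (d1 1 * a + d2 1 * b - b) - d1 1 * (y1 1 * a + y2 1 * b - a)) by ring.
    rewrite F1, F2. ring. }
  apply Rmult_integral in A, B. lra. }
intros [fs [L [HE [HI HS]]]]. split.
- intros Hd. destruct fs as [|f fs]; [simpl in L; congruence|].
  inversion HE as [|f' fs' Hf Hfs]; subst.
  destruct (eigenfunction_coordinates f Hf) as [v1 [v2 [C1 [F1 F2]]]].
  destruct (classic (v1 = 0%C /\ v2 = 0%C)) as [[Z1 Z2]|N].
  + exfalso. specialize (HI (RtoC 1 :: repeat (RtoC 0) (length fs))).
    assert (X : List.Forall (fun c => c = RtoC 0) (RtoC 1 :: repeat (RtoC 0) (length fs))).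
    { apply HI.
      - simpl. now rewrite repeat_length.
      - intros x. rewrite lin_comb_cons, lin_comb_zero, C1, Z1, Z2. ring. }
    inversion X as [|c cs E _]. apply (f_equal fst) in E. simpl in E. lra.
  + destruct (Req_dec (Re v1) 0) as [R1|R1]; [|apply (T _ _ F1); auto].
    destruct (Req_dec (Re v2) 0) as [R2|R2]; [|apply (T _ _ F1); auto].
    apply (T _ _ F2). apply not_and_or. intros [I1 I2]. apply N.
    split; apply injective_projections; simpl; auto.
- intros E Hd. subst d. destruct fs as [|f fs]; [|simpl in Hd; congruence].
  (* The kernel of [M - I]: a vector orthogonal to a nonzero row, or [(1, 0)] when the first column
     vanishes. *)
  assert (X : exists a b, monodromy_fixes a b /\ (a <> 0 \/ b <> 0)).
  { assert (Z : (y1 1 - 1) * (d2 1 - 1) - y2 1 * d1 1 = 0) by lra.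
    destruct (Req_dec (y1 1 - 1) 0) as [Z1|Z1]; [destruct (Req_dec (y2 1) 0) as [Z2|Z2]|].
    - destruct (Req_dec (d1 1) 0) as [Z3|Z3].
      + exists 1, 0. split; [split; rewrite ?Z3; lra | left; lra].
      + exists (1 - d2 1), (d1 1). split; [split; [rewrite Z2; nra | ring] | auto].
    - exists (y2 1), (1 - y1 1). split; [split; [ring | nra] | auto].
    - exists (y2 1), (1 - y1 1). split; [split; [ring | nra] | right; lra]. }
  destruct X as [a [b [F N]]].
  destruct (HS _ (fixed_eigenfunction a b F)) as [cs [Lc HC]].
  destruct cs; [|simpl in Lc; congruence].
  assert (HC' : forall x, a * y1 x + b * y2 x = 0).
  { intros x. specialize (HC x). apply (f_equal fst) in HC. exact HC. }
  destruct fund as [[H1 _] [[H2 _] [E1 [E2 [E3 E4]]]]].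
  assert (A0 := HC' 0). rewrite E1, E3 in A0.
  assert (B0 : a * d1 0 + b * d2 0 = 0).
  { assert (D : is_derive (fun x => a * y1 x + b * y2 x) 0 (a * d1 0 + b * d2 0)).
    { apply derive_plus; apply derive_scal; auto. }
    apply (is_derive_ext _ (fun _ => 0)) in D; auto.
    apply is_derive_unique in D. rewrite <- D. apply is_derive_unique, derive_const. }
  rewrite E2, E4 in B0. lra.
Qed.

(** The identity fixes both [(1, 0)] and [(0, 1)], so [y1] and [y2] are independent eigenfunctions;
    three coordinate vectors in a plane are dependent. *)
Lemma eigenspace_dim_trivial (d : nat) : has_dim (periodic_eigenspace q (RtoC lam)) d ->
  y1 1 = 1 -> d1 1 = 0 -> y2 1 = 0 -> d2 1 = 1 -> d = 2%nat.
Proof.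
intros Hd M1 M2 M3 M4.
assert (N0 : d <> 0%nat) by (apply (eigenspace_dim_nonzero d Hd); lra).
destruct Hd as [fs [L [HE [HI HS]]]].
destruct fs as [|f [|g [|h fs]]]; simpl in L; auto.
- congruence.
- exfalso.
  destruct (HS _ (fixed_eigenfunction 1 0 ltac:(split; rewrite ?M1, ?M2, ?M3, ?M4; ring)))
    as [cs [Lc HC]].
  destruct (HS _ (fixed_eigenfunction 0 1 ltac:(split; rewrite ?M1, ?M2, ?M3, ?M4; ring)))
    as [cs' [Lc' HC']].
  destruct cs as [|c [|c0 cs]]; simpl in Lc; try congruence.
  destruct cs' as [|c' [|c0' cs']]; simpl in Lc'; try congruence.
  assert (E : forall x, (c' * RtoC (y1 x) = c * RtoC (y2 x))%C).
  { intros x. specialize (HC x). specialize (HC' x).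
    unfold lin_comb in HC, HC'; simpl in HC, HC'.
    replace (y1 x) with (1 * y1 x + 0 * y2 x) by ring.
    replace (y2 x) with (0 * y1 x + 1 * y2 x) at 2 by ring. rewrite HC, HC'. ring. }
  destruct fund as [_ [[H2 _] [E1 [_ [E3 E4]]]]].
  assert (c' = 0%C).
  { specialize (E 0). rewrite E1, E3, Cmult_1_r, Cmult_0_r in E. exact E. }
  subst c'.
  assert (Z : forall x, y2 x = 0).
  { intros x. specialize (HC' x). unfold lin_comb in HC'; simpl in HC'.
    apply (f_equal fst) in HC'. simpl in HC'. lra. }
  assert (D : d2 0 = 0).
  { assert (D := H2 0). apply (is_derive_ext _ (fun _ => 0)) in D; auto.
    apply is_derive_unique in D. rewrite <- D. apply is_derive_unique, derive_const. }
  lra.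
- exfalso. inversion HE as [|? ? Hf HE1]; subst. inversion HE1 as [|? ? Hg HE2]; subst.
  inversion HE2 as [|? ? Hh _]; subst.
  destruct (eigenfunction_coordinates f Hf) as [u1 [u2 [Cu _]]].
  destruct (eigenfunction_coordinates g Hg) as [v1 [v2 [Cv _]]].
  destruct (eigenfunction_coordinates h Hh) as [w1 [w2 [Cw _]]].
  destruct (linear_dependence_3 u1 u2 v1 v2 w1 w2) as [a [b [c [N [Z1 Z2]]]]].
  assert (X : List.Forall (fun c => c = RtoC 0) (a :: b :: c :: repeat (RtoC 0) (length fs))).
  { apply HI.
    - simpl. now rewrite repeat_length.
    - intros x. rewrite !lin_comb_cons, lin_comb_zero, Cu, Cv, Cw.
      transitivity ((a * u1 + b * v1 + c * w1) * RtoC (y1 x) + (a * u2 + b * v2 + c * w2) * RtoC (y2 x))%C;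
        [ring|]. rewrite Z1, Z2. ring. }
  inversion X as [|? ? Xa X1]; subst. inversion X1 as [|? ? Xb X2]; subst.
  inversion X2 as [|? ? Xc _]; subst. tauto.
Qed.

(** A nonzero row [(r, s)] of [M - I] annihilates the coordinates of every eigenfunction, so any two
    eigenfunctions are proportional. *)
Lemma eigenspace_dim_nontrivial (d : nat) : has_dim (periodic_eigenspace q (RtoC lam)) d ->
  ~ (y1 1 = 1 /\ d1 1 = 0 /\ y2 1 = 0 /\ d2 1 = 1) -> (d <= 1)%nat.
Proof.
intros [fs [L [HE [HI HS]]]] M.
destruct fs as [|f [|g fs]]; simpl in L; try lia. exfalso.
inversion HE as [|? ? Hf HE1]; subst. inversion HE1 as [|? ? Hg HE2]; subst.
destruct (eigenfunction_coordinates f Hf) as [u1 [u2 [Cu [[A1 A2] [A3 A4]]]]].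
destruct (eigenfunction_coordinates g Hg) as [v1 [v2 [Cv [[B1 B2] [B3 B4]]]]].
assert (Z : (u1 * v2 - u2 * v1 = 0)%C).
{ assert (K : exists r s, (r <> 0 \/ s <> 0) /\ (RtoC r * u1 + RtoC s * u2 = 0)%C /\
                                       (RtoC r * v1 + RtoC s * v2 = 0)%C).
  { assert (RowsA : forall r s, r * Re u1 + s * Re u2 = 0 -> r * Im u1 + s * Im u2 = 0 ->
      (RtoC r * u1 + RtoC s * u2 = 0)%C).
    { intros r s Hr Hi. apply injective_projections; simpl; unfold Re, Im in *; lra. }
    assert (RowsB : forall r s, r * Re v1 + s * Re v2 = 0 -> r * Im v1 + s * Im v2 = 0 ->
      (RtoC r * v1 + RtoC s * v2 = 0)%C).
    { intros r s Hr Hi. apply injective_projections; simpl; unfold Re, Im in *; lra. }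
    destruct (classic (y1 1 - 1 = 0 /\ y2 1 = 0)) as [[N1 N2]|N].
    - exists (d1 1), (d2 1 - 1). split.
      + apply not_and_or. intros [N3 N4]. apply M. repeat split; lra.
      + split; [apply RowsA | apply RowsB]; lra.
    - exists (y1 1 - 1), (y2 1). split.
      + now apply not_and_or.
      + split; [apply RowsA | apply RowsB]; lra. }
  destruct K as [r [s [Hrs [K1 K2]]]].
  assert (X : (RtoC r * (u1 * v2 - u2 * v1) = 0)%C).
  { transitivity ((RtoC r * u1 + RtoC s * u2) * v2 - u2 * (RtoC r * v1 + RtoC s * v2))%C; [ring|].
    rewrite K1, K2. ring. }
  assert (X' : (RtoC s * (u1 * v2 - u2 * v1) = 0)%C).
  { transitivity (u1 * (RtoC r * v1 + RtoC s * v2) - (RtoC r * u1 + RtoC s * u2) * v1)%C; [ring|].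
    rewrite K1, K2. ring. }
  apply NNPP. intros NZ. destruct Hrs as [H|H].
  - apply (Cmult_neq_0 (RtoC r) (u1 * v2 - u2 * v1)%C); auto.
    intros E. apply H. now apply RtoC_inj.
  - apply (Cmult_neq_0 (RtoC s) (u1 * v2 - u2 * v1)%C); auto.
    intros E. apply H. now apply RtoC_inj. }
destruct (linear_dependence_2 _ _ _ _ Z) as [a [b [N [Z1 Z2]]]].
assert (X : List.Forall (fun c => c = RtoC 0) (a :: b :: repeat (RtoC 0) (length fs))).
{ apply HI.
  - simpl. now rewrite repeat_length.
  - intros x. rewrite !lin_comb_cons, lin_comb_zero, Cu, Cv.
    transitivity ((a * u1 + b * v1) * RtoC (y1 x) + (a * u2 + b * v2) * RtoC (y2 x))%C;
      [ring|]. rewrite Z1, Z2. ring. }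
inversion X as [|? ? Xa X1]; subst. inversion X1 as [|? ? Xb X2]; subst. tauto.
Qed.

End Eigenspace.

(** * The periodic spectrum *)

Lemma derivative_sign_near (f : R -> R) (x l : R) : is_derive f x l -> l <> 0 ->
  exists d, 0 < d /\ forall t, 0 < t < d ->
    0 < l * (f (x + t) - f x) /\ l * (f (x - t) - f x) < 0.
Proof.
intros Hd Hl. apply is_derive_Reals in Hd.
destruct (Hd (Rabs l) (Rabs_pos_lt l Hl)) as [d H].
assert (A : forall h, h <> 0 -> Rabs h < d -> 0 < l * ((f (x + h) - f x) / h)).
{ intros h Hh Hhd. specialize (H h Hh Hhd).
  set (r := (f (x + h) - f x) / h) in *.
  unfold Rabs in H. destruct (Rcase_abs l); destruct (Rcase_abs (r - l)); nra. }
exists d. split; [apply cond_pos|]. intros t Ht. split.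
- specialize (A t ltac:(lra) ltac:(rewrite Rabs_right; lra)).
  replace (l * (f (x + t) - f x)) with (l * ((f (x + t) - f x) / t) * t) by (field; lra).
  apply Rmult_lt_0_compat; lra.
- specialize (A (- t) ltac:(lra) ltac:(rewrite Rabs_left; lra)).
  replace (f (x - t)) with (f (x + - t)) by (f_equal; ring).
  replace (l * (f (x + - t) - f x)) with (- (l * ((f (x + - t) - f x) / - t) * t)) by (field; lra).
  assert (0 < l * ((f (x + - t) - f x) / - t) * t) by (apply Rmult_lt_0_compat; lra). lra.
Qed.

Lemma pow_neg1_cases n : ((-1) ^ n = 1 \/ (-1) ^ n = -1).
Proof. induction n as [|n [E|E]]; simpl; rewrite ?E; lra. Qed.

Section Spectrum.

Variables (q : R -> R) (Q0 : R) (Y1 D1 Y2 D2 : R -> R -> R) (lam : nat -> R).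
Hypothesis q_periodic : forall x, q (x + 1) = q x.
Hypothesis q_cont : forall x, continuous q x.
Hypothesis q_le : forall x, Rabs (q x) <= Q0.
Hypothesis Y_fund : forall mu,
  fundamental_system (fun x => q x - mu) (Y1 mu) (D1 mu) (Y2 mu) (D2 mu).
Hypothesis lam_spec : periodic_eigenvalues q lam.

Notation disc := (discriminant Y1 D2).
Notation slope := (discriminant_slope Y1 D1 Y2 D2).
Notation trivial := (trivial_monodromy Y1 D1 Y2 D2).

Lemma lam_mono m n : (m <= n)%nat -> lam m <= lam n.
Proof.
intros H. induction H as [|n H IH]; [lra|].
apply Rle_trans with (lam n); auto. apply lam_spec.
Qed.

Lemma lam_lt_index m n : lam m < lam n -> (m < n)%nat.
Proof.
intros H. destruct (Nat.lt_ge_cases m n) as [L|L]; auto.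
apply lam_mono in L. lra.
Qed.

Lemma eigenvalue_index mu : disc mu = 2 -> exists n, lam n = mu.
Proof.
intros H. destruct lam_spec as [_ L]. destruct (L (RtoC mu)) as [l [_ [Hin Hd]]].
apply (eigenspace_dim_nonzero q mu _ _ _ _ q_periodic (Y_fund mu) _ Hd) in H.
destruct l as [|n l]; [now simpl in H|].
exists n. apply RtoC_inj. apply Hin. now left.
Qed.

Lemma disc_lam n : disc (lam n) = 2.
Proof.
destruct lam_spec as [_ L]. destruct (L (RtoC (lam n))) as [l [_ [Hin Hd]]].
apply (eigenspace_dim_nonzero q (lam n) _ _ _ _ q_periodic (Y_fund (lam n)) _ Hd).
assert (In n l) by now apply Hin. now destruct l.
Qed.

Lemma lam_multiplicity n :
  (~ trivial (lam n) /\ forall m, lam m = lam n -> m = n) \/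
  (trivial (lam n) /\ exists m, m <> n /\ lam m = lam n /\ forall p, lam p = lam n -> p = n \/ p = m).
Proof.
destruct lam_spec as [_ L]. destruct (L (RtoC (lam n))) as [l [ND [Hin Hd]]].
assert (Hin' : forall m, In m l <-> lam m = lam n).
{ intros m. rewrite Hin. split; [apply RtoC_inj | now intros ->]. }
assert (In n l) by now apply Hin'.
destruct (classic (trivial (lam n))) as [T|T].
- right. split; auto. destruct T as [T1 [T2 [T3 T4]]].
  assert (E := eigenspace_dim_trivial q _ _ _ _ _ q_periodic (Y_fund (lam n)) _ Hd T1 T2 T3 T4).
  destruct l as [|a [|b [|c l]]]; simpl in E; try discriminate.
  assert (N1 : a <> b) by (inversion ND as [|? ? N _]; subst; intros ->; apply N; now left).
  destruct H as [->|[->|[]]].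
  + exists b. split; auto. split; [apply Hin'; simpl; auto|].
    intros p Hp. apply Hin' in Hp. destruct Hp as [->|[->|[]]]; auto.
  + exists a. split; auto. split; [apply Hin'; simpl; auto|].
    intros p Hp. apply Hin' in Hp. destruct Hp as [->|[->|[]]]; auto.
- left. split; auto.
  assert (E := eigenspace_dim_nontrivial q _ _ _ _ _ (Y_fund (lam n)) _ Hd T).
  destruct l as [|a [|b l]]; simpl in E; try lia; [destruct H|].
  destruct H as [->|[]]. intros m Hm. apply Hin' in Hm. destruct Hm as [->|[]]; auto.
Qed.

Lemma disc_same_sign x y : x <= y -> (forall t, x <= t <= y -> disc t <> 2) ->
  0 < (disc x - 2) * (disc y - 2).
Proof.
intros Hxy H.
destruct (Req_dec x y) as [<-|N].
- assert (disc x - 2 <> 0) by (specialize (H x ltac:(lra)); lra). nra.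
- apply Rnot_le_lt. intros C.
  destruct (disc_reaches_2 q Q0 Y1 D1 Y2 D2 q_cont q_le Y_fund x y ltac:(lra) C) as [t [Ht E]].
  exact (H t Ht E).
Qed.

Lemma no_eigenvalue_between n t : (forall m, (m < n)%nat -> lam m < t) -> t < lam n -> disc t <> 2.
Proof.
intros H1 H2 E. destruct (eigenvalue_index t E) as [m <-].
apply lam_lt_index in H2. specialize (H1 m H2). lra.
Qed.

(* The sign flips at eigenvalues with nontrivial monodromy, which are listed once,
   and is negative on both sides of the others, which are listed twice. *)
Lemma disc_sign n x : (forall m, (m < n)%nat -> lam m < x) -> x < lam n ->
  0 < (-1) ^ n * (disc x - 2).
Proof.
revert x. induction n as [n IH] using lt_wf_ind. intros x H1 H2.
destruct n as [|p].
- set (y := Rmin x (- Q0) - 1).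
  assert (y1 : y < x) by (unfold y; assert (R := Rmin_l x (- Q0)); lra).
  assert (y2 : y < - Q0) by (unfold y; assert (R := Rmin_r x (- Q0)); lra).
  assert (S := disc_same_sign y x ltac:(lra)).
  assert (P := disc_below q Q0 Y1 D1 Y2 D2 q_le Y_fund y y2).
  simpl. rewrite Rmult_1_l.
  assert (0 < (disc y - 2) * (disc x - 2)).
  { apply S. intros t Ht. apply (no_eigenvalue_between 0); [intros; lia | lra]. }
  nra.
- assert (Hp : lam p < x) by (apply H1; lia).
  assert (ext : forall d, 0 < d -> exists t, 0 < t < d /\ lam p + t <= x).
  { intros d Hd. exists (Rmin (d / 2) (x - lam p)).
    assert (R1 := Rmin_l (d / 2) (x - lam p)). assert (R2 := Rmin_r (d / 2) (x - lam p)).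
    assert (0 < Rmin (d / 2) (x - lam p)) by (apply Rmin_pos; lra). lra. }
  assert (right : forall t, 0 < t -> lam p + t <= x -> 0 < (disc (lam p + t) - 2) * (disc x - 2)).
  { intros t Ht Htx. apply disc_same_sign; auto. intros s Hs.
    apply (no_eigenvalue_between (S p)); [|lra].
    intros m Hm. assert (M := lam_mono m p ltac:(lia)). lra. }
  assert (left : forall m d, (forall m', (m' < m)%nat -> lam m' < lam p) -> 0 < d ->
     exists t, 0 < t < d /\ forall m', (m' < m)%nat -> lam m' < lam p - t).
  { intros [|m] d Hm Hd.
    - exists (d / 2). split; [lra | intros; lia].
    - specialize (Hm m ltac:(lia)). exists (Rmin (d / 2) ((lam p - lam m) / 2)).
      assert (R1 := Rmin_l (d / 2) ((lam p - lam m) / 2)).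
      assert (R2 := Rmin_r (d / 2) ((lam p - lam m) / 2)).
      assert (0 < Rmin (d / 2) ((lam p - lam m) / 2)) by (apply Rmin_pos; lra).
      split; [lra|]. intros m' Hm'. assert (M := lam_mono m' m ltac:(lia)). lra. }
  assert (Dp := disc_lam p).
  destruct (lam_multiplicity p) as [[NT U]|[T [m [Hmp [Em U]]]]].
  + assert (Sl : slope (lam p) (lam p) <> 0).
    { apply (discriminant_slope_nonzero q Y1 D1 Y2 D2 Y_fund); auto. }
    destruct (derivative_sign_near disc (lam p) _
       (disc_derive q Q0 Y1 D1 Y2 D2 q_cont q_le Y_fund (lam p)) Sl) as [d [Hd HS]].
    rewrite Dp in HS. set (l := slope (lam p) (lam p)) in *.
    destruct (left p d) as [t [Ht HL]]; auto.
    { intros m Hm. assert (M := lam_mono m p ltac:(lia)).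
      destruct (Req_dec (lam m) (lam p)) as [E|E]; [apply U in E; lia | lra]. }
    assert (IHp := IH p ltac:(lia) (lam p - t) HL ltac:(lra)).
    destruct (HS t Ht) as [_ HS2].
    destruct (ext d Hd) as [s [Hs Hsx]]. destruct (HS s Hs) as [HS1 _].
    specialize (right s ltac:(lra) Hsx). simpl.
    destruct (pow_neg1_cases p) as [E|E]; rewrite E in *.
    * assert (l < 0) by nra. assert (disc (lam p + s) - 2 < 0) by nra. nra.
    * assert (0 < l) by nra. assert (0 < disc (lam p + s) - 2) by nra. nra.
  + destruct (discriminant_lt_near_trivial q Q0 Y1 D1 Y2 D2 q_cont q_le Y_fund (lam p) T) as [d [Hd HN]].
    (* The two indices of a double eigenvalue are adjacent, so [p = S m]. The induction hypothesis
       is used at [m], to the left of the eigenvalue, and [(-1) ^ m] is also the sign to the right,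
       at index [S (S m)]. *)
    assert (m < p)%nat.
    { destruct (Nat.lt_trichotomy m p) as [L|[L|L]]; auto; [lia|].
      assert (M := lam_mono (S p) m ltac:(lia)). lra. }
    assert (p = S m).
    { destruct (Nat.eq_dec p (S m)) as [E|E]; auto.
      assert (M1 := lam_mono m (S m) ltac:(lia)). assert (M2 := lam_mono (S m) p ltac:(lia)).
      destruct (U (S m) ltac:(lra)); lia. }
    subst p.
    destruct (left m d) as [t [Ht HL]]; auto.
    { intros m' Hm'. assert (M := lam_mono m' m ltac:(lia)).
      destruct (Req_dec (lam m') (lam m)) as [E|E]; [|lra].
      destruct (U m' ltac:(lra)); lia. }
    assert (IHm := IH m ltac:(lia) (lam (S m) - t) HL ltac:(lra)).
    assert (N1 := HN (lam (S m) - t) ltac:(lra) ltac:(rewrite Rabs_left; lra)).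
    destruct (ext d Hd) as [s [Hs Hsx]].
    assert (N2 := HN (lam (S m) + s) ltac:(lra) ltac:(rewrite Rabs_right; lra)).
    specialize (right s ltac:(lra) Hsx). simpl.
    destruct (pow_neg1_cases m) as [E|E]; rewrite E in *; nra.
Qed.

Lemma lam_lower n : - Q0 <= lam n.
Proof.
apply Rnot_lt_le. intros H.
apply (disc_below q Q0 Y1 D1 Y2 D2 q_le Y_fund) in H. rewrite disc_lam in H. lra.
Qed.

(** Equality would make the eigenvalue double, with [disc < 2] just to its left, whereas [disc_sign]
    at the even index [2 k] gives [disc > 2] there. *)
Lemma lam_even_lt k : lam (2 * k) < lam (2 * k + 1).
Proof.
assert (M := lam_mono (2 * k) (2 * k + 1) ltac:(lia)).
destruct (Req_dec (lam (2 * k)) (lam (2 * k + 1))) as [E|E]; [exfalso | lra].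
destruct (lam_multiplicity (2 * k)) as [[_ U]|[T [m [Hm [Em U]]]]].
{ specialize (U (2 * k + 1)%nat (eq_sym E)). lia. }
destruct (discriminant_lt_near_trivial q Q0 Y1 D1 Y2 D2 q_cont q_le Y_fund _ T) as [d [Hd HN]].
assert (Em' : m = (2 * k + 1)%nat) by (destruct (U (2 * k + 1)%nat (eq_sym E)); lia).
assert (X : exists t, 0 < t < d /\ forall m', (m' < 2 * k)%nat -> lam m' < lam (2 * k) - t).
{ assert (B : forall m', (m' < 2 * k)%nat -> lam m' < lam (2 * k)).
  { intros m' Hm'. assert (M' := lam_mono m' (2 * k) ltac:(lia)).
    destruct (Req_dec (lam m') (lam (2 * k))) as [E'|E']; [|lra].
    destruct (U m' E'); lia. }
  destruct (2 * k)%nat as [|r].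
  - exists (d / 2). split; [lra | intros; lia].
  - specialize (B r ltac:(lia)). exists (Rmin (d / 2) ((lam (S r) - lam r) / 2)).
    assert (R1 := Rmin_l (d / 2) ((lam (S r) - lam r) / 2)).
    assert (R2 := Rmin_r (d / 2) ((lam (S r) - lam r) / 2)).
    assert (0 < Rmin (d / 2) ((lam (S r) - lam r) / 2)) by (apply Rmin_pos; lra).
    split; [lra|]. intros m' Hm'. assert (M' := lam_mono m' r ltac:(lia)). lra. }
destruct X as [t [Ht HL]].
assert (S := disc_sign (2 * k) (lam (2 * k) - t) HL ltac:(lra)).
rewrite pow_1_even in S.
assert (N := HN (lam (2 * k) - t) ltac:(lra) ltac:(rewrite Rabs_left; lra)). lra.
Qed.

(** The drop from 2 to -2 is at least 4, which cancels the 4 in [disc_lipschitz]; the first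
    alternative covers gaps beyond the window of that lemma. *)
Lemma lam_gap k : 6 <= lam (2 * k + 1) - lam (2 * k) \/
  sqrt (lam (2 * k) + Q0 + 1) <= exp (2 * Q0 + 7) ^ 3 * (lam (2 * k + 1) - lam (2 * k)).
Proof.
destruct (Rle_lt_dec 6 (lam (2 * k + 1) - lam (2 * k))) as [G|G]; auto. right.
assert (L := lam_even_lt k). assert (Lo := lam_lower (2 * k)).
destruct (disc_dip q Q0 Y1 D1 Y2 D2 q_cont q_le Y_fund _ _ L (disc_lam _) (disc_lam _)) as [x [Hx Dx]].
{ intros x Hx. assert (S := disc_sign (2 * k + 1) x).
  rewrite Nat.add_1_r, pow_1_odd in S. rewrite Nat.add_1_r in Hx.
  assert (0 < -1 * (disc x - 2)); [|lra]. apply S; [|lra].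
  intros m Hm. assert (M := lam_mono m (2 * k) ltac:(lia)). lra. }
assert (B := disc_lipschitz q Q0 Y1 D1 Y2 D2 q_cont q_le Y_fund (lam (2 * k)) x Lo
   ltac:(rewrite Rabs_right; lra)).
rewrite disc_lam, Rabs_left, (Rabs_right (x - _)) in B by lra.
set (w := sqrt (lam (2 * k) + Q0 + 1)) in *.
assert (w1 : 1 <= w).
{ unfold w. rewrite <- sqrt_1 at 1. apply sqrt_le_1; lra. }
set (E := exp (2 * Q0 + 7) ^ 3) in *.
assert (E0 : 0 < E) by (apply pow_lt, exp_pos).
assert (C : 4 * w <= 4 * E * (x - lam (2 * k))).
{ replace (4 * E * (x - lam (2 * k))) with (4 * E / w * (x - lam (2 * k)) * w) by (field; lra).
  apply Rmult_le_compat_r; lra. }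
assert (E * (x - lam (2 * k)) <= E * (lam (2 * k + 1) - lam (2 * k))) by (apply Rmult_le_compat_l; lra).
lra.
Qed.

(** The square root in [lam_gap] is at least 1, so each gap contributes at least
    [exp (2 Q0 + 7) ^ (-3)]. This crude linear growth is then fed back into [lam_gap]. *)
Lemma lam_growth k : - Q0 + INR k / exp (2 * Q0 + 7) ^ 3 <= lam (2 * k).
Proof.
assert (q0 : 0 <= Q0) by (eapply Rle_trans; [apply Rabs_pos | apply (q_le 0)]).
set (E := exp (2 * Q0 + 7) ^ 3).
assert (E1 : 1 <= E).
{ unfold E. apply pow_R1_Rle. rewrite <- exp_0. apply exp_le_compat. lra. }
induction k as [|k IH].
- simpl. unfold Rdiv. rewrite Rmult_0_l, Rplus_0_r. apply lam_lower.
- rewrite S_INR. assert (M := lam_mono (2 * k + 1) (2 * S k) ltac:(lia)).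
  assert (Lo := lam_lower (2 * k)). assert (i1 : / E <= 1).
  { rewrite <- Rinv_1. apply Rinv_le_contravar; lra. }
  assert (G : / E <= lam (2 * k + 1) - lam (2 * k)).
  { destruct (lam_gap k) as [G|G]; [lra|]. fold E in G.
    assert (w1 : 1 <= sqrt (lam (2 * k) + Q0 + 1)) by (rewrite <- sqrt_1 at 1; apply sqrt_le_1; lra).
    apply Rmult_le_reg_l with E; [lra|]. rewrite Rinv_r by lra. lra. }
  unfold Rdiv in *. rewrite Rmult_plus_distr_r. lra.
Qed.

(** With [E = exp (2 Q0 + 7) ^ 3] the condition is [k >= 36 E ^ 3], so [lam_growth] gives
    [lam (2 k) + Q0 >= (6 E) ^ 2], as [lam_gap] requires. *)
Lemma lam_gap_6 k : 36 * exp (2 * Q0 + 7) ^ 9 <= INR k -> 6 <= lam (2 * k + 1) - lam (2 * k).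
Proof.
intros H. destruct (lam_gap k) as [G|G]; auto.
assert (P := lam_growth k).
replace (exp (2 * Q0 + 7) ^ 9) with ((exp (2 * Q0 + 7) ^ 3) ^ 3) in H by ring.
set (E := exp (2 * Q0 + 7) ^ 3) in *.
assert (E0 : 0 < E) by (apply pow_lt, exp_pos).
assert (A : 36 * E ^ 2 <= INR k / E).
{ apply Rmult_le_reg_r with E; auto. replace (INR k / E * E) with (INR k) by (field; lra). lra. }
assert (S : 6 * E <= sqrt (lam (2 * k) + Q0 + 1)).
{ rewrite <- (sqrt_pow2 (6 * E)) by lra. apply sqrt_le_1; nra. }
apply Rmult_le_reg_l with E; lra.
Qed.

Lemma disc_at_multiples_pi (j : nat) : 1 <= INR j -> 4 * exp Q0 ^ 3 * Q0 <= INR j ->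
  disc ((INR j * PI) ^ 2) <= 2 * (-1) ^ j + 1 /\ 2 * (-1) ^ j - 1 <= disc ((INR j * PI) ^ 2).
Proof.
intros H1 H2. assert (P : 3 < PI) by (assert (P := PI2_3_2); lra).
assert (W : INR j <= INR j * PI) by nra.
assert (A := disc_asymptotic q Q0 Y1 D1 Y2 D2 q_cont q_le Y_fund (INR j * PI) ltac:(lra)).
assert (C : cos (INR j * PI) = (-1) ^ j).
{ clear. induction j as [|j IH].
  - simpl. rewrite Rmult_0_l. apply cos_0.
  - rewrite S_INR, Rmult_plus_distr_r, Rmult_1_l, neg_cos, IH. simpl. ring. }
rewrite C in A.
assert (B : 4 * exp Q0 ^ 3 / (INR j * PI) * Q0 <= 1).
{ apply Rmult_le_reg_r with (INR j * PI); [lra|].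
  replace (4 * exp Q0 ^ 3 / (INR j * PI) * Q0 * (INR j * PI)) with (4 * exp Q0 ^ 3 * Q0) by (field; lra).
  lra. }
apply Rabs_le_between in A. lra.
Qed.

(** The values of [disc] are at most -1 at the squares of the two odd multiples of pi and at least 1
    at the even one in between; so there is a peak of height at least 2, and a crossing of the level
    2. *)
Lemma eigenvalue_cluster (j : nat) : 1 <= INR j -> 4 * exp Q0 ^ 3 * Q0 <= INR j ->
  exists n, (INR (2 * j + 1) * PI) ^ 2 < lam n < (INR (2 * j + 3) * PI) ^ 2.
Proof.
intros H1 H2. assert (P : 3 < PI) by (assert (P := PI2_3_2); lra).
assert (I1 : INR (2 * j + 1) = 2 * INR j + 1) by (rewrite plus_INR, mult_INR; simpl; lra).
assert (I2 : INR (2 * j + 2) = 2 * INR j + 2) by (rewrite plus_INR, mult_INR; simpl; lra).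
assert (I3 : INR (2 * j + 3) = 2 * INR j + 3) by (rewrite plus_INR, mult_INR; simpl; lra).
destruct (disc_at_multiples_pi (2 * j + 1)) as [A _]; [lra|lra|].
destruct (disc_at_multiples_pi (2 * j + 2)) as [_ B]; [lra|lra|].
destruct (disc_at_multiples_pi (2 * j + 3)) as [C _]; [lra|lra|].
replace (2 * j + 1)%nat with (S (2 * j)) in A at 2 by lia. rewrite pow_1_odd in A.
replace (2 * j + 2)%nat with (2 * (j + 1))%nat in B at 1 by lia. rewrite pow_1_even in B.
replace (2 * j + 3)%nat with (S (2 * (j + 1))) in C at 2 by lia. rewrite pow_1_odd in C.
assert (O : (INR (2 * j + 1) * PI) ^ 2 < (INR (2 * j + 2) * PI) ^ 2 < (INR (2 * j + 3) * PI) ^ 2).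
{ rewrite I1, I2, I3. split; nra. }
destruct (disc_peak q Q0 Y1 D1 Y2 D2 q_cont q_le Y_fund _ _ _ O) as [x [Hx Dx]]; try lra.
destruct (disc_reaches_2 q Q0 Y1 D1 Y2 D2 q_cont q_le Y_fund ((INR (2 * j + 1) * PI) ^ 2) x)
  as [y [Hy E]]; [lra|nra|].
destruct (eigenvalue_index y E) as [n En]. exists n. rewrite En.
assert (y <> (INR (2 * j + 1) * PI) ^ 2) by (intros ->; lra). lra.
Qed.

(** The open intervals for successive [i] are disjoint, so their eigenvalues increase strictly and
    the index rises by at least one each time. *)
Lemma lam_upper_shifted (J i : nat) : 1 <= INR J -> 4 * exp Q0 ^ 3 * Q0 <= INR J ->
  exists n, (i <= n)%nat /\
    (INR (2 * (J + i) + 1) * PI) ^ 2 < lam n < (INR (2 * (J + i) + 3) * PI) ^ 2.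
Proof.
intros H1 H2.
assert (HJ : forall i, INR J <= INR (J + i)) by (intros; apply le_INR; lia).
induction i as [|i [n [Hn IH]]].
- destruct (eigenvalue_cluster (J + 0)) as [n Hn];
    [specialize (HJ 0%nat); lra | specialize (HJ 0%nat); lra |].
  exists n. split; [lia | exact Hn].
- destruct (eigenvalue_cluster (J + S i)) as [n' Hn'];
    [specialize (HJ (S i)); lra | specialize (HJ (S i)); lra |].
  exists n'. split; auto.
  assert (lam n < lam n').
  { eapply Rlt_trans; [apply IH|].
    replace (2 * (J + i) + 3)%nat with (2 * (J + S i) + 1)%nat by lia. apply Hn'. }
  apply lam_lt_index in H. lia.
Qed.

(** The interval number [2 n] lies below [((2 J + 4 n + 3) PI) ^ 2]; for [n >= 1] the bracket is at
    most [(2 J + 7) n], and [PI <= 4] gives the factor 16. *)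
Lemma lam_upper (J n : nat) : 1 <= INR J -> 4 * exp Q0 ^ 3 * Q0 <= INR J -> (1 <= n)%nat ->
  lam (2 * n) <= 16 * (2 * INR J + 7) ^ 2 * INR n ^ 2.
Proof.
intros H1 H2 Hn. destruct (lam_upper_shifted J (2 * n) H1 H2) as [m [Hm B]].
apply lam_mono in Hm.
assert (N1 : 1 <= INR n) by (replace 1 with (INR 1) by reflexivity; now apply le_INR).
assert (P : PI <= 4) by apply PI_4. assert (P0 := PI_RGT_0).
replace (INR (2 * (J + 2 * n) + 3)) with (2 * INR J + 4 * INR n + 3) in B
  by (rewrite !plus_INR, !mult_INR, !plus_INR, mult_INR; simpl; ring).
assert (B' : (2 * INR J + 4 * INR n + 3) * PI <= (2 * INR J + 7) * INR n * 4).
{ apply Rmult_le_compat; nra. }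
assert (((2 * INR J + 4 * INR n + 3) * PI) ^ 2 <= ((2 * INR J + 7) * INR n * 4) ^ 2).
{ apply pow_incr. split; auto. apply Rmult_le_pos; lra. }
nra.
Qed.

End Spectrum.

(** * The difference scheme *)

Lemma Cmod_le_components (z : C) : Cmod z <= Rabs (Re z) + Rabs (Im z).
Proof.
replace z with (RtoC (Re z) + Ci * RtoC (Im z))%C at 1
  by (apply injective_projections; simpl; unfold Re, Im; ring).
eapply Rle_trans; [apply Cmod_triangle|].
rewrite Cmod_mult, Cmod_Ci, !Cmod_R. lra.
Qed.

Lemma Im_le_Cmod (z : C) : Rabs (Im z) <= Cmod z.
Proof. eapply Rle_trans; [apply Rmax_r | apply (Rmax_Cmod z)]. Qed.

Lemma Cmod_minus_triangle (x y : C) : Cmod (x - y) <= Cmod x + Cmod y.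
Proof. unfold Cminus. rewrite <- (Cmod_opp y). apply Cmod_triangle. Qed.

(** The mean value theorem is applied to real and imaginary parts separately, whence the factor
    2. *)
Lemma complex_mean_value (y dy : R -> C) (c : C) (a b K : R) : a <= b ->
  (forall x, @is_derive R_AbsRing C_R_NormedModule y x (dy x)) ->
  (forall x, a <= x <= b -> Cmod (dy x - c) <= K) ->
  Cmod (y b - y a - RtoC (b - a) * c) <= 2 * K * (b - a).
Proof.
intros Hab Hd HK.
assert (A : Rabs ((Re (y b) - b * Re c) - (Re (y a) - a * Re c)) <= K * (b - a)).
{ apply (derive_abs_le (fun t => Re (y t) - t * Re c) (fun t => Re (dy t) - 1 * Re c)); auto.
  - intros x _. apply derive_minus; [now apply is_derive_Re|].
    eapply is_derive_eq.
    + apply derive_mult; [apply (@is_derive_id R_AbsRing) | apply derive_const].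
    + simpl. unfold one; simpl. ring.
  - intros x Hx. eapply Rle_trans; [|apply (HK x Hx)].
    eapply Rle_trans; [|apply re_le_Cmod]. right. f_equal. simpl. unfold Re. ring. }
assert (B : Rabs ((Im (y b) - b * Im c) - (Im (y a) - a * Im c)) <= K * (b - a)).
{ apply (derive_abs_le (fun t => Im (y t) - t * Im c) (fun t => Im (dy t) - 1 * Im c)); auto.
  - intros x _. apply derive_minus; [now apply is_derive_Im|].
    eapply is_derive_eq.
    + apply derive_mult; [apply (@is_derive_id R_AbsRing) | apply derive_const].
    + simpl. unfold one; simpl. ring.
  - intros x Hx. eapply Rle_trans; [|apply (HK x Hx)].
    eapply Rle_trans; [|apply Im_le_Cmod]. right. f_equal. simpl. unfold Im. ring. }
eapply Rle_trans; [apply Cmod_le_components|].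
replace (Re (y b - y a - RtoC (b - a) * c)) with ((Re (y b) - b * Re c) - (Re (y a) - a * Re c))
  by (simpl; unfold Re, Im; ring).
replace (Im (y b - y a - RtoC (b - a) * c)) with ((Im (y b) - b * Im c) - (Im (y a) - a * Im c))
  by (simpl; unfold Re, Im; ring).
lra.
Qed.

Lemma discrete_gronwall (n : nat -> R) (r t : R) : 0 <= r -> 0 <= t -> n O <= 0 ->
  forall N, (forall k, (k < N)%nat -> n (S k) <= (1 + r) * n k + t) ->
  n N <= INR N * t * exp (r * INR N).
Proof.
intros Hr Ht H0 N H.
assert (A : forall k, (k <= N)%nat -> n k <= INR k * t * exp (r * INR k)).
{ induction k as [|k IH]; intros Hk.
  - simpl. lra.
  - specialize (IH ltac:(lia)). specialize (H k ltac:(lia)).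
    rewrite S_INR. assert (X : exp (r * (INR k + 1)) = exp (r * INR k) * exp r).
    { rewrite <- exp_plus. f_equal. ring. }
    rewrite X. assert (E := exp_ineq1_le r). assert (P := exp_pos (r * INR k)).
    assert (K0 := pos_INR k).
    assert (E1 : 1 <= exp (r * INR k)).
    { rewrite <- exp_0. apply exp_le_compat. now apply Rmult_le_pos. }
    assert (Z : 0 <= INR k * t * exp (r * INR k)).
    { apply Rmult_le_pos; [now apply Rmult_le_pos | lra]. }
    apply Rle_trans with (exp r * (INR k * t * exp (r * INR k)) + t * (exp (r * INR k) * exp r)).
    + apply Rle_trans with ((1 + r) * (INR k * t * exp (r * INR k)) + t * 1).
      * eapply Rle_trans; [exact H|]. rewrite Rmult_1_r. apply Rplus_le_compat_r.
        apply Rmult_le_compat_l; lra.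
      * apply Rplus_le_compat.
        -- apply Rmult_le_compat_r; lra.
        -- apply Rmult_le_compat_l; auto. assert (1 <= exp r) by lra. nra.
    + right. ring. }
now apply A.
Qed.

Section OneStep.

Variables (w h a kap : R) (r : C).
Hypotheses (w_ge1 : 1 <= w) (h_pos : 0 < h) (h_le : h <= 1 / 2) (hw_le : h * w ^ 2 <= kap).

(* The norm that diagonalizes the rotation [z' = p], [p' = - w^2 z]. *)
Definition rotation_norm (z p : C) : R :=
  Cmod (p + Ci * RtoC w * z) + Cmod (p - Ci * RtoC w * z).

Lemma rotation_norm_triangle (z p z' p' : C) :
  rotation_norm (z + z') (p + p') <= rotation_norm z p + rotation_norm z' p'.
Proof.
unfold rotation_norm.
replace (p + p' + Ci * RtoC w * (z + z'))%C with ((p + Ci * RtoC w * z) + (p' + Ci * RtoC w * z'))%C by ring.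
replace (p + p' - Ci * RtoC w * (z + z'))%C with ((p - Ci * RtoC w * z) + (p' - Ci * RtoC w * z'))%C by ring.
assert (T1 := Cmod_triangle (p + Ci * RtoC w * z) (p' + Ci * RtoC w * z')).
assert (T2 := Cmod_triangle (p - Ci * RtoC w * z) (p' - Ci * RtoC w * z')). lra.
Qed.

Lemma Cmod_Ciw_mult (z : C) : Cmod (Ci * RtoC w * z) = w * Cmod z.
Proof. rewrite !Cmod_mult, Cmod_Ci, Cmod_R, Rabs_right by lra. ring. Qed.

Lemma rotation_norm_le (z p : C) : rotation_norm z p <= 2 * (Cmod p + w * Cmod z).
Proof.
unfold rotation_norm.
assert (T1 := Cmod_triangle p (Ci * RtoC w * z)).
assert (T2 := Cmod_minus_triangle p (Ci * RtoC w * z)).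
rewrite Cmod_Ciw_mult in *. lra.
Qed.

Lemma rotation_norm_ge (z p : C) : Cmod p <= rotation_norm z p / 2 /\ w * Cmod z <= rotation_norm z p / 2.
Proof.
unfold rotation_norm.
assert (T1 := Cmod_triangle (p + Ci * RtoC w * z) (p - Ci * RtoC w * z)).
assert (T2 := Cmod_minus_triangle (p + Ci * RtoC w * z) (p - Ci * RtoC w * z)).
replace (p + Ci * RtoC w * z + (p - Ci * RtoC w * z))%C with (RtoC 2 * p)%C in T1 by ring.
replace (p + Ci * RtoC w * z - (p - Ci * RtoC w * z))%C with (RtoC 2 * (Ci * RtoC w * z))%C in T2 by ring.
rewrite Cmod_mult, Cmod_R, Rabs_right in T1, T2 by lra. rewrite Cmod_Ciw_mult in T2. lra.
Qed.

(** The excess over 1 is of second order: with [x = w h] it is [h (h w ^ 2) <= h kap], which stays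
    bounded when summed over the steps. *)
Lemma Cmod_1_plus_Ci (x : R) : Cmod (1 + Ci * RtoC x) <= 1 + x ^ 2.
Proof.
assert (P := pow2_ge_0 x).
rewrite <- (Rabs_right (Cmod (1 + Ci * RtoC x))) by (apply Rle_ge, Cmod_ge_0).
apply sqr_le_abs; [lra|]. rewrite Cmod2_alt. simpl. nra.
Qed.

(** Estimating [w |z| + |p|] directly would give a factor [1 + O(h w)], hence [exp (O(w))] after all
    steps. In the coordinates [p + i w z] and [p - i w z] a step is multiplication by [1 + i w h]
    and [1 - i w h], up to [e1] (from [b] differing from 1), [e2] (from the remainder [r]) and [e3]
    (from using the updated [z] in the equation for [p]), each [O(h)] relative to the norm. *)
Lemma one_step_growth (z p : C) (b d rho : R) :
  Rabs (b - 1) <= d * h -> Rabs b <= 2 -> Cmod r <= rho -> 0 <= d ->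
  rotation_norm (z + RtoC (h * b) * p)
     (p + RtoC h * (r - RtoC (w ^ 2)) * (z + RtoC (h * b) * p)) <=
  (1 + h * (3 * kap + d * kap + 4 * rho)) * rotation_norm z p.
Proof.
intros Hb Hb2 Hr d0.
destruct (rotation_norm_ge z p) as [Np Nz]. set (n := rotation_norm z p) in *.
assert (n0 : 0 <= n) by (assert (Q := Cmod_ge_0 p); lra).
assert (rho0 : 0 <= rho) by (assert (Q := Cmod_ge_0 r); lra).
assert (hw : h * w <= kap).
{ apply Rle_trans with (h * w ^ 2); [|exact hw_le]. apply Rmult_le_compat_l; nra. }
assert (hw0 : 0 < h * w) by (apply Rmult_lt_0_compat; lra).
assert (k0 : 0 <= kap) by lra.
assert (Cz : Cmod z <= n / 2) by (assert (Q := Cmod_ge_0 z); nra).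
set (z1 := (z + RtoC (h * b) * p)%C).
assert (Hhb : Cmod (RtoC (h * b) * p) <= h * n).
{ rewrite Cmod_mult, Cmod_R, Rabs_mult, (Rabs_right h) by lra.
  assert (Q := Cmod_ge_0 p). assert (Q' := Rabs_pos b).
  apply Rle_trans with (h * 2 * (n / 2)); [|lra].
  apply Rmult_le_compat; auto; [nra|]. apply Rmult_le_compat_l; lra. }
assert (Hz1 : Cmod z1 <= n).
{ unfold z1. eapply Rle_trans; [apply Cmod_triangle|]. nra. }
set (e1 := (Ci * RtoC (w * h * (b - 1)) * p)%C).
set (e2 := (RtoC h * r * z1)%C).
set (e3 := (RtoC (h * w ^ 2) * (RtoC (h * b) * p))%C).
assert (E1 : Cmod e1 <= h * (d * kap) * n / 2).
{ unfold e1. rewrite !Cmod_mult, Cmod_Ci, Cmod_R, Rmult_1_l, !Rabs_mult, (Rabs_right w), (Rabs_right h) by lra.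
  apply Rle_trans with (w * h * (d * h) * (n / 2)).
  - apply Rmult_le_compat; auto; try apply Cmod_ge_0.
    + apply Rmult_le_pos; [nra | apply Rabs_pos].
    + apply Rmult_le_compat_l; [nra | auto].
  - replace (w * h * (d * h) * (n / 2)) with (h * d * (n / 2) * (h * w)) by ring.
    replace (h * (d * kap) * n / 2) with (h * d * (n / 2) * kap) by field.
    apply Rmult_le_compat_l; auto. apply Rmult_le_pos; [nra | lra]. }
assert (E2 : Cmod e2 <= h * rho * n).
{ unfold e2. rewrite !Cmod_mult, Cmod_R, Rabs_right by lra.
  apply Rmult_le_compat; auto; try apply Cmod_ge_0.
  - apply Rmult_le_pos; [lra | apply Cmod_ge_0].
  - apply Rmult_le_compat_l; lra. }
assert (E3 : Cmod e3 <= h * kap * n).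
{ unfold e3. rewrite Cmod_mult, Cmod_R, Rabs_right by nra.
  replace (h * kap * n) with (kap * (h * n)) by ring.
  apply Rmult_le_compat; auto; [nra | apply Cmod_ge_0]. }
assert (R : Cmod (1 + Ci * RtoC (w * h)) <= 1 + h * kap).
{ eapply Rle_trans; [apply Cmod_1_plus_Ci|].
  replace ((w * h) ^ 2) with (h * (h * w ^ 2)) by ring. nra. }
assert (R' : Cmod (1 + Ci * RtoC (- (w * h))) <= 1 + h * kap).
{ eapply Rle_trans; [apply Cmod_1_plus_Ci|].
  replace ((- (w * h)) ^ 2) with (h * (h * w ^ 2)) by ring. nra. }
assert (up : Cmod (p + RtoC h * (r - RtoC (w ^ 2)) * z1 + Ci * RtoC w * z1) <=
   (1 + h * kap) * Cmod (p + Ci * RtoC w * z) + (h * (d * kap) * n / 2 + h * rho * n + h * kap * n)).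
{ replace (p + RtoC h * (r - RtoC (w ^ 2)) * z1 + Ci * RtoC w * z1)%C with
    ((1 + Ci * RtoC (w * h)) * (p + Ci * RtoC w * z) + (e1 + e2 - e3))%C.
  2:{ unfold e1, e2, e3, z1. apply injective_projections; simpl; ring. }
  eapply Rle_trans; [apply Cmod_triangle|]. rewrite Cmod_mult.
  apply Rplus_le_compat.
  - apply Rmult_le_compat_r; auto. apply Cmod_ge_0.
  - eapply Rle_trans; [apply Cmod_minus_triangle|].
    assert (T := Cmod_triangle e1 e2). lra. }
assert (um : Cmod (p + RtoC h * (r - RtoC (w ^ 2)) * z1 - Ci * RtoC w * z1) <=
   (1 + h * kap) * Cmod (p - Ci * RtoC w * z) + (h * (d * kap) * n / 2 + h * rho * n + h * kap * n)).
{ replace (p + RtoC h * (r - RtoC (w ^ 2)) * z1 - Ci * RtoC w * z1)%C with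
    ((1 + Ci * RtoC (- (w * h))) * (p - Ci * RtoC w * z) + (e2 - e1 - e3))%C.
  2:{ unfold e1, e2, e3, z1. apply injective_projections; simpl; ring. }
  eapply Rle_trans; [apply Cmod_triangle|]. rewrite Cmod_mult.
  apply Rplus_le_compat.
  - apply Rmult_le_compat_r; auto. apply Cmod_ge_0.
  - eapply Rle_trans; [apply Cmod_minus_triangle|].
    assert (T := Cmod_minus_triangle e2 e1). lra. }
unfold rotation_norm at 1. fold z1.
assert (Hn : n = Cmod (p + Ci * RtoC w * z) + Cmod (p - Ci * RtoC w * z)) by reflexivity.
assert (0 <= h * rho * n) by (apply Rmult_le_pos; [nra | auto]).
nra.
Qed.

End OneStep.

(** * Convergence of the scheme to the Schroedinger equation *)

Section Comparison.

Variables (alpha beta : R -> R) (B sigma w h kap : R) (lam : C).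
Hypothesis B0 : 0 <= B.
Hypotheses (alpha_le : forall x, Rabs (alpha x) <= B) (beta_le : forall x, Rabs (beta x) <= B).
Hypothesis alpha_lip : forall x y, Rabs (alpha x - alpha y) <= B * Rabs (x - y).
Hypothesis beta_lip : forall x y, Rabs (beta x - beta y) <= B * Rabs (x - y).
Hypothesis sigma_le : Rabs sigma <= 1.
Hypotheses (w_ge1 : 1 <= w) (w_sqr : w ^ 2 = Re lam + 3 * B + 3) (lam_im : Rabs (Im lam) <= 2).
Hypotheses (h_pos : 0 < h) (h_le : h <= 1 / 2) (hw_le : h * w ^ 2 <= kap).

Let q (x : R) : R := - 2 * alpha (2 * x) + sigma * beta (2 * x).
(** For [|s| <= 3 B] the number [s - lam + w ^ 2] has real part [s + 3 B + 3], at most [6 B + 3],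
    and imaginary part of modulus at most 2. *)
Let R0 : R := 6 * B + 5.

Lemma sigma_mult_le x : Rabs x <= B -> Rabs (sigma * x) <= B.
Proof.
intros Hx. rewrite Rabs_mult. assert (P := Rabs_pos x). assert (P' := Rabs_pos sigma). nra.
Qed.

Lemma q_bound x : Rabs (q x) <= 3 * B.
Proof.
unfold q. assert (A := alpha_le (2 * x)). assert (S := sigma_mult_le _ (beta_le (2 * x))).
apply Rabs_le_between in A, S. apply Rabs_le. lra.
Qed.

Lemma shifted_bound s : Rabs s <= 3 * B ->
  Cmod (RtoC s - lam + RtoC (w ^ 2)) <= R0 /\ Cmod (RtoC s - lam) <= (1 + R0) * w ^ 2.
Proof.
intros Hs. assert (A : Cmod (RtoC s - lam + RtoC (w ^ 2)) <= R0).
{ eapply Rle_trans; [apply Cmod_le_components|].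
  replace (Re (RtoC s - lam + RtoC (w ^ 2))) with (s + 3 * B + 3)
    by (rewrite w_sqr; simpl; unfold Re; ring).
  replace (Im (RtoC s - lam + RtoC (w ^ 2))) with (- Im lam) by (simpl; unfold Im; ring).
  rewrite Rabs_Ropp. unfold R0. apply Rabs_le_between in Hs.
  rewrite Rabs_right by lra. lra. }
split; auto.
replace (RtoC s - lam)%C with ((RtoC s - lam + RtoC (w ^ 2)) - RtoC (w ^ 2))%C by ring.
eapply Rle_trans; [apply Cmod_minus_triangle|].
assert (W : 1 <= w ^ 2) by nra.
rewrite (Cmod_R (w ^ 2)), (Rabs_right (w ^ 2)) by lra. unfold R0 in *. nra.
Qed.

Lemma schrodinger_bound (y dy : R -> C) (G0 : R) : schrodinger_solution q lam y dy -> 0 <= G0 ->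
  Cmod (dy 0) ^ 2 + w ^ 2 * Cmod (y 0) ^ 2 <= G0 ^ 2 ->
  forall x, 0 <= x <= 1 -> w * Cmod (y x) <= G0 * exp R0 /\ Cmod (dy x) <= G0 * exp R0.
Proof.
intros [ddy [H1 [H2 H3]]] G00 HG x Hx.
assert (A : forall x, Re (ddy x) = - w ^ 2 * Re (y x) + ((q x + 3 * B + 3) * Re (y x) + Im lam * Im (y x)) /\
                      Im (ddy x) = - w ^ 2 * Im (y x) + ((q x + 3 * B + 3) * Im (y x) - Im lam * Re (y x))).
{ intros t. specialize (H3 t). assert (R3 := f_equal Re H3). assert (I3 := f_equal Im H3).
  rewrite w_sqr. simpl in R3, I3. unfold Re, Im in *. split; lra. }
assert (E : Re (dy x) ^ 2 + Im (dy x) ^ 2 + w ^ 2 * (Re (y x) ^ 2 + Im (y x) ^ 2) <=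
  (Re (dy 0) ^ 2 + Im (dy 0) ^ 2 + w ^ 2 * (Re (y 0) ^ 2 + Im (y 0) ^ 2)) * exp (2 * R0 * x)).
{ apply (energy_bound w R0 x (fun t => Re (y t)) (fun t => Re (dy t))
     (fun t => Im (y t)) (fun t => Im (dy t)) (fun t => q t + 3 * B + 3) (fun _ => Im lam)); auto; try lra.
  - intros t _. assert (Q := q_bound t). apply Rabs_le_between in Q.
    unfold R0. split; [apply Rabs_le; lra | lra].
  - intros t _. now apply is_derive_Re.
  - intros t _. now apply is_derive_Im.
  - intros t _. rewrite <- (proj1 (A t)). now apply is_derive_Re.
  - intros t _. rewrite <- (proj2 (A t)). now apply is_derive_Im. }
rewrite <- !Cmod2_alt in E.
assert (X : exp (2 * R0 * x) <= exp R0 ^ 2).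
{ replace (exp R0 ^ 2) with (exp (R0 + R0)) by (rewrite exp_plus; ring).
  apply exp_le_compat. unfold R0. nra. }
assert (T : Cmod (dy x) ^ 2 + w ^ 2 * Cmod (y x) ^ 2 <= (G0 * exp R0) ^ 2).
{ eapply Rle_trans; [exact E|]. rewrite Rpow_mult_distr.
  assert (P := exp_pos (2 * R0 * x)).
  apply Rmult_le_compat; try lra.
  assert (0 <= Cmod (dy 0) ^ 2) by apply pow2_ge_0.
  assert (0 <= (w * Cmod (y 0)) ^ 2) by apply pow2_ge_0.
  rewrite Rpow_mult_distr in *. lra. }
assert (HP : 0 <= G0 * exp R0) by (apply Rmult_le_pos; [auto | left; apply exp_pos]).
assert (S1 : 0 <= Cmod (dy x) ^ 2) by apply pow2_ge_0.
assert (S2 : 0 <= (w * Cmod (y x)) ^ 2) by apply pow2_ge_0.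
assert (S3 : (w * Cmod (y x)) ^ 2 = w ^ 2 * Cmod (y x) ^ 2) by ring.
split; (eapply Rle_trans; [apply Rle_abs | apply sqr_le_abs; lra]).
Qed.

(** In [T1] the first term is the Taylor remainder of [y] and [B] comes from [b] differing from 1.
    In [T2], [12 B] is the variation of the potential over a step, [4 (1 + R0)] that of [y], and the
    last term the error of [z] carried into [p]. *)
Let T1 : R := 4 * (1 + R0) + B.
Let T2 : R := 12 * B + 4 * (1 + R0) + (1 + R0) * kap * T1.

(** The number [s] is the potential that the difference equation sees at the node [x + h]: from
    [a_k = 1 + h ^ 2 alpha_k] one has [2 - a_k - a_{k+1} = - h ^ 2 (alpha_k + alpha_{k+1})]. On the
    step it is within [6 B h] of [q]. *)
Lemma truncation_error (y dy : R -> C) (G x b : R) : schrodinger_solution q lam y dy -> 0 <= G ->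
  (forall t, x <= t <= x + h -> w * Cmod (y t) <= G /\ Cmod (dy t) <= G) ->
  Rabs (b - 1) <= B * h ->
  let s := sigma * beta (2 * (x + h)) - alpha (2 * (x + h)) - alpha (2 * x) in
  let tz := (y (x + h)%R - (y x + RtoC (h * b) * dy x))%C in
  let tp := (dy (x + h)%R - (dy x + RtoC h * (RtoC s - lam) * (y x + RtoC (h * b) * dy x)))%C in
  Cmod tz <= T1 * h ^ 2 * w * G /\ Cmod tp <= T2 * h ^ 2 * w ^ 2 * G.
Proof.
intros [ddy [H1 [H2 H3]]] G0 HG Hb s tz tp.
assert (W : 1 <= w ^ 2) by nra.
assert (R00 : 0 <= R0) by (unfold R0; lra).
assert (k0 : 0 <= kap) by nra.
assert (T10 : 0 <= T1) by (unfold T1; lra).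
assert (eqn : forall t, ddy t = ((RtoC (q t) - lam) * y t)%C).
{ intros t. specialize (H3 t).
  transitivity (RtoC (q t) * y t - (- ddy t + RtoC (q t) * y t))%C; [ring|]. rewrite H3. ring. }
assert (Sb : forall t, x <= t <= x + h -> Cmod (ddy t) <= (1 + R0) * w * G).
{ intros t Ht. rewrite eqn, Cmod_mult.
  destruct (HG t Ht) as [Gy _]. destruct (shifted_bound (q t) (q_bound t)) as [_ Sq].
  apply Rle_trans with ((1 + R0) * w ^ 2 * Cmod (y t)).
  - apply Rmult_le_compat_r; [apply Cmod_ge_0 | auto].
  - replace ((1 + R0) * w ^ 2 * Cmod (y t)) with ((1 + R0) * w * (w * Cmod (y t))) by ring.
    apply Rmult_le_compat_l; auto. apply Rmult_le_pos; lra. }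
assert (Dd : forall t, x <= t <= x + h -> Cmod (dy t - dy x) <= 2 * ((1 + R0) * w * G) * h).
{ intros t Ht.
  assert (M := complex_mean_value dy ddy (RtoC 0) x t ((1 + R0) * w * G) (proj1 Ht) H2).
  replace (dy t - dy x)%C with (dy t - dy x - RtoC (t - x) * 0)%C by ring.
  eapply Rle_trans; [apply M|].
  - intros u Hu. replace (ddy u - 0)%C with (ddy u) by ring. apply Sb. lra.
  - apply Rmult_le_compat_l; [|lra].
    apply Rmult_le_pos; [lra|]. apply Rmult_le_pos; [apply Rmult_le_pos; lra | auto]. }
assert (Dy : forall t, x <= t <= x + h -> Cmod (y t - y (x + h)%R) <= 2 * G * h).
{ intros t Ht.
  assert (M := complex_mean_value y dy (RtoC 0) t (x + h) G (proj2 Ht) H1).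
  replace (y t - y (x + h)%R)%C with (- (y (x + h)%R - y t - RtoC (x + h - t) * 0))%C by ring.
  rewrite Cmod_opp. eapply Rle_trans; [apply M|].
  - intros u Hu. replace (dy u - 0)%C with (dy u) by ring. apply HG. lra.
  - apply Rmult_le_compat_l; lra. }
assert (Btz : Cmod tz <= T1 * h ^ 2 * w * G).
{ assert (M := complex_mean_value y dy (dy x) x (x + h) (2 * ((1 + R0) * w * G) * h) ltac:(lra) H1 Dd).
  replace (x + h - x) with h in M by ring.
  replace tz with ((y (x + h)%R - y x - RtoC h * dy x) - RtoC (h * (b - 1)) * dy x)%C.
  2:{ unfold tz. rewrite !RtoC_mult, RtoC_minus. ring. }
  eapply Rle_trans; [apply Cmod_minus_triangle|].
  assert (L : Cmod (RtoC (h * (b - 1)) * dy x) <= B * h ^ 2 * w * G).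
  { rewrite Cmod_mult, Cmod_R, Rabs_mult, (Rabs_right h) by lra.
    destruct (HG x ltac:(lra)) as [_ Gd].
    apply Rle_trans with (h * (B * h) * (w * G)); [|right; ring].
    apply Rmult_le_compat; auto; try apply Cmod_ge_0.
    - apply Rmult_le_pos; [lra | apply Rabs_pos].
    - apply Rmult_le_compat_l; lra.
    - nra. }
  unfold T1. lra. }
split; auto.
assert (Hs : Rabs s <= 3 * B).
{ unfold s. assert (A1 := alpha_le (2 * (x + h))). assert (A2 := alpha_le (2 * x)).
  assert (A3 := sigma_mult_le _ (beta_le (2 * (x + h)))).
  apply Rabs_le_between in A1, A2, A3. apply Rabs_le. lra. }
destruct (shifted_bound s Hs) as [_ Qb].
assert (M := complex_mean_value dy ddy ((RtoC s - lam) * y (x + h)%R) x (x + h)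
   (h * w ^ 2 * G * (6 * B + 2 * (1 + R0))) ltac:(lra) H2).
replace (x + h - x) with h in M by ring.
replace tp with ((dy (x + h)%R - dy x - RtoC h * ((RtoC s - lam) * y (x + h)%R))
   + RtoC h * (RtoC s - lam) * tz)%C by (unfold tp, tz; ring).
eapply Rle_trans; [apply Cmod_triangle|].
(* The surplus factor [h w ^ 2] is bounded by [kap], and the remaining [w] by [w ^ 2]. *)
assert (L : Cmod (RtoC h * (RtoC s - lam) * tz) <= (1 + R0) * kap * T1 * h ^ 2 * w ^ 2 * G).
{ rewrite !Cmod_mult, Cmod_R, Rabs_right by lra.
  apply Rle_trans with (h * ((1 + R0) * w ^ 2) * (T1 * h ^ 2 * w * G)).
  - apply Rmult_le_compat; auto; try apply Cmod_ge_0.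
    + apply Rmult_le_pos; [lra | apply Cmod_ge_0].
    + apply Rmult_le_compat_l; lra.
  - replace (h * ((1 + R0) * w ^ 2) * (T1 * h ^ 2 * w * G))
      with ((1 + R0) * T1 * h ^ 2 * G * ((h * w ^ 2) * w)) by ring.
    replace ((1 + R0) * kap * T1 * h ^ 2 * w ^ 2 * G)
      with ((1 + R0) * T1 * h ^ 2 * G * (kap * w ^ 2)) by ring.
    apply Rmult_le_compat_l.
    + repeat apply Rmult_le_pos; lra.
    + apply Rmult_le_compat; auto; nra. }
assert (L' : Cmod (dy (x + h)%R - dy x - RtoC h * ((RtoC s - lam) * y (x + h)%R)) <=
  2 * (h * w ^ 2 * G * (6 * B + 2 * (1 + R0))) * h).
{ apply M. intros t Ht. rewrite eqn.
  replace ((RtoC (q t) - lam) * y t - (RtoC s - lam) * y (x + h)%R)%C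
    with (RtoC (q t - s) * y t + (RtoC s - lam) * (y t - y (x + h)%R))%C.
  2:{ rewrite RtoC_minus. ring. }
  eapply Rle_trans; [apply Cmod_triangle|]. rewrite !Cmod_mult, Cmod_R.
  assert (A1 : Rabs (q t - s) <= 6 * B * h).
  { unfold q, s. assert (L1 := alpha_lip (2 * (x + h)) (2 * t)). assert (L2 := alpha_lip (2 * x) (2 * t)).
    assert (L3 := beta_lip (2 * t) (2 * (x + h))).
    rewrite (Rabs_right (2 * (x + h) - _)) in L1 by lra.
    rewrite (Rabs_left1 (2 * x - _)) in L2 by lra.
    rewrite (Rabs_left1 (2 * t - _)) in L3 by lra.
    assert (L1' : Rabs (alpha (2 * (x + h)) - alpha (2 * t)) <= 2 * B * h) by nra.
    assert (L2' : Rabs (alpha (2 * x) - alpha (2 * t)) <= 2 * B * h) by nra.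
    assert (L3' : Rabs (beta (2 * t) - beta (2 * (x + h))) <= 2 * B * h) by nra.
    assert (L4 : Rabs (sigma * (beta (2 * t) - beta (2 * (x + h)))) <= 2 * B * h).
    { rewrite Rabs_mult. assert (P := Rabs_pos sigma).
      assert (P' := Rabs_pos (beta (2 * t) - beta (2 * (x + h)))). nra. }
    apply Rabs_le_between in L1', L2', L4. apply Rabs_le. lra. }
  destruct (HG t Ht) as [Gy _].
  assert (Gy' : Cmod (y t) <= w ^ 2 * G) by (assert (P := Cmod_ge_0 (y t)); nra).
  assert (U1 : Rabs (q t - s) * Cmod (y t) <= 6 * B * h * (w ^ 2 * G)).
  { apply Rmult_le_compat; auto; [apply Rabs_pos | apply Cmod_ge_0]. }
  assert (U2 : Cmod (RtoC s - lam) * Cmod (y t - y (x + h)%R) <= (1 + R0) * w ^ 2 * (2 * G * h)).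
  { apply Rmult_le_compat; auto; apply Cmod_ge_0. }
  lra. }
unfold T2. lra.
Qed.

Variable N : nat.
Hypothesis h_def : h * INR N = 1 / 2.

(** The initial error is 0 and each step adds [O(h ^ 2 w ^ 2)]; since [h N = 1/2], the sum is
    [O(h w ^ 2)] and the accumulated growth is the exponential of half the rate per unit length. *)
Lemma discrete_solution_error (y dy : R -> C) (G0 : R) (z p : nat -> C) (b : nat -> R) :
  schrodinger_solution q lam y dy -> 0 <= G0 ->
  Cmod (dy 0) ^ 2 + w ^ 2 * Cmod (y 0) ^ 2 <= G0 ^ 2 ->
  z O = y 0 -> p O = dy 0 ->
  (forall k, (k < N)%nat -> Rabs (b k - 1) <= B * h /\ Rabs (b k) <= 2) ->
  (forall k, (k < N)%nat -> z (S k) = (z k + RtoC (h * b k) * p k)%C) ->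
  (forall k, (k < N)%nat -> p (S k) = (p k + RtoC h * (RtoC (sigma * beta (2 * (INR (S k) * h))
     - alpha (2 * (INR (S k) * h)) - alpha (2 * (INR k * h))) - lam) * z (S k))%C) ->
  let K := (T1 + T2) * exp ((3 * kap + B * kap + 4 * R0) / 2) * exp R0 in
  w * Cmod (z N - y (1 / 2)%R) <= K * h * w ^ 2 * G0 /\
  Cmod (p N - dy (1 / 2)%R) <= K * h * w ^ 2 * G0.
Proof.
intros Sol G00 HG0 Ez Ep Hb Hz Hp K.
set (G := G0 * exp R0).
assert (G1 : 0 <= G) by (apply Rmult_le_pos; [auto | left; apply exp_pos]).
assert (HG := schrodinger_bound y dy G0 Sol G00 HG0). fold G in HG.
assert (R00 : 0 <= R0) by (unfold R0; lra).
assert (k0 : 0 <= kap) by nra.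
assert (T10 : 0 <= T1) by (unfold T1; lra).
assert (T20 : 0 <= T2).
{ unfold T2. assert (0 <= (1 + R0) * kap * T1) by (repeat apply Rmult_le_pos; lra). lra. }
assert (W : 1 <= w ^ 2) by nra.
set (n := fun k => rotation_norm w (z k - y (INR k * h)%R) (p k - dy (INR k * h)%R)).
set (rr := h * (3 * kap + B * kap + 4 * R0)).
set (t := 2 * (T1 + T2) * h ^ 2 * w ^ 2 * G).
assert (rr0 : 0 <= rr).
{ unfold rr. apply Rmult_le_pos; [lra|]. assert (0 <= B * kap) by now apply Rmult_le_pos. lra. }
assert (t0 : 0 <= t).
{ unfold t. apply Rmult_le_pos; auto. repeat apply Rmult_le_pos; lra. }
assert (N0 : n O <= 0).
{ unfold n. simpl. rewrite Rmult_0_l, Ez, Ep.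
  replace (y 0 - y 0)%C with (RtoC 0) by ring. replace (dy 0 - dy 0)%C with (RtoC 0) by ring.
  eapply Rle_trans; [apply rotation_norm_le; auto|]. rewrite Cmod_0. lra. }
assert (GR := discrete_gronwall n rr t rr0 t0 N0 N).
assert (Bd : n N <= INR N * t * exp (rr * INR N)).
{ apply GR. intros k Hk. specialize (Hz k Hk). specialize (Hp k Hk). destruct (Hb k Hk) as [Hb1 Hb2].
  assert (k1 : 0 <= INR k * h) by (apply Rmult_le_pos; [apply pos_INR | lra]).
  assert (k2 : INR k * h + h <= 1 / 2).
  { rewrite <- h_def. replace (INR k * h + h) with (h * INR (S k)) by (rewrite S_INR; ring).
    apply Rmult_le_compat_l; [lra|]. now apply le_INR. }
  destruct (truncation_error y dy G (INR k * h) (b k) Sol G1) as [E1 E2]; auto.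
  { intros u Hu. apply HG. lra. }
  replace (INR k * h + h) with (INR (S k) * h) in E1, E2 by (rewrite S_INR; ring).
  set (s := sigma * beta (2 * (INR (S k) * h)) - alpha (2 * (INR (S k) * h)) - alpha (2 * (INR k * h))) in *.
  set (ez := (z k - y (INR k * h)%R)%C) in *. set (ep := (p k - dy (INR k * h)%R)%C) in *.
  set (tz := (y (INR (S k) * h)%R - (y (INR k * h)%R + RtoC (h * b k) * dy (INR k * h)%R))%C) in *.
  set (tp := (dy (INR (S k) * h)%R - (dy (INR k * h)%R + RtoC h * (RtoC s - lam) *
    (y (INR k * h)%R + RtoC (h * b k) * dy (INR k * h)%R)))%C) in *.
  assert (Hs : Rabs s <= 3 * B).
  { unfold s. assert (A1 := alpha_le (2 * (INR (S k) * h))). assert (A2 := alpha_le (2 * (INR k * h))).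
    assert (A3 := sigma_mult_le _ (beta_le (2 * (INR (S k) * h)))).
    apply Rabs_le_between in A1, A2, A3. apply Rabs_le. lra. }
  destruct (shifted_bound s Hs) as [Rb _].
  assert (O := one_step_growth w h kap (RtoC s - lam + RtoC (w ^ 2))%C w_ge1 h_pos h_le hw_le
     ez ep (b k) B R0 Hb1 Hb2 Rb B0).
  assert (EZ : (z (S k) - y (INR (S k) * h)%R)%C = ((ez + RtoC (h * b k) * ep) + (- tz))%C).
  { rewrite Hz. unfold ez, ep, tz. ring. }
  assert (EP : (p (S k) - dy (INR (S k) * h)%R)%C =
     ((ep + RtoC h * (RtoC s - lam + RtoC (w ^ 2) - RtoC (w ^ 2)) * (ez + RtoC (h * b k) * ep)) + (- tp))%C).
  { rewrite Hp, Hz. unfold ez, ep, tp. ring. }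
  unfold n at 1. rewrite EZ, EP.
  eapply Rle_trans; [apply rotation_norm_triangle|].
  assert (TT := rotation_norm_le w w_ge1 (- tz) (- tp)). rewrite !Cmod_opp in TT.
  assert (w * Cmod tz <= T1 * h ^ 2 * w ^ 2 * G).
  { replace (T1 * h ^ 2 * w ^ 2 * G) with (w * (T1 * h ^ 2 * w * G)) by ring.
    apply Rmult_le_compat_l; lra. }
  unfold n. fold ez ep. unfold rr, t. lra. }
assert (hN : INR N = 1 / 2 / h).
{ rewrite <- h_def. field. lra. }
assert (Fin : INR N * t * exp (rr * INR N) = K * h * w ^ 2 * G0).
{ unfold K, t, G, rr.
  replace (h * (3 * kap + B * kap + 4 * R0) * INR N) with ((3 * kap + B * kap + 4 * R0) / 2)
    by (rewrite hN; field; lra).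
  rewrite hN. field. lra. }
rewrite Fin in Bd. unfold n in Bd.
replace (INR N * h) with (1 / 2) in Bd by lra.
destruct (rotation_norm_ge w w_ge1 (z N - y (1/2)%R) (p N - dy (1/2)%R)) as [F1 F2].
assert (P0 := Cmod_ge_0 (p N - dy (1/2)%R)). lra.
Qed.

End Comparison.

(** * From the scheme to the Toda discriminant *)

Lemma fundamental_family_exists (q : R -> R) (Q0 : R) :
  (forall x, continuous q x) -> (forall x, Rabs (q x) <= Q0) ->
  exists Y1 D1 Y2 D2 : R -> R -> R, forall lam,
    fundamental_system (fun x => q x - lam) (Y1 lam) (D1 lam) (Y2 lam) (D2 lam).
Proof.
intros Hc Hq.
assert (E : forall lam, exists s : (R -> R) * (R -> R) * (R -> R) * (R -> R),
  fundamental_system (fun x => q x - lam) (fst (fst (fst s))) (snd (fst (fst s))) (snd (fst s)) (snd s)).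
{ intros lam.
  destruct (fundamental_system_exists (fun x => q x - lam) (Q0 + Rabs lam)) as [y1 [d1 [y2 [d2 H]]]].
  - intros x. apply continuous_sub; [apply Hc | apply continuous_const].
  - intros x. eapply Rle_trans; [apply Rabs_triang|]. rewrite Rabs_Ropp. apply Rplus_le_compat_r, Hq.
  - now exists (y1, d1, y2, d2). }
set (f := fun lam => proj1_sig (constructive_indefinite_description _ (E lam))).
exists (fun lam => fst (fst (fst (f lam)))), (fun lam => snd (fst (fst (f lam)))),
  (fun lam => snd (fst (f lam))), (fun lam => snd (f lam)).
intros lam. exact (proj2_sig (constructive_indefinite_description _ (E lam))).
Qed.

Section PotentialBounds.

Variables (alpha beta : R -> R) (B : R).
Hypotheses (alpha_C2 : C2_0 alpha) (beta_C2 : C2_0 beta).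
Hypotheses (alpha_norm : C2_norm_le B alpha) (beta_norm : C2_norm_le B beta).

Lemma C2_bound_nonneg : 0 <= B.
Proof. eapply Rle_trans; [apply Rabs_pos | apply (alpha_norm 0)]. Qed.

Lemma C2_lipschitz (f : R -> R) : C2_0 f -> C2_norm_le B f ->
  forall x y, Rabs (f x - f y) <= B * Rabs (x - y).
Proof.
intros [_ [Hf _]] Hn.
assert (A : forall x y, y <= x -> Rabs (f x - f y) <= B * Rabs (x - y)).
{ intros x y H. rewrite (Rabs_right (x - y)) by lra.
  apply (derive_abs_le f (Derive f)); auto.
  - intros t _. apply Derive_correct, Hf.
  - intros t _. apply Hn. }
intros x y. destruct (Rle_lt_dec y x) as [H|H]; auto.
rewrite Rabs_minus_sym, (Rabs_minus_sym x). apply A. lra.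
Qed.

(** The value -1 of [sigma] gives [q_plus] and 1 gives [q_minus], so both edges share one
    argument. *)
Definition toda_potential (sigma x : R) : R := - 2 * alpha (2 * x) + sigma * beta (2 * x).

Lemma toda_potential_periodic sigma x : toda_potential sigma (x + 1) = toda_potential sigma x.
Proof.
destruct alpha_C2 as [Pa _]. destruct beta_C2 as [Pb _]. unfold toda_potential.
replace (2 * (x + 1)) with (2 * x + 1 + 1) by ring. now rewrite !Pa, !Pb.
Qed.

Lemma toda_potential_continuous sigma x : continuous (toda_potential sigma) x.
Proof.
destruct alpha_C2 as [_ [Da _]]. destruct beta_C2 as [_ [Db _]].
apply (ex_derive_continuous (V := R_NormedModule)). unfold toda_potential.
apply (ex_derive_plus (V := R_NormedModule) (fun x => - 2 * alpha (2 * x)) (fun x => sigma * beta (2 * x))).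
- auto_derive. apply Da.
- auto_derive. apply Db.
Qed.

End PotentialBounds.

Lemma even_pow_neg1 (n : nat) : (if Z.even (Z.of_nat n) then 1 else -1) = (-1) ^ n.
Proof.
induction n as [|n IH]; auto. rewrite Nat2Z.inj_succ, Z.even_succ, <- Z.negb_even. simpl.
rewrite <- IH. destruct (Z.even (Z.of_nat n)); simpl; ring.
Qed.

Lemma schrodinger_solution_ext (q q' : R -> R) (lam : C) (y dy : R -> C) :
  (forall x, q x = q' x) -> schrodinger_solution q lam y dy -> schrodinger_solution q' lam y dy.
Proof.
intros E [ddy [H1 [H2 H3]]]. exists ddy. split; [exact H1|split; [exact H2|]].
intros x. now rewrite <- E.
Qed.

Section TraceComparison.

Variables (alpha beta : R -> R) (B sigma kap w : R) (N : nat) (lam : C).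
Hypotheses (alpha_C2 : C2_0 alpha) (beta_C2 : C2_0 beta).
Hypotheses (alpha_norm : C2_norm_le B alpha) (beta_norm : C2_norm_le B beta).
Hypothesis sigma_le : Rabs sigma <= 1.
Hypotheses (w_ge1 : 1 <= w) (w_sqr : w ^ 2 = Re lam + 3 * B + 3) (lam_im : Rabs (Im lam) <= 2).
Hypotheses (N_ge1 : 1 <= INR N) (N_ge : B <= INR N).

Let h : R := 1 / (2 * INR N).
Hypothesis hw_le : h * w ^ 2 <= kap.

Let a (k : Z) : R := toda_a alpha N k.

(** Common normal form near both edges: at [mu = 2 - h ^ 2 lam] with [b] moved to the right and
    [sigma = -1]; at [mu = - 2 + h ^ 2 lam] after multiplication by [(-1) ^ k], with [sigma = 1]. *)
Definition scalar_difference_solution (s : Z -> C) : Prop := forall k : Z,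
  (RtoC (a (k - 1)) * s (k - 1)%Z + RtoC (a k) * s (k + 1)%Z =
   (RtoC (2 + h ^ 2 * (sigma * beta (IZR k / INR N))) - RtoC (h ^ 2) * lam) * s k)%C.

(** From [B <= N] follows [h B <= 1/2], so [h ^ 2 |alpha| <= 1/4] and [a] is bounded away from 0. *)
Lemma toda_a_bounds k : 1 / 2 <= a k /\ Rabs (/ a k - 1) <= B * h /\ Rabs (/ a k) <= 2.
Proof.
assert (B0 := C2_bound_nonneg alpha B alpha_norm).
assert (A := proj1 (alpha_norm (IZR k / INR N))).
assert (Ea : a k = 1 + h ^ 2 * alpha (IZR k / INR N)).
{ unfold a, toda_a, h. field. lra. }
set (x := alpha (IZR k / INR N)) in *.
assert (h0 : 0 < h) by (apply Rdiv_lt_0_compat; lra).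
assert (hN : h * INR N = 1 / 2) by (unfold h; field; lra).
assert (hB : h * B <= 1 / 2) by nra.
assert (h1 : h <= 1 / 2) by nra.
assert (D : Rabs (h ^ 2 * x) <= h * (h * B)).
{ rewrite Rabs_mult, Rabs_right by nra. replace (h * (h * B)) with (h ^ 2 * B) by ring.
  apply Rmult_le_compat_l; nra. }
assert (D' : h * (h * B) <= 1 / 4) by nra.
assert (D2 := D). apply Rabs_le_between in D2.
assert (a2 : 1 / 2 <= a k) by lra. split; auto.
assert (ia : 0 < / a k <= 2).
{ split; [apply Rinv_0_lt_compat; lra|].
  replace 2 with (/ (1 / 2)) by field. apply Rinv_le_contravar; lra. }
split.
- replace (/ a k - 1) with (- (h ^ 2 * x) * / a k) by (rewrite Ea in *; field; lra).
  rewrite Rabs_mult, Rabs_Ropp, (Rabs_right (/ a k)) by lra.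
  apply Rle_trans with (h * (h * B) * 2).
  + apply Rmult_le_compat; try lra. apply Rabs_pos.
  + assert (0 <= h * B) by (apply Rmult_le_pos; lra). nra.
- rewrite Rabs_right; lra.
Qed.

(** The constant [K] of [discrete_solution_error] with its abbreviations expanded; it depends on [B]
    and [kap] alone. *)
Definition scheme_constant : R :=
  (4 * (1 + (6 * B + 5)) + B + (12 * B + 4 * (1 + (6 * B + 5)) +
     (1 + (6 * B + 5)) * kap * (4 * (1 + (6 * B + 5)) + B)))
  * exp ((3 * kap + B * kap + 4 * (6 * B + 5)) / 2) * exp (6 * B + 5).

Lemma difference_solution_error (s : Z -> C) (y dy : R -> C) (G0 : R) :
  scalar_difference_solution s ->
  schrodinger_solution (toda_potential alpha beta sigma) lam y dy -> 0 <= G0 ->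
  Cmod (dy 0) ^ 2 + w ^ 2 * Cmod (y 0) ^ 2 <= G0 ^ 2 ->
  s 0%Z = y 0 -> (RtoC (a 0 / h) * (s 1%Z - s 0%Z) = dy 0)%C ->
  w * Cmod (s (Z.of_nat N) - y (1 / 2)%R) <= scheme_constant * h * w ^ 2 * G0 /\
  Cmod (RtoC (a (Z.of_nat N) / h) * (s (Z.of_nat N + 1)%Z - s (Z.of_nat N)) - dy (1 / 2)%R)
    <= scheme_constant * h * w ^ 2 * G0.
Proof.
intros Hs Sol G00 HG0 E0 E1.
assert (B0 := C2_bound_nonneg alpha B alpha_norm).
assert (h0 : 0 < h) by (apply Rdiv_lt_0_compat; lra).
assert (hN : h * INR N = 1 / 2) by (unfold h; field; lra).
assert (h1 : h <= 1 / 2) by nra.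
assert (grid : forall k : nat, 2 * (INR k * h) = IZR (Z.of_nat k) / INR N).
{ intros k. rewrite <- INR_IZR_INZ. unfold h. field. lra. }
apply (discrete_solution_error alpha beta B sigma w h kap lam B0
  (fun x => proj1 (alpha_norm x)) (fun x => proj1 (beta_norm x))
  (C2_lipschitz B alpha alpha_C2 alpha_norm) (C2_lipschitz B beta beta_C2 beta_norm)
  sigma_le w_ge1 w_sqr lam_im h0 h1 hw_le N hN y dy G0
  (fun k => s (Z.of_nat k))
  (fun k => RtoC (a (Z.of_nat k) / h) * (s (Z.of_nat k + 1)%Z - s (Z.of_nat k)))%C
  (fun k => / a (Z.of_nat k))); auto.
- intros k _. apply toda_a_bounds.
- intros k _. destruct (toda_a_bounds (Z.of_nat k)) as [A _].
  rewrite Nat2Z.inj_succ. unfold Z.succ.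
  transitivity (s (Z.of_nat k) + RtoC (h * / a (Z.of_nat k) * (a (Z.of_nat k) / h)) *
    (s (Z.of_nat k + 1)%Z - s (Z.of_nat k)))%C.
  + replace (h * / a (Z.of_nat k) * (a (Z.of_nat k) / h)) with 1 by (field; lra). ring.
  + rewrite (RtoC_mult (h * / a (Z.of_nat k))). ring.
- intros k _. specialize (Hs (Z.of_nat (S k))). rewrite !grid, Nat2Z.inj_succ in *. unfold Z.succ in *.
  replace (Z.of_nat k + 1 - 1)%Z with (Z.of_nat k) in Hs by ring.
  set (j := Z.of_nat k) in *.
  assert (Ea : forall i, a i = 1 + h ^ 2 * alpha (IZR i / INR N)).
  { intros i. unfold a, toda_a, h. field. lra. }
  set (be := beta (IZR (j + 1) / INR N)) in *.
  assert (H2 : (RtoC (a (j + 1)) * s (j + 1 + 1)%Z =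
     (RtoC (2 + h ^ 2 * (sigma * be)) - RtoC (h ^ 2) * lam) * s (j + 1)%Z - RtoC (a j) * s j)%C).
  { rewrite <- Hs. ring. }
  assert (hne : RtoC h <> RtoC 0) by (intros X; apply RtoC_inj in X; lra).
  assert (Hd : forall x, RtoC (x / h) = (RtoC x / RtoC h)%C) by (intros; apply RtoC_div; lra).
  rewrite !Hd.
  transitivity ((RtoC (a (j + 1)) * s (j + 1 + 1)%Z - RtoC (a (j + 1)) * s (j + 1)%Z) / RtoC h)%C;
    [field; auto|].
  rewrite H2, !Ea, !RtoC_plus, !RtoC_minus, !RtoC_mult, !RtoC_pow. field; auto.
Qed.

(** In the scheme [s1] starts with momentum [- a_0 / h], so it does not approximate [y1]. The
    combination [s1 + s2] has value 1 and momentum 0, matching [y1], and [(h / a_0) s2] has value 0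
    and momentum 1, matching [y2]. As [a_N = a_0], the value of the first plus the momentum of the
    second at [N] is [s1(N) + s2(N) + s2(N+1) - s2(N)], the discrete trace. The initial energies are
    [w ^ 2] and 1; the extra [w] of the first is divided out in the value. *)
Lemma trace_comparison (s1 s2 : Z -> C) (D : C) :
  scalar_difference_solution s1 -> scalar_difference_solution s2 ->
  s1 0%Z = RtoC 1 -> s1 1%Z = RtoC 0 -> s2 0%Z = RtoC 0 -> s2 1%Z = RtoC 1 ->
  is_Delta_H (toda_potential alpha beta sigma) lam D ->
  Cmod (s1 (Z.of_nat N) + s2 (Z.of_nat N + 1)%Z - D) <= 2 * scheme_constant * h * w ^ 2.
Proof.
intros H1 H2 E10 E11 E20 E21 [y1 [dy1 [y2 [dy2 [S1 [S2 [F1 [F2 [F3 [F4 ->]]]]]]]]]].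
assert (h0 : 0 < h) by (apply Rdiv_lt_0_compat; lra).
destruct (toda_a_bounds 0) as [A0 _].
assert (aN : a (Z.of_nat N) = a 0).
{ unfold a, toda_a. rewrite <- INR_IZR_INZ. destruct alpha_C2 as [P _].
  do 2 f_equal. replace (INR N / INR N) with (0 / INR N + 1) by (field; lra). apply P. }
assert (L1 : scalar_difference_solution (fun k => s1 k + s2 k)%C).
{ intros k. specialize (H1 k). specialize (H2 k).
  match type of H1 with _ = (?c * _)%C => transitivity (c * s1 k + c * s2 k)%C end; [|ring].
  rewrite <- H1, <- H2. ring. }
assert (L2 : scalar_difference_solution (fun k => RtoC (h / a 0) * s2 k)%C).
{ intros k. specialize (H2 k).
  transitivity (RtoC (h / a 0) * (RtoC (a (k - 1)) * s2 (k - 1)%Z + RtoC (a k) * s2 (k + 1)%Z))%C; [ring|].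
  rewrite H2. ring. }
assert (one : RtoC (a 0%Z / h * (h / a 0%Z)) = RtoC 1).
{ f_equal. field. lra. }
destruct (difference_solution_error _ y1 dy1 w L1 S1) as [C1 _]; try lra.
{ rewrite F1, F2, Cmod_0, Cmod_1. right; ring. }
{ rewrite E10, E20, F1. ring. }
{ rewrite E10, E20, E11, E21, F2. ring. }
destruct (difference_solution_error _ y2 dy2 1 L2 S2) as [_ C2]; try lra.
{ rewrite F3, F4, Cmod_0, Cmod_1. right; ring. }
{ rewrite E20, F3. ring. }
{ rewrite E20, E21, F4. transitivity (RtoC (a 0%Z / h * (h / a 0%Z))); [rewrite RtoC_mult; ring | exact one]. }
rewrite aN in C2. rewrite Rmult_1_r in C2.
replace (RtoC (a 0 / h) * (RtoC (h / a 0) * s2 (Z.of_nat N + 1)%Z - RtoC (h / a 0) * s2 (Z.of_nat N)))%C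
  with (s2 (Z.of_nat N + 1)%Z - s2 (Z.of_nat N))%C in C2.
2:{ transitivity (RtoC (a 0%Z / h * (h / a 0%Z)) * (s2 (Z.of_nat N + 1)%Z - s2 (Z.of_nat N)))%C.
    - rewrite one. ring.
    - rewrite RtoC_mult. ring. }
assert (C1' : Cmod (s1 (Z.of_nat N) + s2 (Z.of_nat N) - y1 (1 / 2)%R) <= scheme_constant * h * w ^ 2).
{ apply Rmult_le_reg_l with w; lra. }
replace (s1 (Z.of_nat N) + s2 (Z.of_nat N + 1)%Z - (y1 (1 / 2)%R + dy2 (1 / 2)%R))%C with
  ((s1 (Z.of_nat N) + s2 (Z.of_nat N) - y1 (1 / 2)%R) +
   (s2 (Z.of_nat N + 1)%Z - s2 (Z.of_nat N) - dy2 (1 / 2)%R))%C by ring.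
eapply Rle_trans; [apply Cmod_triangle|]. lra.
Qed.

End TraceComparison.

Lemma toda_step_sqr (N : nat) : 1 <= INR N -> (1 / (2 * INR N)) ^ 2 = 1 / (4 * INR N ^ 2).
Proof. intros H. field. lra. Qed.

Lemma Delta_plus_comparison (alpha beta : R -> R) (B kap w : R) (N : nat) (lam DN D : C) :
  C2_0 alpha -> C2_0 beta -> C2_norm_le B alpha -> C2_norm_le B beta ->
  1 <= w -> w ^ 2 = Re lam + 3 * B + 3 -> Rabs (Im lam) <= 2 ->
  1 <= INR N -> B <= INR N -> 1 / (2 * INR N) * w ^ 2 <= kap ->
  is_Delta_N alpha beta N (RtoC 2 - RtoC (1 / (4 * INR N ^ 2))%R * lam)%C DN ->
  is_Delta_H (q_plus alpha beta) lam D ->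
  Cmod (DN - D) <= 2 * scheme_constant B kap * (1 / (2 * INR N)) * w ^ 2.
Proof.
intros Ha Hb Na Nb Hw Hw2 Him HN HNB Hk [s1 [s2 [S1 [S2 [E10 [E11 [E20 [E21 ->]]]]]]]] HD.
assert (T : forall s, difference_solution alpha beta N (RtoC 2 - RtoC (1 / (4 * INR N ^ 2))%R * lam)%C s ->
   scalar_difference_solution alpha beta (-1) N lam s).
{ intros s Hs k. specialize (Hs k). unfold toda_b in Hs.
  rewrite toda_step_sqr by auto. rewrite RtoC_plus, !RtoC_mult.
  rewrite RtoC_mult in Hs.
  set (A := (RtoC (toda_a alpha N (k - 1)) * s (k - 1)%Z)%C) in *.
  set (A' := (RtoC (toda_a alpha N k) * s (k + 1)%Z)%C) in *.
  set (e := RtoC (1 / (4 * INR N ^ 2))) in *. set (be := RtoC (beta (IZR k / INR N))) in *.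
  transitivity (A + e * be * s k + A' - e * be * s k)%C; [ring|]. rewrite Hs.
  replace (RtoC (-1)) with (- RtoC 1)%C by (now rewrite <- RtoC_opp). ring. }
apply (trace_comparison alpha beta B (-1) kap w N lam); auto.
- rewrite Rabs_left; lra.
- destruct HD as [y1 [dy1 [y2 [dy2 [U1 [U2 U]]]]]]. exists y1, dy1, y2, dy2.
  split; [|split]; auto; (eapply schrodinger_solution_ext; [|eassumption]);
    intros x; unfold q_plus, toda_potential; ring.
Qed.

(** Multiplication by [(-1) ^ k] carries the edge -2 to the edge 2. The second solution needs
    another sign to keep the value 1 at [k = 1], so both terms of the trace, at [N] and at [N + 1],
    acquire the same factor [(-1) ^ N]. *)
Lemma Delta_minus_comparison (alpha beta : R -> R) (B kap w : R) (N : nat) (lam DN D : C) :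
  C2_0 alpha -> C2_0 beta -> C2_norm_le B alpha -> C2_norm_le B beta ->
  1 <= w -> w ^ 2 = Re lam + 3 * B + 3 -> Rabs (Im lam) <= 2 ->
  1 <= INR N -> B <= INR N -> 1 / (2 * INR N) * w ^ 2 <= kap ->
  is_Delta_N alpha beta N (RtoC (- 2)%R + RtoC (1 / (4 * INR N ^ 2))%R * lam)%C DN ->
  is_Delta_H (q_minus alpha beta) lam D ->
  Cmod (DN - RtoC ((- 1) ^ N)%R * D) <= 2 * scheme_constant B kap * (1 / (2 * INR N)) * w ^ 2.
Proof.
intros Ha Hb Na Nb Hw Hw2 Him HN HNB Hk [s1 [s2 [S1 [S2 [E10 [E11 [E20 [E21 ->]]]]]]]] HD.
set (sg := fun k : Z => RtoC (if Z.even k then 1 else -1)).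
assert (sgS : forall k, sg (k + 1)%Z = (- sg k)%C /\ sg (k - 1)%Z = (- sg k)%C).
{ intros k. unfold sg. rewrite <- !RtoC_opp. rewrite Z.even_add, Z.even_sub. simpl.
  destruct (Z.even k); simpl; split; f_equal; ring. }
assert (T : forall c s, difference_solution alpha beta N (RtoC (- 2)%R + RtoC (1 / (4 * INR N ^ 2))%R * lam)%C s ->
   scalar_difference_solution alpha beta 1 N lam (fun k => c * sg k * s k)%C).
{ intros c s Hs k. specialize (Hs k). unfold toda_b in Hs. destruct (sgS k) as [P1 P2].
  rewrite P1, P2.
  rewrite toda_step_sqr by auto. rewrite RtoC_plus, !RtoC_mult.
  rewrite RtoC_mult in Hs.
  set (A := RtoC (toda_a alpha N (k - 1))) in *.
  set (A' := RtoC (toda_a alpha N k)) in *.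
  set (e := RtoC (1 / (4 * INR N ^ 2))) in *. set (be := RtoC (beta (IZR k / INR N))) in *.
  transitivity (- (c * sg k) * (A * s (k - 1)%Z + e * be * s k + A' * s (k + 1)%Z - e * be * s k))%C; [ring|].
  rewrite Hs.
  replace (RtoC (-2)) with (- RtoC 2)%C by (now rewrite <- RtoC_opp). ring. }
assert (sgN : sg (Z.of_nat N) = RtoC ((-1) ^ N)) by (unfold sg; now rewrite even_pow_neg1).
assert (sq : (RtoC ((-1) ^ N) * RtoC ((-1) ^ N) = RtoC 1)%C).
{ rewrite <- RtoC_mult. f_equal. destruct (pow_neg1_cases N) as [E|E]; rewrite E; ring. }
assert (Cm : Cmod (RtoC ((-1) ^ N)) = 1).
{ rewrite Cmod_R. apply pow_1_abs. }
assert (X : Cmod (RtoC 1 * sg (Z.of_nat N) * s1 (Z.of_nat N) +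
    RtoC (-1) * sg (Z.of_nat N + 1)%Z * s2 (Z.of_nat N + 1)%Z - D) <=
    2 * scheme_constant B kap * (1 / (2 * INR N)) * w ^ 2).
{ apply (trace_comparison alpha beta B 1 kap w N lam Ha Hb Na Nb ltac:(rewrite Rabs_right; lra)
    Hw Hw2 Him HN HNB Hk (fun k => RtoC 1 * sg k * s1 k)%C (fun k => RtoC (-1) * sg k * s2 k)%C D
    (T _ _ S1) (T _ _ S2)); unfold sg; simpl.
  - rewrite E10. ring.
  - rewrite E11. ring.
  - rewrite E20. ring.
  - rewrite E21. apply injective_projections; simpl; ring.
  - destruct HD as [y1 [dy1 [y2 [dy2 [U1 [U2 U]]]]]]. exists y1, dy1, y2, dy2.
    split; [|split]; auto; (eapply schrodinger_solution_ext; [|eassumption]);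
      intros x; unfold q_minus, toda_potential; ring. }
destruct (sgS (Z.of_nat N)) as [P _]. rewrite P, sgN in X.
replace (s1 (Z.of_nat N) + s2 (Z.of_nat N + 1)%Z - RtoC ((-1) ^ N) * D)%C
  with (RtoC ((-1) ^ N) * (RtoC 1 * RtoC ((-1) ^ N) * s1 (Z.of_nat N) +
    RtoC (-1) * (- RtoC ((-1) ^ N)) * s2 (Z.of_nat N + 1)%Z - D))%C.
- rewrite Cmod_mult, Cm, Rmult_1_l. exact X.
- transitivity ((RtoC ((-1) ^ N) * RtoC ((-1) ^ N)) * s1 (Z.of_nat N) +
    (RtoC ((-1) ^ N) * RtoC ((-1) ^ N)) * s2 (Z.of_nat N + 1)%Z - RtoC ((-1) ^ N) * D)%C.
  + replace (RtoC (-1)) with (- RtoC 1)%C by (now rewrite <- RtoC_opp). ring.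
  + rewrite sq. ring.
Qed.

(** * Size of the boxes and choice of the constants *)

Lemma integer_part_bounds (x : R) : 0 <= x ->
  INR (integer_part x) <= x /\ x < INR (integer_part x) + 1.
Proof.
intros Hx. destruct (base_Int_part x) as [H1 H2]. unfold integer_part.
assert (0 <= Int_part x)%Z.
{ apply Z.lt_succ_r. apply lt_IZR. rewrite succ_IZR. simpl. lra. }
rewrite INR_IZR_INZ, Z2Nat.id by auto. lra.
Qed.

Lemma integer_part_ge (n : nat) (x : R) : INR n <= x -> (n <= integer_part x)%nat.
Proof.
intros H. assert (P := pos_INR n). destruct (integer_part_bounds x ltac:(lra)) as [_ B].
apply Nat.lt_succ_r, INR_lt. rewrite S_INR. lra.
Qed.

Lemma Rpower_le_self (x e : R) : 1 <= x -> e <= 1 -> Rpower x e <= x.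
Proof.
intros Hx He. rewrite <- (Rpower_1 x) at 2 by lra. apply Rle_Rpower; lra.
Qed.

Lemma scheme_constant_nonneg (B kap : R) : 0 <= B -> 0 <= kap -> 0 <= scheme_constant B kap.
Proof.
intros HB Hk. unfold scheme_constant.
assert (0 <= (1 + (6 * B + 5)) * kap * (4 * (1 + (6 * B + 5)) + B)).
{ repeat apply Rmult_le_pos; lra. }
apply Rmult_le_pos; [apply Rmult_le_pos; [lra|]|]; left; apply exp_pos.
Qed.

Lemma nat_above (x : R) : exists n : nat, x <= INR n.
Proof.
destruct (Rle_lt_dec 0 x) as [H|H].
- exists (S (integer_part x)). rewrite S_INR. destruct (integer_part_bounds x H). lra.
- exists O. simpl. lra.
Qed.

(** The spectral bounds with [Q0 = 3 B], hence uniform over all potentials under consideration. *)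
Lemma toda_potential_spectrum (alpha beta : R -> R) (B sigma : R) (lam : nat -> R) :
  C2_0 alpha -> C2_0 beta -> C2_norm_le B alpha -> C2_norm_le B beta -> Rabs sigma <= 1 ->
  periodic_eigenvalues (toda_potential alpha beta sigma) lam ->
  - (3 * B) <= lam O /\
  (forall k, 36 * exp (2 * (3 * B) + 7) ^ 9 <= INR k -> 6 <= lam (2 * k + 1)%nat - lam (2 * k)%nat) /\
  (forall J n, 1 <= INR J -> 4 * exp (3 * B) ^ 3 * (3 * B) <= INR J -> (1 <= n)%nat ->
     lam (2 * n)%nat <= 16 * (2 * INR J + 7) ^ 2 * INR n ^ 2).
Proof.
intros Ha Hb Na Nb Hs Hlam.
assert (Hc := toda_potential_continuous alpha beta Ha Hb sigma).
assert (Hq : forall x, Rabs (toda_potential alpha beta sigma x) <= 3 * B).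
{ apply q_bound; auto.
  - intros x; apply Na.
  - intros x; apply Nb. }
assert (Hp := toda_potential_periodic alpha beta Ha Hb sigma).
destruct (fundamental_family_exists _ _ Hc Hq) as [Y1 [D1 [Y2 [D2 HY]]]].
split; [|split].
- exact (lam_lower _ _ Y1 D1 Y2 D2 lam Hp Hq HY Hlam O).
- intros k. exact (lam_gap_6 _ _ Y1 D1 Y2 D2 lam Hp Hc Hq HY Hlam k).
- intros J n. exact (lam_upper _ _ Y1 D1 Y2 D2 lam Hp Hc Hq HY Hlam J n).
Qed.

Lemma periodic_eigenvalues_ext (q q' : R -> R) (lam : nat -> R) :
  (forall x, q x = q' x) -> periodic_eigenvalues q lam -> periodic_eigenvalues q' lam.
Proof.
intros E [H1 H2]. split; auto. intros mu. destruct (H2 mu) as [l [ND [Hin [fs [L [A1 [A2 A3]]]]]]].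
exists l. split; [exact ND|]. split; [exact Hin|]. exists fs. split; [exact L|].
split; [|split]; auto.
- revert A1. apply List.Forall_impl. intros f [[df S] P]. split; auto.
  exists df. now apply (schrodinger_solution_ext q).
- intros f [[df S] P]. apply A3. split; auto. exists df.
  apply (schrodinger_solution_ext q'); auto.
Qed.

Lemma q_plus_toda_potential (alpha beta : R -> R) (x : R) :
  q_plus alpha beta x = toda_potential alpha beta (-1) x.
Proof. unfold q_plus, toda_potential. ring. Qed.

Lemma q_minus_toda_potential (alpha beta : R -> R) (x : R) :
  q_minus alpha beta x = toda_potential alpha beta 1 x.
Proof. unfold q_minus, toda_potential. ring. Qed.

Section GrowthFunction.

Variables (eta : R) (F : nat -> R).
Hypothesis eta_bounds : 0 < eta < 1 / 2.
Hypothesis F_ge1 : forall n, (1 <= n)%nat -> 1 <= F n.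
Hypothesis F_le : forall n, (1 <= n)%nat -> F n <= Rpower (INR n) eta.

Lemma INR_ge1 n : (1 <= n)%nat -> 1 <= INR n.
Proof. intros H. change 1 with (INR 1). now apply le_INR. Qed.

(** This is where [eta < 1/2] enters. *)
Lemma F_sqr_le n : (1 <= n)%nat -> F n ^ 2 <= INR n.
Proof.
intros Hn. assert (H1 := F_ge1 n Hn). assert (H2 := F_le n Hn).
apply Rle_trans with (Rpower (INR n) eta * Rpower (INR n) eta); [nra|].
rewrite <- Rpower_plus. apply Rpower_le_self; [now apply INR_ge1 | lra].
Qed.

Lemma integer_part_F_bounds n : (1 <= n)%nat ->
  (1 <= integer_part (F n))%nat /\ INR (integer_part (F n)) <= F n /\
  INR (integer_part (F n)) <= INR n.
Proof.
intros Hn. assert (H1 := F_ge1 n Hn).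
destruct (integer_part_bounds (F n) ltac:(lra)) as [A _].
split; [apply integer_part_ge; exact H1 | split; auto].
assert (H2 := F_le n Hn).
assert (H3 := Rpower_le_self (INR n) eta (INR_ge1 n Hn) ltac:(lra)). lra.
Qed.

(** On the box [Re z <= lam (2 [F M]) + 2], so [w ^ 2 <= U [F M] ^ 2 + 3 B + 5], and [F M >= 1]
    absorbs the last terms. The second bound follows from [F M ^ 2 <= M <= N]. *)
Lemma box_bound (B U w : R) (lam : nat -> R) (N M : nat) (z : C) :
  0 <= B -> 0 <= U ->
  (forall n, (1 <= n)%nat -> lam (2 * n)%nat <= U * INR n ^ 2) ->
  (1 <= N)%nat -> M = integer_part (F N) -> in_box F lam M z ->
  w ^ 2 = Re z + 3 * B + 3 ->
  w ^ 2 <= (U + 3 * B + 5) * F M ^ 2 /\ 1 / (2 * INR N) * w ^ 2 <= U + 3 * B + 5.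
Proof.
intros HB HU Hlam HN HM [[_ Hz] _] Hw.
destruct (integer_part_F_bounds N HN) as [M1 [_ M3]]. rewrite <- HM in M1, M3.
destruct (integer_part_F_bounds M M1) as [n1 [n2 _]].
specialize (Hlam _ n1). set (n := integer_part (F M)) in *.
assert (n1' := INR_ge1 n n1).
assert (HF : INR n ^ 2 <= F M ^ 2) by nra.
assert (A : w ^ 2 <= (U + 3 * B + 5) * F M ^ 2).
{ assert (U * INR n ^ 2 <= U * F M ^ 2) by (apply Rmult_le_compat_l; auto).
  assert (1 <= F M ^ 2) by nra.
  assert (3 * B + 5 <= (3 * B + 5) * F M ^ 2) by nra. lra. }
split; auto.
assert (HN' := INR_ge1 N HN). assert (HF2 := F_sqr_le M M1).
apply Rmult_le_reg_l with (2 * INR N); [lra|].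
replace (2 * INR N * (1 / (2 * INR N) * w ^ 2)) with (w ^ 2) by (field; lra).
apply Rle_trans with ((U + 3 * B + 5) * INR N).
- eapply Rle_trans; [exact A|]. apply Rmult_le_compat_l; lra.
- assert (0 <= (U + 3 * B + 5) * INR N) by (apply Rmult_le_pos; lra). lra.
Qed.

Lemma scheme_error_bound (C U w : R) (N M : nat) : 0 <= C -> 0 <= U -> (1 <= N)%nat ->
  M = integer_part (F N) -> w ^ 2 <= U * F M ^ 2 ->
  2 * C * (1 / (2 * INR N)) * w ^ 2 <= C * U * (F M ^ 2 / INR M).
Proof.
intros HC HU HN HM Hw. destruct (integer_part_F_bounds N HN) as [M1 [_ M3]].
rewrite <- HM in M1, M3. assert (M1' := INR_ge1 M M1).
assert (I : / INR N <= / INR M) by (apply Rinv_le_contravar; lra).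
assert (I0 : 0 < / INR N) by (apply Rinv_0_lt_compat; lra).
replace (2 * C * (1 / (2 * INR N)) * w ^ 2) with (C * (w ^ 2 * / INR N)) by (field; lra).
replace (C * U * (F M ^ 2 / INR M)) with (C * (U * F M ^ 2 * / INR M)) by (field; lra).
apply Rmult_le_compat_l; auto. apply Rmult_le_compat; auto; [apply pow2_ge_0 | lra].
Qed.

End GrowthFunction.

Theorem theorem2p3 (eta : R) (eta_bounds : 0 < eta < 1 / 2)
    (F : nat -> R)
    (F_ge1 : forall n, (1 <= n)%nat -> 1 <= F n)
    (F_incr : forall m n, (1 <= m)%nat -> (m <= n)%nat -> F m <= F n)
    (F_lim : is_lim_seq F p_infty)
    (F_le : forall n, (1 <= n)%nat -> F n <= Rpower (INR n) eta)
    (B : R) :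
  (exists N0 : nat, (1 <= N0)%nat /\
     forall (alpha beta : R -> R) (lamp lamm : nat -> R),
       C2_0 alpha -> C2_0 beta -> C2_norm_le B alpha -> C2_norm_le B beta ->
       periodic_eigenvalues (q_plus alpha beta) lamp ->
       periodic_eigenvalues (q_minus alpha beta) lamm ->
       gap_condition F lamp N0 /\ gap_condition F lamm N0) /\
  (exists (K : R) (N1 : nat),
     forall (alpha beta : R -> R) (lamp lamm : nat -> R),
       C2_0 alpha -> C2_0 beta -> C2_norm_le B alpha -> C2_norm_le B beta ->
       periodic_eigenvalues (q_plus alpha beta) lamp ->
       periodic_eigenvalues (q_minus alpha beta) lamm ->
       forall N0 : nat, (1 <= N0)%nat ->
       gap_condition F lamp N0 -> gap_condition F lamm N0 ->
       forall N M : nat, (N0 <= N)%nat -> (N1 <= N)%nat ->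
       M = integer_part (F N) ->
       (forall lambda DN D : C,
          in_box F lamm M lambda ->
          is_Delta_N alpha beta N
            (RtoC (- 2)%R + RtoC (1 / (4 * INR N ^ 2))%R * lambda)%C DN ->
          is_Delta_H (q_minus alpha beta) lambda D ->
          Cmod (DN - RtoC ((- 1) ^ N)%R * D)%C <= K * (F M ^ 2 / INR M)) /\
       (forall lambda DN D : C,
          in_box F lamp M lambda ->
          is_Delta_N alpha beta N
            (RtoC 2 - RtoC (1 / (4 * INR N ^ 2))%R * lambda)%C DN ->
          is_Delta_H (q_plus alpha beta) lambda D ->
          Cmod (DN - D)%C <= K * (F M ^ 2 / INR M))).
Proof.
assert (spec_p : forall alpha beta lam, periodic_eigenvalues (q_plus alpha beta) lam ->
  periodic_eigenvalues (toda_potential alpha beta (-1)) lam).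
{ intros alpha beta lam. apply periodic_eigenvalues_ext, q_plus_toda_potential. }
assert (spec_m : forall alpha beta lam, periodic_eigenvalues (q_minus alpha beta) lam ->
  periodic_eigenvalues (toda_potential alpha beta 1) lam).
{ intros alpha beta lam. apply periodic_eigenvalues_ext, q_minus_toda_potential. }
assert (abs_p : Rabs (-1) <= 1) by (rewrite Rabs_left; lra).
assert (abs_m : Rabs 1 <= 1) by (rewrite Rabs_right; lra).
split.
- set (k0 := 36 * exp (2 * (3 * B) + 7) ^ 9).
  apply is_lim_seq_spec in F_lim.
  destruct (F_lim k0) as [m1 H1].
  (* The limit is used twice because the gap condition involves [F ([F N0])]: from [F (S m2) > S m1]
     the integer part is at least [S m1], where [F] already exceeds [k0]. *)
  destruct (F_lim (INR (S m1))) as [m2 H2].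
  exists (S m2). split; [lia|].
  assert (A : forall k, F (integer_part (F (S m2))) <= INR k -> k0 <= INR k).
  { intros k Hk. left. eapply Rlt_le_trans; [|exact Hk]. apply H1.
    apply Nat.le_trans with (S m1); [lia|]. apply integer_part_ge. left. apply H2. lia. }
  intros alpha beta lamp lamm Ha Hb Na Nb Hp Hm. split; intros k Hk; apply A in Hk; apply Rle_ge.
  + now apply (toda_potential_spectrum alpha beta B (-1) lamp Ha Hb Na Nb abs_p (spec_p _ _ _ Hp)).
  + now apply (toda_potential_spectrum alpha beta B 1 lamm Ha Hb Na Nb abs_m (spec_m _ _ _ Hm)).
(* [J] is past the threshold of [lam_upper] for [Q0 = 3 B], and [U] is the resulting factor of
   [n ^ 2]. *)
- destruct (nat_above (Rmax 1 (4 * exp (3 * B) ^ 3 * (3 * B)))) as [J HJ].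
  assert (HJ1 := Rle_trans _ _ _ (Rmax_l _ _) HJ). assert (HJ2 := Rle_trans _ _ _ (Rmax_r _ _) HJ).
  set (U := 16 * (2 * INR J + 7) ^ 2).
  assert (HU : 0 <= U) by (unfold U; assert (P := pow2_ge_0 (2 * INR J + 7)); lra).
  (* By [box_bound] this number bounds both [w ^ 2 / F M ^ 2] and [h w ^ 2]. *)
  set (kap := U + 3 * B + 5).
  destruct (nat_above B) as [n HnB].
  exists (scheme_constant B kap * kap), (S n).
  intros alpha beta lamp lamm Ha Hb Na Nb Hp Hm N0 _ _ _ N M _ HN HM.
  assert (HB := C2_bound_nonneg alpha B Na).
  assert (Hkap : 0 <= kap) by (unfold kap; lra).
  assert (HC := scheme_constant_nonneg B kap HB Hkap).
  assert (HN1 : (1 <= N)%nat) by lia.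
  assert (HN1' := INR_ge1 N HN1).
  assert (HNB : B <= INR N) by (apply Rle_trans with (INR n); auto; apply le_INR; lia).
  assert (box : forall lam z, - (3 * B) <= lam O ->
    (forall j, (1 <= j)%nat -> lam (2 * j)%nat <= U * INR j ^ 2) -> in_box F lam M z ->
    exists w, 1 <= w /\ w ^ 2 = Re z + 3 * B + 3 /\ Rabs (Im z) <= 2 /\
      w ^ 2 <= kap * F M ^ 2 /\ 1 / (2 * INR N) * w ^ 2 <= kap).
  { intros lam z Hlo Hup Hz. exists (sqrt (Re z + 3 * B + 3)).
    assert (Hz' := Hz). destruct Hz' as [[Z1 _] [Z2 Z3]].
    assert (W2 : sqrt (Re z + 3 * B + 3) ^ 2 = Re z + 3 * B + 3) by (apply pow2_sqrt; lra).
    split; [|split; [|split]]; auto.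
    - rewrite <- sqrt_1 at 1. apply sqrt_le_1; lra.
    - apply Rabs_le. lra.
    - apply (box_bound eta F eta_bounds F_ge1 F_le B U _ lam N M z); auto. }
  split; intros lambda DN D Hbox HDN HD.
  + destruct (toda_potential_spectrum alpha beta B 1 lamm Ha Hb Na Nb abs_m (spec_m _ _ _ Hm))
      as [Lo [_ Up]].
    destruct (box lamm lambda Lo (fun j => Up J j HJ1 HJ2) Hbox) as [w [W1 [W2 [W3 [W4 W5]]]]].
    eapply Rle_trans; [apply (Delta_minus_comparison alpha beta B kap w N lambda); auto|].
    apply (scheme_error_bound eta); auto.
  + destruct (toda_potential_spectrum alpha beta B (-1) lamp Ha Hb Na Nb abs_p (spec_p _ _ _ Hp))
      as [Lo [_ Up]].
    destruct (box lamp lambda Lo (fun j => Up J j HJ1 HJ2) Hbox) as [w [W1 [W2 [W3 [W4 W5]]]]].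
    eapply Rle_trans; [apply (Delta_plus_comparison alpha beta B kap w N lambda); auto|].
    apply (scheme_error_bound eta); auto.
Qed.
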